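(* Let $n\ge 1$ and $m\ge 2$ be integers and let $1<q<\frac{2m}{m-1}$. Let $M_q$ be a positive integer satisfying $$M_q>\frac{m(m-1)n}{2m-(m-1)q}.$$ Then there is a constant $C>0$, depending only on $n,m,q,M_q$, such that the following holds. Suppose that $\sigma\in L^q((\mathbb R^n)^m)\cap \mathscr C^{M_q}((\mathbb R^n)^m)$ satisfies $$\|\partial^\alpha\sigma\|_{L^\infty((\mathbb R^n)^m)}\le D_0\qquad\text{for all multi-indices } |\alpha|\le M_q .$$ Then for all Schwartz functions $f_1,\dots,f_m$ on $\mathbb R^n$, $$\|T_\sigma(f_1,\dots,f_m)\|_{L^{2/m}(\mathbb R^n)}\le C\, D_0^{1-\frac{(m-1)q}{2m}}\,\|\sigma\|_{L^q((\mathbb R^n)^m)}^{\frac{(m-1)q}{2m}}\,\prod_{j=1}^m\|f_j\|_{L^2(\mathbb R^n)} .$$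
   Context: The Fourier transform is $\widehat f(\xi)=\int_{\mathbb R^n}f(x)e^{-2\pi i\langle x,\xi\rangle}\,dx$. For a bounded measurable function $\sigma$ on $(\mathbb R^n)^m$ the $m$-linear multiplier operator $T_\sigma$ is defined for Schwartz functions $f_1,\dots,f_m$ on $\mathbb R^n$ by $$T_\sigma(f_1,\dots,f_m)(x)=\int_{(\mathbb R^n)^m}\sigma(\xi_1,\dots,\xi_m)\Big(\prod_{j=1}^m\widehat{f_j}(\xi_j)\Big)e^{2\pi i\langle x,\xi_1+\cdots+\xi_m\rangle}\,d\xi_1\cdots d\xi_m,\qquad x\in\mathbb R^n.$$ For $0<p<\infty$, $\|g\|_{L^p}=(\int|g|^p)^{1/p}$ (a quasi-norm if $p<1$). *)

(* Defs.v *)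
From HB Require Import structures.
From mathcomp Require Import all_boot all_order all_algebra.
From mathcomp Require Import complex.
From mathcomp Require Import all_classical all_reals all_analysis.

Set Implicit Arguments.
Unset Strict Implicit.
Unset Printing Implicit Defensive.

Import Order.TTheory GRing.Theory Num.Theory.
Import numFieldNormedType.Exports.

Local Open Scope classical_set_scope.
Local Open Scope ring_scope.

(* R^n is 'rV[R]_n, and (R^n)^m is 'M[R]_(m, n): the point (xi_1, ..., xi_m)
   is the matrix whose j-th row is xi_j. *)

Definition matrix_display : measure_display.
Proof. exact: default_measure_display. Qed.

(* Product (= Borel) sigma-algebra, generated by the coordinate functions. *)
Section matrix_measurable.
Variables (R : realType) (m n : nat).

Definition matrix_cylinders : set (set 'M[R]_(m, n)) :=
  \bigcup_(ij in [set: 'I_m * 'I_n])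
    preimage_set_system setT (fun A : 'M[R]_(m, n) => A ij.1 ij.2) measurable.

Let matrix_set0 : <<s matrix_cylinders >> set0.
Proof. exact: sigma_algebra0. Qed.

Let matrix_setC A : <<s matrix_cylinders >> A -> <<s matrix_cylinders >> (~` A).
Proof. exact: sigma_algebraC. Qed.

Let matrix_bigcup (F : (set 'M[R]_(m, n))^nat) :
  (forall i, <<s matrix_cylinders >> (F i)) ->
  <<s matrix_cylinders >> (\bigcup_i F i).
Proof. exact: sigma_algebra_bigcup. Qed.

HB.instance Definition _ := @isMeasurable.Build matrix_display 'M[R]_(m, n)
  <<s matrix_cylinders >> matrix_set0 matrix_setC matrix_bigcup.

Lemma measurable_entry (i : 'I_m) (j : 'I_n) :
  measurable_fun [set: 'M[R]_(m, n)] (fun A => A i j).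
Proof.
move=> _ Y mY; apply: sub_sigma_algebra; exists (i, j) => //.
by exists Y.
Qed.

Lemma measurable_fun_matrixP d (T : measurableType d) (f : T -> 'M[R]_(m, n)) :
  (forall i j, measurable_fun [set: T] (fun x => f x i j)) ->
  measurable_fun [set: T] f.
Proof.
move=> mf; apply: (@measurability _ _ _ _ _ _ matrix_cylinders) => //.
move=> _ [_ [[i j] _ [B mB <-]] <-].
by rewrite 2!setTI -comp_preimage -[X in measurable X]setTI; exact: mf.
Qed.

End matrix_measurable.

Section lebesgue.
Variable R : realType.

Definition row_cons n (p : measurableTypeR R * 'rV[R]_n) : 'rV[R]_n.+1 :=
  row_mx (p.1)%:M p.2.

Definition mx_cons m n (p : 'rV[R]_n * 'M[R]_(m, n)) : 'M[R]_(m.+1, n) :=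
  col_mx p.1 p.2.

(* Lebesgue measure on R^n: the n-fold product of the one on R. *)
Fixpoint lebesgue_rV n : set 'rV[R]_n -> \bar R :=
  match n with
  | 0 => dirac (0 : 'rV[R]_0)
  | k.+1 => pushforward (lebesgue_measure \x @lebesgue_rV k)%E (@row_cons k)
  end.

(* Lebesgue measure on (R^n)^m: the m-fold product of the one on R^n. *)
Fixpoint lebesgue_mx m n : set 'M[R]_(m, n) -> \bar R :=
  match m with
  | 0 => dirac (0 : 'M[R]_(0, n))
  | k.+1 => pushforward (@lebesgue_rV n \x @lebesgue_mx k n)%E (@mx_cons k n)
  end.

Lemma measurable_row_cons n : measurable_fun setT (@row_cons n).
Proof.
apply: measurable_fun_matrixP => i j; rewrite /row_cons.
have [k ->|k ->] := split_ordP (j : 'I_(1 + n)).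
- rewrite (_ : (fun x => _) = fst) ?(@measurable_fst)//.
  by apply/funext => p; rewrite (@row_mxEl _ 1 1 n) mxE !ord1 eqxx mulr1n.
- rewrite (_ : (fun x => _) = (fun v : 'rV[R]_n => v i k) \o snd).
    exact: measurableT_comp (measurable_entry _ _) measurable_snd.
  by apply/funext => p; rewrite (@row_mxEr _ 1 1 n).
Qed.

Lemma measurable_mx_cons m n : measurable_fun setT (@mx_cons m n).
Proof.
apply: measurable_fun_matrixP => i j; rewrite /mx_cons.
have [k ->|k ->] := split_ordP (i : 'I_(1 + m)).
- rewrite (_ : (fun x => _) = (fun v : 'rV[R]_n => v k j) \o fst).
    exact: measurableT_comp (measurable_entry _ _) measurable_fst.
  by apply/funext => p; rewrite (@col_mxEu _ 1 m n).
- rewrite (_ : (fun x => _) = (fun A : 'M[R]_(m, n) => A k j) \o snd).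
    exact: measurableT_comp (measurable_entry _ _) measurable_snd.
  by apply/funext => p; rewrite (@col_mxEd _ 1 m n).
Qed.

Lemma sigma_finite_pushforward d1 d2 (T1 : measurableType d1)
    (T2 : measurableType d2) (mu : {measure set T1 -> \bar R})
    (f : T1 -> T2) (g : T2 -> T1) :
  sigma_finite setT mu -> measurable_fun setT f -> measurable_fun setT g -> cancel f g ->
  exists nu : {sigma_finite_measure set T2 -> \bar R},
    pushforward mu f = nu :> (set T2 -> \bar R).
Proof.
move=> [F FT mF] mf mg fK.
pose nu0 : {measure set T2 -> \bar R} :=
  measure_function_pushforward__canonical__measure_function_Measure mu mf.
have nu0_sigma_finite : sigma_finite setT nu0.
  exists (fun i => g @^-1` F i).
    by rewrite -preimage_bigcup -FT preimage_setT.
  move=> i; have [mFi muFi] := mF i; split.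
    by rewrite -[X in measurable X]setTI; exact: mg.
  by rewrite /nu0 /= /pushforward -comp_preimage (_ : g \o f = id)//;
    apply/funext => x /=; rewrite fK.
pose nu1 := isSigmaFinite.Build _ _ _ nu0 nu0_sigma_finite.
pose nu2 := @isSFinite.Build _ _ _ nu0
  (sfinite_measure_sigma_finite nu0_sigma_finite).
pose nu : {sigma_finite_measure set T2 -> \bar R} :=
  HB.pack (nu0 : set T2 -> \bar R) nu0 nu1 nu2.
by exists nu.
Qed.

Lemma sigma_finite_product d1 d2 (T1 : measurableType d1)
    (T2 : measurableType d2) (mu : {sigma_finite_measure set T1 -> \bar R})
    (nu : {sigma_finite_measure set T2 -> \bar R}) :
  sigma_finite setT (mu \x nu)%E.
Proof.
have /sigma_finiteP[F [FT ndF Foo]] := sigma_finiteT mu.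
have /sigma_finiteP[G [GT ndG Goo]] := sigma_finiteT nu.
exists (fun n => F n `*` G n).
  rewrite -setXTT FT GT predeqE => -[x y]; split.
    move=> [/= [n _ Fnx] [k _ Gky]]; exists (maxn n k) => //; split.
    - by move: x Fnx; exact/subsetPset/ndF/leq_maxl.
    - by move: y Gky; exact/subsetPset/ndG/leq_maxr.
  by move=> [n _ []/= ? ?]; split; exists n.
move=> k; have [? ?] := Foo k; have [? ?] := Goo k.
split; first exact: measurableX.
by rewrite product_measure1E// lte_mul_pinfty// ge0_fin_numE.
Qed.

Lemma lebesgue_rV_sigma_finite n :
  exists nu : {sigma_finite_measure set 'rV[R]_n -> \bar R},
    @lebesgue_rV n = nu :> (set 'rV[R]_n -> \bar R).
Proof.
elim: n => [|n [mu muE]] /=; first by exists (dirac (0 : 'rV[R]_0)).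
pose pm : {measure set (measurableTypeR R * 'rV[R]_n)%type -> \bar R} :=
  [the {measure set _ -> \bar R} of (lebesgue_measure \x mu)%E].
rewrite muE; apply: (@sigma_finite_pushforward _ _ _ _ pm _
  (fun v : 'rV[R]_n.+1 => (v 0 0 : measurableTypeR R, rsubmx (v : 'rV[R]_(1 + n))))).
- exact: sigma_finite_product.
- exact: measurable_row_cons.
- apply: measurable_fun_pair => /=; first exact: measurable_entry.
  apply: measurable_fun_matrixP => i j.
  by under eq_fun do rewrite mxE; exact: measurable_entry.
- move=> [x v]; rewrite /row_cons row_mxKr; congr pair.
  have -> : 0 = lshift n (0 : 'I_1) by apply: val_inj.
  by rewrite (@row_mxEl _ 1 1 n) mxE eqxx mulr1n.
Qed.

Lemma lebesgue_mx_sigma_finite m n :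
  exists nu : {sigma_finite_measure set 'M[R]_(m, n) -> \bar R},
    @lebesgue_mx m n = nu :> (set 'M[R]_(m, n) -> \bar R).
Proof.
elim: m => [|m [mu muE]] /=; first by exists (dirac (0 : 'M[R]_(0, n))).
have [rho rhoE] := lebesgue_rV_sigma_finite n.
pose pm : {measure set ('rV[R]_n * 'M[R]_(m, n))%type -> \bar R} :=
  [the {measure set _ -> \bar R} of (rho \x mu)%E].
rewrite rhoE muE; apply: (@sigma_finite_pushforward _ _ _ _ pm _
  (fun A : 'M[R]_(m.+1, n) =>
    (usubmx (A : 'M[R]_(1 + m, n)), dsubmx (A : 'M[R]_(1 + m, n))))).
- exact: sigma_finite_product.
- exact: measurable_mx_cons.
- by apply: measurable_fun_pair => /=; apply: measurable_fun_matrixP => i j;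
    under eq_fun do rewrite mxE; exact: measurable_entry.
- by move=> [v A]; rewrite /mx_cons col_mxKu col_mxKd.
Qed.

Section rV.
Variable n : nat.

Let rV0 : @lebesgue_rV n set0 = 0%E.
Proof. by have [nu ->] := lebesgue_rV_sigma_finite n. Qed.

Let rV_ge0 A : (0 <= @lebesgue_rV n A)%E.
Proof. by have [nu ->] := lebesgue_rV_sigma_finite n; exact: measure_ge0. Qed.

Let rV_additive : semi_sigma_additive (@lebesgue_rV n).
Proof.
have [nu ->] := lebesgue_rV_sigma_finite n.
exact: measure_semi_sigma_additive.
Qed.

Let rV_sigma_finite : sigma_finite setT (@lebesgue_rV n).
Proof. by have [nu ->] := lebesgue_rV_sigma_finite n; exact: sigma_finiteT. Qed.

HB.instance Definition _ := isMeasure.Build _ _ _ (@lebesgue_rV n)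
  rV0 rV_ge0 rV_additive.

HB.instance Definition _ := Measure_isSigmaFinite.Build _ _ _ (@lebesgue_rV n)
  rV_sigma_finite.

End rV.

Section mx.
Variables m n : nat.

Let mx0 : @lebesgue_mx m n set0 = 0%E.
Proof. by have [nu ->] := lebesgue_mx_sigma_finite m n. Qed.

Let mx_ge0 A : (0 <= @lebesgue_mx m n A)%E.
Proof. by have [nu ->] := lebesgue_mx_sigma_finite m n; exact: measure_ge0. Qed.

Let mx_additive : semi_sigma_additive (@lebesgue_mx m n).
Proof.
have [nu ->] := lebesgue_mx_sigma_finite m n.
exact: measure_semi_sigma_additive.
Qed.

Let mx_sigma_finite : sigma_finite setT (@lebesgue_mx m n).
Proof. by have [nu ->] := lebesgue_mx_sigma_finite m n; exact: sigma_finiteT. Qed.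

HB.instance Definition _ := isMeasure.Build _ _ _ (@lebesgue_mx m n)
  mx0 mx_ge0 mx_additive.

HB.instance Definition _ := Measure_isSigmaFinite.Build _ _ _ (@lebesgue_mx m n)
  mx_sigma_finite.

End mx.

End lebesgue.
Arguments lebesgue_rV {R} n.
Arguments lebesgue_mx {R} m n.

Local Open Scope complex_scope.

Section complex_functions.
Variable R : realType.

Definition cmod (z : R[i]) : R := ComplexField.Normc.normc z.

Definition cintegral d (T : measurableType d) (mu : {measure set T -> \bar R})
    (f : T -> R[i]) : R[i] :=
  (\int[mu]_x complex.Re (f x)) +i* (\int[mu]_x complex.Im (f x)).

Definition cLnorm d (T : measurableType d) (mu : {measure set T -> \bar R})
    (p : \bar R) (f : T -> R[i]) : \bar R :=
  ('N[mu]_p[EFin \o cmod \o f])%E.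

Definition in_Lp d (T : measurableType d) (mu : {measure set T -> \bar R})
    (p : \bar R) (f : T -> R[i]) : Prop :=
  [/\ measurable_fun setT (fun x => complex.Re (f x)),
      measurable_fun setT (fun x => complex.Im (f x)) &
      (cLnorm mu p f < +oo)%E].

(* e^{2 pi i t} *)
Definition e2pi (t : R) : R[i] := cos (2 * pi * t) +i* sin (2 * pi * t).

End complex_functions.

Section smoothness.
Variables (R : realType) (m n : nat).
Implicit Types (g : 'M[R]_(m, n) -> R) (f : 'M[R]_(m, n) -> R[i]).

Definition partial (i : 'I_m) (j : 'I_n) g : 'M[R]_(m, n) -> R :=
  fun x => 'D_(delta_mx i j) g x.

(* Continuity and partial derivatives of a complex-valued function are those of
   its real and imaginary parts. *)
Fixpoint Ck_real (k : nat) g : Prop :=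
  continuous g /\
  match k with
  | 0 => True
  | l.+1 => forall i j,
      (forall x, derivable g x (delta_mx i j)) /\ Ck_real l (partial i j g)
  end.

Definition Ck (k : nat) f : Prop :=
  Ck_real k (fun x => complex.Re (f x)) /\ Ck_real k (fun x => complex.Im (f x)).

(* Multi-indices on (R^n)^m are matrices of naturals; the partials are taken in
   a fixed order, which is immaterial for functions of class C^|a|. *)
Definition mdeg (a : 'M[nat]_(m, n)) : nat := (\sum_i \sum_j a i j)%N.

Definition mpartial_real (a : 'M[nat]_(m, n)) g : 'M[R]_(m, n) -> R :=
  foldr (fun ij : 'I_m * 'I_n => iter (a ij.1 ij.2) (partial ij.1 ij.2)) g
    (enum {: 'I_m * 'I_n}).

Definition mpartial (a : 'M[nat]_(m, n)) f : 'M[R]_(m, n) -> R[i] :=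
  fun x => mpartial_real a (fun y => complex.Re (f y)) x +i*
           mpartial_real a (fun y => complex.Im (f y)) x.

Definition mpower (a : 'M[nat]_(m, n)) (x : 'M[R]_(m, n)) : R :=
  \prod_i \prod_j x i j ^+ a i j.

Definition schwartz f : Prop :=
  (forall k, Ck k f) /\
  forall a b : 'M[nat]_(m, n), exists K : R, forall x,
    `|mpower a x| * cmod (mpartial b f x) <= K.

End smoothness.

Section multiplier.
Variable R : realType.

Definition dot n (x y : 'rV[R]_n) : R := \sum_i x 0 i * y 0 i.

Definition fourier n (f : 'rV[R]_n -> R[i]) (xi : 'rV[R]_n) : R[i] :=
  cintegral (lebesgue_rV n) (fun x => f x * e2pi (- dot x xi)).

Definition multiplier_op m n (sigma : 'M[R]_(m, n) -> R[i])
    (f : 'I_m -> 'rV[R]_n -> R[i]) (x : 'rV[R]_n) : R[i] :=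
  cintegral (lebesgue_mx m n) (fun xi =>
    sigma xi * (\prod_(j < m) fourier (f j) (row j xi)) *
    e2pi (dot x (\sum_(j < m) row j xi))).

End multiplier.

(* Main.v *)
Require Import Defs.
From mathcomp Require Import all_boot all_order all_algebra.
From mathcomp Require Import complex.
From mathcomp Require Import all_classical all_reals all_analysis.
From mathcomp Require Import measurable_realfun ess_sup_inf qpoly.
From mathcomp Require Import ring lra.

Set Implicit Arguments.
Unset Strict Implicit.
Unset Printing Implicit Defensive.

Import Order.TTheory GRing.Theory Num.Theory.
Import numFieldNormedType.Exports.

Local Open Scope classical_set_scope.
Local Open Scope ring_scope.

(* Split the symbol into its real and imaginary parts.  On a large box let
   [P_l sigma] be the projection of [sigma] onto piecewise polynomials of degree
   less than [M] in each variable, over the dyadic cells of side [2^-l].  These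
   projections are nested, so that [P_l sigma] is a sum of pieces
   [P_l (sigma - P_(l-1) sigma) = \sum_k b_k w_k], where the [w_k] are tensor
   products of functions on R^n.  Taylor's formula and the bounds on the
   derivatives give [|b_k| <= C D0 2^(-l M)], and boundedness of the projections on
   L^q gives [\sum_k |b_k|^q <= C 2^(l m n) ||sigma||_q^q]; together they control
   [\sum_k |b_k|^(2m/(m-1))].  That exponent suffices to bound the operator of one
   piece in L^(2/m): the index set of the tensor sum is divided into [m] parts so
   that on the i-th part the squares of [b] are summable along the slices
   orthogonal to the i-th index, and Cauchy-Schwarz, Plancherel and the inequality
   of the means apply.  The lower bound on [M] makes the sum over [l]
   geometric, and Fatou's lemma removes the truncation. *)

(** Put q_c = 2m/(m-1). Interpolating between the two bounds on the coefficients of level l gives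
    \sum_k |b_k|^q_c <= C (D0 2^(-l M))^(q_c - q) 2^(l m n) ||sigma||_q^q. This decays geometrically
    in l when M (q_c - q) > m n, which is the hypothesis on M with the denominator cleared and m - 1
    divided out; the root of order q_c carries the powers 1 - q/q_c of D0 and q/q_c of ||sigma||_q.
    The slices dictate q_c: with beta = |b|^(2/(m-1)) one has beta^m = |b|^q_c and beta^(m-1) = b^2,
    so a bound on the total of beta^m becomes a bound on sums of squares along slices. Since L^(2/m)
    is in general only quasi-normed, the subadditivity of t^(2/m) replaces the triangle inequality,
    both for the m parts and for the levels. The pieces w_k are not orthonormal: what is used is
    their bounded overlap, their bounded mass and the nonnegativity of the dual functions,
    properties that pass to tensor products. Constants may be lossy, so Plancherel is only needed as
    an inequality with a constant depending on n. *)

(** * Real integrals and Fubini *)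

Section integrals.
Context d (T : measurableType d) (R : realType) (mu : {measure set T -> \bar R}).
Implicit Types f g h : T -> R.

Definition rintegrable f := mu.-integrable setT (EFin \o f).

Lemma rintegrable_measurable f : rintegrable f -> measurable_fun setT f.
Proof. by move=> /measurable_int/measurable_EFinP. Qed.

Lemma rintegrable_le f g : measurable_fun setT f -> rintegrable g ->
  (forall x, `|f x| <= g x) -> rintegrable f.
Proof.
move=> mf ig fg; apply: (le_integrable measurableT _ _ ig).
  exact/measurable_EFinP.
move=> x _; rewrite /= lee_fin (le_trans (fg x))//; exact: ler_norm.
Qed.

Lemma rintegrable_norm f : rintegrable f -> rintegrable (fun x => `|f x|).
Proof. exact: integrable_norm. Qed.

Lemma rintegrableZl c f : rintegrable f -> rintegrable (fun x => c * f x).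
Proof.
by move=> /(integrableZl measurableT c); apply: eq_integrable => // x _.
Qed.

Lemma rintegrableD f g : rintegrable f -> rintegrable g ->
  rintegrable (fun x => f x + g x).
Proof.
move=> hf hg; have := integrableD measurableT hf hg.
by apply: eq_integrable => // x _.
Qed.

Lemma rintegrableB f g : rintegrable f -> rintegrable g ->
  rintegrable (fun x => f x - g x).
Proof.
move=> hf hg; have := integrableB measurableT hf hg.
by apply: eq_integrable => // x _.
Qed.

Lemma rintegrable0 : rintegrable (fun=> 0).
Proof. exact: integrable0. Qed.

Lemma rintegrable_sum (I : Type) (s : seq I) (F : I -> T -> R) :
  (forall i, rintegrable (F i)) -> rintegrable (fun x => \sum_(i <- s) F i x).
Proof.
move=> hF; elim: s => [|i s ih].
  by under eq_fun do rewrite big_nil; exact: rintegrable0.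
by under eq_fun do rewrite big_cons; exact: rintegrableD.
Qed.

Lemma Rintegral_sum (I : Type) (s : seq I) (F : I -> T -> R) :
  (forall i, rintegrable (F i)) ->
  \int[mu]_x (\sum_(i <- s) F i x) = \sum_(i <- s) \int[mu]_x F i x.
Proof.
move=> hF; elim: s => [|i s ih].
  rewrite big_nil (_ : (fun x => _) = cst 0).
    by rewrite /Rintegral integral0.
  by apply/funext => x; rewrite big_nil.
rewrite big_cons -ih -RintegralD//; [|exact: hF|exact: rintegrable_sum].
by apply: eq_Rintegral => x _; rewrite big_cons.
Qed.

Lemma rintegrable_bounded f g (c : R) : rintegrable f -> measurable_fun setT g ->
  (forall x, `|g x| <= c) -> rintegrable (fun x => f x * g x).
Proof.
move=> hf mg gc; apply: (@rintegrable_le _ (fun x => c * `|f x|)).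
- by apply: measurable_funM => //; exact: rintegrable_measurable.
- exact/rintegrableZl/rintegrable_norm.
- by move=> x; rewrite normrM mulrC ler_wpM2r.
Qed.

Lemma Rintegral_EFin f : rintegrable f ->
  (\int[mu]_x (f x)%:E = (\int[mu]_x f x)%:E)%E.
Proof. by move=> hf; rewrite /Rintegral fineK//; exact: integrable_fin_num. Qed.

Lemma ge0_rintegrable f (c : \bar R) : measurable_fun setT f ->
  (forall x, 0 <= f x) -> (c < +oo)%E -> (\int[mu]_x (f x)%:E <= c)%E ->
  rintegrable f.
Proof.
move=> mf f0 cy fc; apply/integrableP; split; first exact/measurable_EFinP.
apply: le_lt_trans cy; apply: le_trans fc.
by under eq_integral do rewrite /= ger0_norm//.
Qed.

Lemma le_Rintegral_norm f g : rintegrable f -> rintegrable g ->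
  (forall x, `|f x| <= g x) -> `|\int[mu]_x f x| <= \int[mu]_x g x.
Proof.
move=> hf hg fg; apply: (le_trans (le_normr_Rintegral measurableT hf)).
by apply: le_Rintegral => //; exact: rintegrable_norm.
Qed.

Lemma fatou_le (f_ : nat -> T -> R) (f : T -> R) (c : \bar R) :
  (forall n, measurable_fun setT (f_ n)) -> (forall n x, 0 <= f_ n x) ->
  (forall x, f_ n x @[n --> \oo] --> f x) ->
  (forall n, (\int[mu]_x (f_ n x)%:E <= c)%E) -> (\int[mu]_x (f x)%:E <= c)%E.
Proof.
move=> mf f0 ff fc; rewrite (_ : (fun x => _) =
    (fun x => limn_einf (fun n => (f_ n x)%:E))); last first.
  apply/funext => x; have fx : (f_ n x)%:E @[n --> \oo] --> (f x)%:E.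
    by apply: cvg_EFin; [exact: nearW|exact: ff].
  by have [-> _] := cvg_limn_einf_sup fx.
apply: (@le_trans _ _ (limn_einf (fun n => \int[mu]_x (f_ n x)%:E)%E)).
  apply: fatou => //; first by move=> n; exact/measurable_EFinP.
  by move=> n x _; rewrite lee_fin.
rewrite limn_einf_lim; apply: lime_le; first exact: is_cvg_einfs.
by apply: nearW => n; apply: le_trans (fc n); apply: ereal_inf_lbound; exists n => /=.
Qed.

Lemma Rintegral_cvg_dominated (f_ : nat -> T -> R) f g :
  (forall n, measurable_fun setT (f_ n)) -> rintegrable g ->
  (forall n x, `|f_ n x| <= g x) -> (forall x, f_ n x @[n --> \oo] --> f x) ->
  rintegrable f /\ (\int[mu]_x f_ n x) @[n --> \oo] --> \int[mu]_x f x.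
Proof.
move=> mf hg fg ff.
have hf_ n : rintegrable (f_ n) by exact: rintegrable_le (mf n) hg (fg n).
have ffE x : (f_ n x)%:E @[n --> \oo] --> (f x)%:E.
  by apply: cvg_EFin; [exact: nearW|exact: ff].
have mfE : measurable_fun setT f.
  by apply/measurable_EFinP; apply: emeasurable_fun_cvg => [n|x _];
    [exact/measurable_EFinP/(mf n)|exact: ffE].
have [] := @dominated_convergence _ _ _ mu setT measurableT
  (fun n => EFin \o f_ n) (EFin \o f) (EFin \o g) => //.
- by move=> n; exact/measurable_EFinP.
- exact/measurable_EFinP.
- by apply: aeW => x _; exact: ffE.
- by apply: aeW => x n _; rewrite /= lee_fin.
- move=> hf _ cf; split => //; apply/fine_cvg.
  by rewrite -Rintegral_EFin.
Qed.

End integrals.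
Arguments rintegrable {d T R} mu f.

Section fubini_real.
Context d1 d2 (T1 : measurableType d1) (T2 : measurableType d2) (R : realType).
Variable mu : {sigma_finite_measure set T1 -> \bar R}.
Variable nu : {sigma_finite_measure set T2 -> \bar R}.

Variables (u : T1 -> R) (v : T2 -> R) (F : T1 * T2 -> R).
Hypotheses (hu : rintegrable mu u) (hv : rintegrable nu v).
Hypothesis mF : measurable_fun setT F.
Hypothesis Fuv : forall x y, `|F (x, y)| <= `|u x| * `|v y|.

(** The product majorant makes every section integrable, not merely almost every one, so the
    iterated integrals are real-valued everywhere and no exceptional null set has to be carried
    along. *)
Lemma fubini_sectionl x : rintegrable nu (fun y => F (x, y)).
Proof.
apply: (@rintegrable_le _ _ _ _ _ (fun y => `|u x| * `|v y|)) => //.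
- exact: measurableT_comp mF (pair1_measurable x).
- exact/rintegrableZl/rintegrable_norm.
Qed.

Lemma fubini_sectionr y : rintegrable mu (fun x => F (x, y)).
Proof.
apply: (@rintegrable_le _ _ _ _ _ (fun x => `|v y| * `|u x|)) => //.
- exact: measurableT_comp mF (pair2_measurable y).
- exact/rintegrableZl/rintegrable_norm.
- by move=> x; rewrite mulrC.
Qed.

Lemma fubini_integrable : rintegrable (mu \x nu)%E F.
Proof.
apply/(integrable12ltyP mu nu); first exact/measurable_EFinP.
apply: (@le_lt_trans _ _ (\int[mu]_x ((\int[nu]_y `|v y|) * `|u x|)%:E)%E).
  apply: ge0_le_integral => //.
  - by move=> x _; exact: integral_ge0.
  - apply: (measurable_fun_fubini_tonelli_F (fun z => `|(F z)%:E|%E)) => //.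
    by apply: measurableT_comp => //; exact/measurable_EFinP.
  - apply/measurable_EFinP/measurable_funM => //.
    by apply: measurableT_comp => //; exact: rintegrable_measurable hu.
  - move=> x _; rewrite mulrC -RintegralZl//; last exact: rintegrable_norm.
    rewrite -Rintegral_EFin; last exact/rintegrableZl/rintegrable_norm.
    apply: ge0_le_integral => //.
    + apply: measurableT_comp => //; apply/measurable_EFinP.
      exact/rintegrable_measurable/fubini_sectionl.
    + apply/measurable_EFinP/measurable_funM => //.
      by apply: measurableT_comp => //; exact: rintegrable_measurable hv.
    + by move=> y _; rewrite /= lee_fin.
by rewrite Rintegral_EFin ?ltry//; exact/rintegrableZl/rintegrable_norm.
Qed.

Lemma fubini_fstE x :
  fubini_F nu (EFin \o F) x = (\int[nu]_y F (x, y))%:E.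
Proof. by rewrite /fubini_F Rintegral_EFin//; exact: fubini_sectionl. Qed.

Lemma fubini_sndE y :
  fubini_G mu (EFin \o F) y = (\int[mu]_x F (x, y))%:E.
Proof. by rewrite /fubini_G Rintegral_EFin//; exact: fubini_sectionr. Qed.

Lemma fubini_integrable_fst : rintegrable mu (fun x => \int[nu]_y F (x, y)).
Proof.
apply: (eq_integrable measurableT) (integrable_fubini_F fubini_integrable) => x _.
exact: fubini_fstE.
Qed.

Lemma fubini_integrable_snd : rintegrable nu (fun y => \int[mu]_x F (x, y)).
Proof.
apply: (@rintegrable_le _ _ _ _ _ (fun y => (\int[mu]_x `|u x|) * `|v y|)).
- apply/measurable_EFinP.
  apply: (eq_measurable_fun _ _ (measurable_fubini_G fubini_integrable)) => y _.
  exact: fubini_sndE.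
- exact/rintegrableZl/rintegrable_norm.
- move=> y; rewrite -RintegralZr//; last exact: rintegrable_norm.
  apply: le_Rintegral_norm => //; first exact: fubini_sectionr.
  under eq_fun do rewrite mulrC.
  exact/rintegrableZl/rintegrable_norm.
Qed.

Lemma Rintegral_prod1 : \int[(mu \x nu)%E]_z F z = \int[mu]_x \int[nu]_y F (x, y).
Proof.
rewrite {1}/Rintegral -(integral12_prod_meas1 fubini_integrable).
by congr fine; apply: eq_integral => x _; exact: fubini_fstE.
Qed.

Lemma Rintegral_prod2 : \int[(mu \x nu)%E]_z F z = \int[nu]_y \int[mu]_x F (x, y).
Proof.
rewrite {1}/Rintegral -(integral21_prod_meas1 fubini_integrable).
by congr fine; apply: eq_integral => x _; exact: fubini_sndE.
Qed.

Lemma Rintegral_swap :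
  \int[mu]_x \int[nu]_y F (x, y) = \int[nu]_y \int[mu]_x F (x, y).
Proof. by rewrite -Rintegral_prod1 Rintegral_prod2. Qed.

End fubini_real.

(** Integrability is not assumed: the integral is the difference of the integrals of the positive
    and negative parts, and each of these is measurable in the parameter by Tonelli's theorem. *)
Lemma measurable_integral_param d1 d2 (T1 : measurableType d1)
    (T2 : measurableType d2) (R : realType)
    (nu : {sigma_finite_measure set T2 -> \bar R}) (f : T1 * T2 -> \bar R) :
  measurable_fun setT f -> measurable_fun setT (fun x => \int[nu]_y f (x, y))%E.
Proof.
move=> mf; rewrite (_ : (fun x => _) =
    (fun x => \int[nu]_y f^\+ (x, y) - \int[nu]_y f^\- (x, y))%E).
  apply: emeasurable_funB.
  - apply: (measurable_fun_fubini_tonelli_F f^\+%E) => //.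
    exact: measurable_funepos.
  - apply: (measurable_fun_fubini_tonelli_F f^\-%E) => //.
    exact: measurable_funeneg.
apply/funext => x; rewrite [LHS]integralE.
under eq_integral do rewrite funepos_comp/=.
by under [X in (_ - X)%E = _]eq_integral do rewrite funeneg_comp/=.
Qed.

Lemma measurable_Rintegral_param d1 d2 (T1 : measurableType d1)
    (T2 : measurableType d2) (R : realType)
    (nu : {sigma_finite_measure set T2 -> \bar R}) (F : T1 * T2 -> R) :
  measurable_fun setT F -> measurable_fun setT (fun x => \int[nu]_y F (x, y)).
Proof.
move=> mF; apply: measurableT_comp; first exact: fine_measurable.
apply: (@measurable_integral_param _ _ _ _ R nu (EFin \o F)).
exact/measurable_EFinP.
Qed.

Section prod_integral.
Context d1 d2 (T1 : measurableType d1) (T2 : measurableType d2) (R : realType).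
Variable mu : {sigma_finite_measure set T1 -> \bar R}.
Variable nu : {sigma_finite_measure set T2 -> \bar R}.

Lemma rintegrable_prod (u : T1 -> R) (v : T2 -> R) :
  rintegrable mu u -> rintegrable nu v ->
  rintegrable (mu \x nu)%E (fun z => u z.1 * v z.2).
Proof.
move=> hu hv; apply: (@fubini_integrable _ _ _ _ _ mu nu u v) => //.
  apply: measurable_funM; apply: measurableT_comp => //.
    exact: rintegrable_measurable hu.
  exact: rintegrable_measurable hv.
by move=> x y /=; rewrite normrM.
Qed.

Lemma Rintegral_prod (u : T1 -> R) (v : T2 -> R) :
  rintegrable mu u -> rintegrable nu v ->
  \int[(mu \x nu)%E]_z (u z.1 * v z.2) = (\int[mu]_x u x) * \int[nu]_y v y.
Proof.
move=> hu hv; rewrite (@Rintegral_prod1 _ _ _ _ _ mu nu u v)//=.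
- rewrite -RintegralZr//; apply: eq_Rintegral => x _.
  by rewrite RintegralZl.
- apply: measurable_funM; apply: measurableT_comp => //.
    exact: rintegrable_measurable hu.
  exact: rintegrable_measurable hv.
- by move=> x y /=; rewrite normrM.
Qed.

End prod_integral.

(** * Lebesgue measure on R^n and (R^n)^m *)

Section rV_peel.
Context (R : realType).
Local Notation leb := (@lebesgue_measure R).

Lemma row_cons0 n (p : measurableTypeR R * 'rV[R]_n) : row_cons p 0 ord0 = p.1.
Proof.
have -> : ord0 = lshift n (0 : 'I_1) by apply: val_inj.
by rewrite /row_cons (@row_mxEl _ 1 1 n) mxE eqxx mulr1n.
Qed.

Lemma row_consS n (p : measurableTypeR R * 'rV[R]_n) i :
  row_cons p 0 (lift ord0 i) = p.2 0 i.
Proof.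
have -> : lift ord0 i = rshift 1 i by apply: val_inj.
by rewrite /row_cons (@row_mxEr _ 1 1 n).
Qed.

Lemma row_mx_cons0 m n (p : 'rV[R]_n * 'M[R]_(m, n)) : row ord0 (mx_cons p) = p.1.
Proof.
apply/rowP => j; rewrite mxE; have -> : ord0 = lshift m (0 : 'I_1) by apply: val_inj.
by rewrite /mx_cons (@col_mxEu _ 1 m n).
Qed.

Lemma row_mx_consS m n (p : 'rV[R]_n * 'M[R]_(m, n)) i :
  row (lift ord0 i) (mx_cons p) = row i p.2.
Proof.
apply/rowP => j; rewrite [RHS]mxE mxE; have -> : lift ord0 i = rshift 1 i by apply: val_inj.
by rewrite /mx_cons (@col_mxEd _ 1 m n).
Qed.

Lemma row_cons_surj n (x : 'rV[R]_n.+1) :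
  x = row_cons (x 0 ord0 : measurableTypeR R, \row_i x 0 (lift ord0 i)).
Proof.
apply/rowP => i; case: (unliftP ord0 i) => [j ->|->].
  by rewrite row_consS mxE.
by rewrite row_cons0.
Qed.

Lemma dot_row_cons n (p r : measurableTypeR R * 'rV[R]_n) :
  dot (row_cons p) (row_cons r) = p.1 * r.1 + dot p.2 r.2.
Proof.
rewrite /dot big_ord_recl !row_cons0; congr (_ + _).
by apply: eq_bigr => i _; rewrite !row_consS.
Qed.

Local Open Scope ereal_scope.

Local Close Scope ereal_scope.

Lemma rintegrable_rV n (F : 'rV[R]_n.+1 -> R) : measurable_fun setT F ->
  rintegrable (leb \x lebesgue_rV n)%E (fun z => F (row_cons z)) ->
  rintegrable (lebesgue_rV n.+1) F.
Proof.
move=> mF iF.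
have := @integrable_pushforward _ _ _ _ R _ (@measurable_row_cons R n)
  (leb \x lebesgue_rV n)%E setT (EFin \o F).
by rewrite preimage_setT; apply => //; exact/measurable_EFinP.
Qed.

Lemma Rintegral_rV n (F : 'rV[R]_n.+1 -> R) : measurable_fun setT F ->
  rintegrable (leb \x lebesgue_rV n)%E (fun z => F (row_cons z)) ->
  \int[lebesgue_rV n.+1]_x F x = \int[(leb \x lebesgue_rV n)%E]_z F (row_cons z).
Proof.
move=> mF iF; congr fine.
have := @integral_pushforward _ _ _ _ R _ (@measurable_row_cons R n)
  (leb \x lebesgue_rV n)%E setT (EFin \o F).
by rewrite preimage_setT; apply => //; exact/measurable_EFinP.
Qed.

Lemma rintegrable_mx m n (F : 'M[R]_(m.+1, n) -> R) : measurable_fun setT F ->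
  rintegrable (lebesgue_rV n \x lebesgue_mx m n)%E (fun z => F (mx_cons z)) ->
  rintegrable (lebesgue_mx m.+1 n) F.
Proof.
move=> mF iF.
have := @integrable_pushforward _ _ _ _ R _ (@measurable_mx_cons R m n)
  (lebesgue_rV n \x lebesgue_mx m n)%E setT (EFin \o F).
by rewrite preimage_setT; apply => //; exact/measurable_EFinP.
Qed.

Lemma Rintegral_mx m n (F : 'M[R]_(m.+1, n) -> R) : measurable_fun setT F ->
  rintegrable (lebesgue_rV n \x lebesgue_mx m n)%E (fun z => F (mx_cons z)) ->
  \int[lebesgue_mx m.+1 n]_x F x =
  \int[(lebesgue_rV n \x lebesgue_mx m n)%E]_z F (mx_cons z).
Proof.
move=> mF iF; congr fine.
have := @integral_pushforward _ _ _ _ R _ (@measurable_mx_cons R m n)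
  (lebesgue_rV n \x lebesgue_mx m n)%E setT (EFin \o F).
by rewrite preimage_setT; apply => //; exact/measurable_EFinP.
Qed.

Lemma measurable_row m n (j : 'I_m) :
  measurable_fun setT (fun A : 'M[R]_(m, n) => row j A).
Proof.
apply: measurable_fun_matrixP => i k.
by under eq_fun do rewrite mxE; exact: measurable_entry.
Qed.

Lemma rintegrable_dirac d (T : measurableType d) (a : T) (F : T -> R) :
  (forall x, F x = F a) ->
  rintegrable (dirac a : {measure set T -> \bar R}) F.
Proof.
move=> cF; apply: (eq_integrable measurableT (cst (F a)%:E)).
  by move=> x _; rewrite /= (cF x).
by apply: finite_measure_integrable_cst.
Qed.

Lemma Rintegral_dirac d (T : measurableType d) (a : T) (F : T -> R) :
  (forall x, F x = F a) ->
  \int[dirac a : {measure set T -> \bar R}]_x F x = F a.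
Proof.
move=> cF; rewrite (_ : F = cst (F a)); last by apply/funext => x; rewrite (cF x).
by rewrite Rintegral_cst//= /dirac indicE in_setT mulr1.
Qed.

Lemma rintegrable_rV0 (F : 'rV[R]_0 -> R) : rintegrable (lebesgue_rV 0) F.
Proof. by apply: rintegrable_dirac => x; rewrite [x]thinmx0. Qed.

Lemma Rintegral_rV0 (F : 'rV[R]_0 -> R) : \int[lebesgue_rV 0]_x F x = F 0.
Proof. by apply: Rintegral_dirac => x; rewrite [x]thinmx0. Qed.

Lemma rintegrable_mx0 n (F : 'M[R]_(0, n) -> R) : rintegrable (lebesgue_mx 0 n) F.
Proof. by apply: rintegrable_dirac => x; rewrite [x]flatmx0. Qed.

Lemma Rintegral_mx0 n (F : 'M[R]_(0, n) -> R) : \int[lebesgue_mx 0 n]_x F x = F 0.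
Proof. by apply: Rintegral_dirac => x; rewrite [x]flatmx0. Qed.

Section fubini_rV.
Variables (n : nat) (u : R -> R) (v : 'rV[R]_n -> R) (F : 'rV[R]_n.+1 -> R).
Hypotheses (hu : rintegrable leb u) (hv : rintegrable (lebesgue_rV n) v).
Hypothesis mF : measurable_fun setT F.
Hypothesis Fuv : forall s x, `|F (row_cons (s, x))| <= `|u s| * `|v x|.

Let mFc : measurable_fun setT (fun z => F (row_cons z)).
Proof. exact: measurableT_comp mF (@measurable_row_cons R n). Qed.

Lemma Rintegral_rV1 : \int[lebesgue_rV n.+1]_x F x =
  \int[leb]_s \int[lebesgue_rV n]_x F (row_cons (s, x)).
Proof.
rewrite Rintegral_rV//; last exact: fubini_integrable hu hv _ _.
by rewrite (Rintegral_prod1 hu hv).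
Qed.

Lemma Rintegral_rV2 : \int[lebesgue_rV n.+1]_x F x =
  \int[lebesgue_rV n]_x \int[leb]_s F (row_cons (s, x)).
Proof.
rewrite Rintegral_rV//; last exact: fubini_integrable hu hv _ _.
by rewrite (Rintegral_prod2 hu hv).
Qed.

End fubini_rV.

Section fubini_mx.
Variables (m n : nat) (u : 'rV[R]_n -> R) (v : 'M[R]_(m, n) -> R).
Variable F : 'M[R]_(m.+1, n) -> R.
Hypotheses (hu : rintegrable (lebesgue_rV n) u).
Hypotheses (hv : rintegrable (lebesgue_mx m n) v).
Hypothesis mF : measurable_fun setT F.
Hypothesis Fuv : forall s x, `|F (mx_cons (s, x))| <= `|u s| * `|v x|.

Let mFc : measurable_fun setT (fun z => F (mx_cons z)).
Proof. exact: measurableT_comp mF (@measurable_mx_cons R m n). Qed.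

End fubini_mx.

Lemma measurable_prod_coord n (u : 'I_n -> R -> R) :
  (forall i, measurable_fun setT (u i)) ->
  measurable_fun setT (fun x : 'rV[R]_n => \prod_i u i (x 0 i)).
Proof.
move=> mu; apply: measurable_prod => i _ /=.
exact: measurableT_comp (mu i) (measurable_entry 0 i).
Qed.

Lemma measurable_prod_row m n (u : 'I_m -> 'rV[R]_n -> R) :
  (forall i, measurable_fun setT (u i)) ->
  measurable_fun setT (fun A : 'M[R]_(m, n) => \prod_i u i (row i A)).
Proof.
move=> mu; apply: measurable_prod => i _ /=.
exact: measurableT_comp (mu i) (measurable_row i).
Qed.

(** Integrability and value are proved together because the induction step needs the former for the
    product over the remaining coordinates. *)
Lemma prod_coord_integral n (u : 'I_n -> R -> R) :
  (forall i, rintegrable leb (u i)) ->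
  rintegrable (lebesgue_rV n) (fun x => \prod_i u i (x 0 i)) /\
  \int[lebesgue_rV n]_x \prod_i u i (x 0 i) = \prod_i \int[leb]_s u i s.
Proof.
elim: n u => [|n ih] u hu.
  by rewrite big_ord0 Rintegral_rV0 big_ord0; split => //; exact: rintegrable_rV0.
have [iv iE] := ih _ (fun i => hu (lift ord0 i)).
have mF := measurable_prod_coord (fun i => rintegrable_measurable (hu i)).
have FE (z : measurableTypeR R * 'rV[R]_n) :
    \prod_i u i (row_cons z 0 i) =
    u ord0 z.1 * \prod_i u (lift ord0 i) (z.2 0 i).
  rewrite big_ord_recl row_cons0; congr (_ * _).
  by apply: eq_bigr => i _; rewrite row_consS.
have iF := rintegrable_prod (hu ord0) iv.
split.
  by apply: rintegrable_rV => //; under eq_fun do rewrite FE.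
rewrite Rintegral_rV//; last by under eq_fun do rewrite FE.
under eq_Rintegral do rewrite FE.
by rewrite (Rintegral_prod (hu ord0) iv) iE big_ord_recl.
Qed.

Lemma prod_row_integral m n (u : 'I_m -> 'rV[R]_n -> R) :
  (forall i, rintegrable (lebesgue_rV n) (u i)) ->
  rintegrable (lebesgue_mx m n) (fun A => \prod_i u i (row i A)) /\
  \int[lebesgue_mx m n]_A \prod_i u i (row i A) =
  \prod_i \int[lebesgue_rV n]_x u i x.
Proof.
elim: m u => [|m ih] u hu.
  by rewrite big_ord0 Rintegral_mx0 big_ord0; split => //; exact: rintegrable_mx0.
have [iv iE] := ih _ (fun i => hu (lift ord0 i)).
have mF := measurable_prod_row (fun i => rintegrable_measurable (hu i)).
have FE (z : 'rV[R]_n * 'M[R]_(m, n)) :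
    \prod_i u i (row i (mx_cons z)) =
    u ord0 z.1 * \prod_i u (lift ord0 i) (row i z.2).
  rewrite big_ord_recl row_mx_cons0; congr (_ * _).
  by apply: eq_bigr => i _; rewrite row_mx_consS.
have iF := rintegrable_prod (hu ord0) iv.
split.
  by apply: rintegrable_mx => //; under eq_fun do rewrite FE.
rewrite Rintegral_mx//; last by under eq_fun do rewrite FE.
under eq_Rintegral do rewrite FE.
by rewrite (Rintegral_prod (hu ord0) iv) iE big_ord_recl.
Qed.

End rV_peel.

(** * The Plancherel inequality *)

Section real_line.
Context (R : realType).
Local Notation leb := (@lebesgue_measure R).

Lemma is_derive_continuous (F f : R -> R) :
  (forall x : R, is_derive x 1 F (f x)) -> continuous F.
Proof.
move=> dF x; apply: differentiable_continuous.
by apply/derivable1_diffP; case: (dF x).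
Qed.

Lemma rintegrable_itv (f : R -> R) (a b : R) : continuous f ->
  rintegrable leb (f \_ `[a, b]).
Proof.
move=> cf; rewrite /rintegrable -restrict_EFin.
apply/integrable_restrict => //; rewrite setTI.
apply: continuous_compact_integrable; first exact: segment_compact.
exact: continuous_subspaceT.
Qed.

Lemma Rintegral_FTC (F f : R -> R) (a b : R) : a < b ->
  (forall x : R, is_derive x 1 F (f x)) -> continuous f ->
  \int[leb]_(x in `[a, b]) f x = F b - F a.
Proof.
move=> ab dF cf; have cF := is_derive_continuous dF.
rewrite /Rintegral (@continuous_FTC2 _ f F)//.
- exact: continuous_subspaceT.
- split.
  + by move=> x _; case: (dF x).
  + exact/cvg_at_right_filter/cF.
  + exact/cvg_at_left_filter/cF.
- by move=> x _; rewrite derive1E; apply: derive_val.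
Qed.

Lemma Rintegral_FTC_patch (F f : R -> R) (a b : R) : a < b ->
  (forall x : R, is_derive x 1 F (f x)) -> continuous f ->
  \int[leb]_x (f \_ `[a, b]) x = F b - F a.
Proof. by move=> ab dF cf; rewrite -Rintegral_mkcond; exact: Rintegral_FTC. Qed.

Lemma patch_itv_cvg (f : R -> R) x :
  (f \_ `[- n.+1%:R, n.+1%:R]) x @[n --> \oo] --> f x.
Proof.
apply: (@cvg_near_cst _ _ _ _ _).
near=> n; rewrite patchE ifT// inE/= in_itv/= -ler_norml.
apply: ltW; apply: (lt_le_trans (archi_boundP (normr_ge0 x))).
rewrite ler_nat; apply: leqW; near: n; exact: nbhs_infty_ge.
Unshelve. all: by end_near. Qed.

(** The fundamental theorem evaluates the integral over each interval [-k, k], and Fatou's lemma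
    passes to the whole line. With the arctangent as primitive this gives the mass of the Cauchy
    kernels. *)
Lemma ge0_integral_le_FTC (F f : R -> R) (c : R) :
  (forall x : R, is_derive x 1 F (f x)) -> continuous f ->
  (forall x, 0 <= f x) -> (forall x y, F y - F x <= c) ->
  rintegrable leb f /\ \int[leb]_x f x <= c.
Proof.
move=> dF cf f0 Fc; have mf := continuous_measurable_fun cf.
have le_c : (\int[leb]_x (f x)%:E <= c%:E)%E.
  apply: (@fatou_le _ (measurableTypeR R) R leb (fun n => f \_ `[- n.+1%:R, n.+1%:R]) f) => //.
  - by move=> n; exact/rintegrable_measurable/rintegrable_itv.
  - by move=> n x; rewrite patchE; case: ifP.
  - exact: patch_itv_cvg.
  - move=> n; rewrite Rintegral_EFin; last exact: rintegrable_itv.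
    by rewrite (@Rintegral_FTC_patch F) ?lee_fin// gtrN.
have hf := @ge0_rintegrable _ (measurableTypeR R) R leb f c%:E mf f0 (ltry c) le_c.
by split => //; rewrite -lee_fin -Rintegral_EFin.
Qed.

Lemma Rintegral_derive_eq0 (F f : R -> R) :
  (forall x : R, is_derive x 1 F (f x)) -> continuous f -> rintegrable leb f ->
  F n.+1%:R - F (- n.+1%:R) @[n --> \oo] --> 0 ->
  \int[leb]_x f x = 0.
Proof.
move=> dF cf hf F0.
have [||_ cvf] := @Rintegral_cvg_dominated _ (measurableTypeR R) R leb
  (fun n => f \_ `[- n.+1%:R, n.+1%:R]) f (fun x => `|f x|)
  (fun n => rintegrable_measurable (rintegrable_itv _ _ cf)) (rintegrable_norm hf).
- by move=> n x; rewrite patchE; case: ifP => // _; rewrite normr0.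
- exact: patch_itv_cvg.
apply: (cvg_unique _ cvf) => //.
apply: cvg_trans F0; apply: near_eq_cvg; apply: nearW => n.
by rewrite (@Rintegral_FTC_patch F)// gtrN.
Qed.

Lemma continuous_parabola (a : R) : continuous (fun s : R => 1 - (s / a) ^+ 2).
Proof.
apply: (@is_derive_continuous _ (fun s => - (2 * (s / a) / a))) => s.
apply: is_derive_eq; rewrite /GRing.scale/=; ring.
Qed.

Lemma continuous_cos_affine (w t : R) : continuous (fun s : R => cos (w * s + t)).
Proof.
move=> s; apply: (@continuous_comp _ _ _ (fun s : R => w * s + t) cos); last exact: continuous_cos.
by apply: cvgD; [exact: mulrl_continuous|exact: cvg_cst].
Qed.

(** The parabola vanishes at both ends of the interval, so the boundary term of order 1/w drops out
    and the transform is of order w^-2, hence integrable in w; an indicator would only give 1/w. The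
    primitive [F] results from integrating by parts twice. *)
Lemma parabola_integral (a w t : R) : 0 < a -> w != 0 ->
  \int[leb]_(s in `[- a, a]) ((1 - (s / a) ^+ 2) * cos (w * s + t)) =
  2 / (a * w ^+ 2) * - (cos (w * a + t) + cos (w * - a + t)) +
  2 / (a ^+ 2 * w ^+ 3) * (sin (w * a + t) - sin (w * - a + t)).
Proof.
move=> a0 w0.
pose F s := (1 - (s / a) ^+ 2) * sin (w * s + t) / w
  - 2 * s / a ^+ 2 * cos (w * s + t) / w ^+ 2
  + 2 / a ^+ 2 * sin (w * s + t) / w ^+ 3.
have dF (s : R) : is_derive s 1 F ((1 - (s / a) ^+ 2) * cos (w * s + t)).
  rewrite /F.
  have dl : is_derive s 1 (fun s : R => w * s + t) w.
    by apply: is_derive_eq; rewrite addr0 ?mulr1// /GRing.scale/= mulr1.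
  have ds : is_derive s 1 (fun s : R => sin (w * s + t)) (w * cos (w * s + t)).
    by have := @is_derive1_comp _ sin (fun s : R => w * s + t) s _ _
      (is_derive_sin (w * s + t)) dl; rewrite mulrC.
  have dc : is_derive s 1 (fun s : R => cos (w * s + t)) (- w * sin (w * s + t)).
    by have := @is_derive1_comp _ cos (fun s : R => w * s + t) s _ _
      (is_derive_cos (w * s + t)) dl; rewrite mulrC mulrN mulNr.
  apply: is_derive_eq; rewrite /GRing.scale/=; field.
  by rewrite w0 gt_eqF.
have cF : continuous (fun s : R => (1 - (s / a) ^+ 2) * cos (w * s + t)).
  by move=> s; apply: cvgM; [exact: continuous_parabola|exact: continuous_cos_affine].
rewrite (Rintegral_FTC _ dF cF); last by lra.
by rewrite /F; field; rewrite w0 gt_eqF.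
Qed.

(* An integrable window increasing to 1 with [a] whose Fourier transform is
   dominated by a Cauchy kernel of bounded mass; it makes Fubini's theorem
   applicable in the Plancherel inequality. *)
Definition phi (a : R) : R -> R := (fun s => 1 - (s / a) ^+ 2) \_ `[- a, a].

Lemma phi_ge0 (a s : R) : 0 < a -> 0 <= phi a s.
Proof.
move=> a0; rewrite /phi patchE; case: ifPn => //.
rewrite inE/= in_itv/= -ler_norml => sa; rewrite subr_ge0 -real_normK ?num_real//.
by rewrite expr_le1// normrM normfV (gtr0_norm a0) ler_pdivrMr ?mul1r.
Qed.

Lemma measurable_cos_affine (w t : R) :
  measurable_fun setT (fun s : R => cos (w * s + t)).
Proof. by apply: continuous_measurable_fun; exact: continuous_cos_affine. Qed.

Lemma rintegrable_phi a : rintegrable leb (phi a).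
Proof. exact/rintegrable_itv/continuous_parabola. Qed.

Lemma Rintegral_phi (a : R) : 0 < a -> \int[leb]_s phi a s <= 2 * a.
Proof.
move=> a0; apply: (@le_trans _ _ (\int[leb]_s ((fun=> 1 : R) \_ `[- a, a]) s)).
  apply: le_Rintegral => //; first exact: rintegrable_phi.
    by apply: rintegrable_itv => x; exact: cvg_cst.
  by move=> x _; rewrite /phi !patchE; case: ifPn => // _; rewrite lerBlDr lerDl sqr_ge0.
rewrite (@Rintegral_FTC_patch id); [lra|lra|].
by move=> x; exact: cvg_cst.
Qed.

(** For |a w| <= 1 the mass 2a of the window suffices. Otherwise the explicit formula is at most
    8a/(a w)^2, and (a w)^2 >= (1 + (a w)^2)/2 turns the 8 into 16. *)
Lemma phi_cos_bound (a w t : R) : 0 < a ->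
  `|\int[leb]_s (phi a s * cos (w * s + t))| <= 16 * a / (1 + (a * w) ^+ 2).
Proof.
move=> a0; have [aw1|aw1] := lerP (`|a * w|) 1.
  apply: (@le_trans _ _ (\int[leb]_s phi a s)).
    apply: le_Rintegral_norm => [||x].
    - apply: (@rintegrable_bounded _ _ _ _ _ _ 1); first exact: rintegrable_phi.
        exact: measurable_cos_affine.
      by move=> x; rewrite ler_norml cos_geN1 cos_le1.
    - exact: rintegrable_phi.
    - rewrite normrM ger0_norm ?phi_ge0// ler_piMr ?phi_ge0//.
      by rewrite ler_norml cos_geN1 cos_le1.
  apply: (le_trans (Rintegral_phi a0)).
  rewrite ler_pdivlMr; last by rewrite ltr_pwDl// sqr_ge0.
  have : (a * w) ^+ 2 <= 1 by rewrite -real_normK ?num_real// expr_le1.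
  by move: ((a * w) ^+ 2) => r; nra.
have w0 : w != 0 by apply/eqP => w0; move: aw1; rewrite w0 mulr0 normr0 ltr10.
have -> : \int[leb]_s (phi a s * cos (w * s + t)) =
    \int[leb]_(s in `[- a, a]) ((1 - (s / a) ^+ 2) * cos (w * s + t)).
  rewrite [RHS]Rintegral_mkcond; apply: eq_Rintegral => s _.
  by rewrite /phi !patchE; case: ifP => // _; rewrite mul0r.
rewrite parabola_integral//.
have c1 (x : R) : `|cos x| <= 1 by rewrite ler_norml cos_geN1 cos_le1.
have s1 (x : R) : `|sin x| <= 1 by rewrite ler_norml sin_geN1 sin_le1.
apply: (le_trans (ler_normD _ _)); rewrite normrM [X in _ + X]normrM normrN.
have nw : 0 < `|w| by rewrite normr_gt0.
have -> : `|2 / (a * w ^+ 2)| = 2 / (a * `|w| ^+ 2).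
  by rewrite normrM normfV normrM normrX (gtr0_norm a0) normr_nat.
have -> : `|2 / (a ^+ 2 * w ^+ 3)| = 2 / (a ^+ 2 * `|w| ^+ 3).
  by rewrite normrM normfV normrM !normrX (gtr0_norm a0) normr_nat.
have -> : (a * w) ^+ 2 = (a * `|w|) ^+ 2 by rewrite !exprMn real_normK ?num_real.
have aw : 1 < a * `|w| by move: aw1; rewrite normrM (gtr0_norm a0).
have C2 : `|cos (w * a + t) + cos (w * - a + t)| <= 2.
  by apply: (le_trans (ler_normD _ _)); rewrite (_ : 2 = 1 + 1) ?lerD.
have S2 : `|sin (w * a + t) - sin (w * - a + t)| <= 2.
  by apply: (le_trans (ler_normB _ _)); rewrite (_ : 2 = 1 + 1) ?lerD.
apply: (@le_trans _ _ (8 * a / (a * `|w|) ^+ 2)).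
  apply: (@le_trans _ _ (2 / (a * `|w| ^+ 2) * 2 + 2 / (a ^+ 2 * `|w| ^+ 3) * 2)).
    by rewrite lerD// ler_wpM2l// divr_ge0// mulr_ge0// ?exprn_ge0// ltW.
  rewrite -subr_ge0.
  have -> : 8 * a / (a * `|w|) ^+ 2 -
      (2 / (a * `|w| ^+ 2) * 2 + 2 / (a ^+ 2 * `|w| ^+ 3) * 2) =
      4 * (a * `|w| - 1) / (a ^+ 2 * `|w| ^+ 3).
    by field; rewrite !gt_eqF.
  rewrite divr_ge0 ?mulr_ge0 ?exprn_ge0 ?subr_ge0 ?(ltW aw)//; lra.
rewrite ler_pdivrMr ?exprn_gt0//; last by lra.
rewrite mulrAC ler_pdivlMr; last by rewrite ltr_pwDl// sqr_ge0.
have : 0 <= 8 * a * ((a * `|w|) ^+ 2 - 1).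
  by rewrite mulr_ge0 ?subr_ge0 ?exprn_ege1 ?(ltW aw)// mulr_ge0 ?(ltW a0).
lra.
Qed.

(** The point is that the mass does not depend on [a]: the primitive is 8/pi times an arctangent,
    whose total variation is at most pi. *)
Lemma cauchy_kernel (a x : R) : 0 < a ->
  rintegrable leb (fun y => 16 * a / (1 + (a * (2 * pi * (x - y))) ^+ 2)) /\
  \int[leb]_y (16 * a / (1 + (a * (2 * pi * (x - y))) ^+ 2)) <= 8.
Proof.
move=> a0; have pi0 := @pi_gt0 R.
have A1 : forall u : R, atan u < pi / 2 := @atan_ltpi2 R.
have A2 : forall u : R, - (pi / 2) < atan u := @atan_gtNpi2 R.
move: (pi : R) pi0 A1 A2 => p pi0 A1 A2.
pose F y := - (8 / p) * atan (a * (2 * p * (x - y))).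
have cq : continuous (fun y : R => (a * (2 * p * (x - y))) ^+ 2).
  apply: (@is_derive_continuous _
    (fun y => - (2 * (a * (2 * p * (x - y))) * (2 * p * a)))) => y.
  by apply: is_derive_eq; rewrite /GRing.scale/=; ring.
apply: (@ge0_integral_le_FTC F).
- move=> y; rewrite /F.
  have dl : is_derive y 1 (fun y : R => a * (2 * p * (x - y))) (- (2 * p * a)).
    by apply: is_derive_eq; rewrite /GRing.scale/=; ring.
  have := @is_derive1_comp _ atan (fun y : R => a * (2 * p * (x - y))) y _ _
    (is_derive1_atan _) dl.
  move=> da; apply: is_derive_eq; rewrite /GRing.scale/=; field.
  by rewrite !gt_eqF// ltr_pwDl// sqr_ge0.
- move=> y; apply: cvgM; first exact: cvg_cst.
  apply: cvgV; first by rewrite gt_eqF// ltr_pwDl// sqr_ge0.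
  apply: cvgD; first exact: cvg_cst.
  exact: cq.
- by move=> y; rewrite divr_ge0// ?addr_ge0 ?sqr_ge0// mulr_ge0// ltW.
- move=> y z; rewrite /F.
  have := A1 (a * (2 * p * (x - y))).
  have := A2 (a * (2 * p * (x - z))).
  move: (atan _) (atan _) => u v u1 v1.
  have -> : - (8 / p) * v - - (8 / p) * u = 8 * ((u - v) / p) by field; rewrite gt_eqF.
  have : (u - v) / p <= 1 by rewrite ler_pdivrMr// mul1r; lra.
  lra.
Qed.
End real_line.

Section plancherel.
Context (R : realType).
Local Notation leb := (@lebesgue_measure R).

Lemma measurable_dot d (T : measurableType d) n (f g : T -> 'rV[R]_n) :
  measurable_fun setT f -> measurable_fun setT g ->
  measurable_fun setT (fun t => dot (f t) (g t)).
Proof.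
move=> mf mg; apply: measurable_sum => i.
by apply: measurable_funM; apply: measurableT_comp (measurable_entry 0 i) _.
Qed.

Lemma measurable_mxB d (T : measurableType d) m n (f g : T -> 'M[R]_(m, n)) :
  measurable_fun setT f -> measurable_fun setT g ->
  measurable_fun setT (fun t => f t - g t).
Proof.
move=> mf mg; apply: measurable_fun_matrixP => i j; under eq_fun do rewrite !mxE.
by apply: measurable_funB; apply: measurableT_comp (measurable_entry i j) _.
Qed.

Lemma dotBl n (x y z : 'rV[R]_n) : dot (x - y) z = dot x z - dot y z.
Proof. by rewrite /dot -sumrB; apply: eq_bigr => i _; rewrite !mxE mulrBl. Qed.

Lemma cos_norm_le1 (x : R) : `|cos x| <= 1.
Proof. by rewrite ler_norml cos_geN1 cos_le1. Qed.

Lemma sin_norm_le1 (x : R) : `|sin x| <= 1.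
Proof. by rewrite ler_norml sin_geN1 sin_le1. Qed.

Lemma measurable_cos_comp d (T : measurableType d) (f : T -> R) :
  measurable_fun setT f -> measurable_fun setT (fun x => cos (f x)).
Proof. exact: measurableT_comp (continuous_measurable_fun (@continuous_cos R)). Qed.

Lemma measurable_sin_comp d (T : measurableType d) (f : T -> R) :
  measurable_fun setT f -> measurable_fun setT (fun x => sin (f x)).
Proof. exact: measurableT_comp (continuous_measurable_fun (@continuous_sin R)). Qed.

Lemma sin_cosBpihalf (x : R) : sin x = cos (x - pi / 2).
Proof. by rewrite cosB cos_pihalf sin_pihalf mulr0 add0r mulr1. Qed.

Definition Phi n (a : R) (xi : 'rV[R]_n) : R := \prod_i phi a (xi 0 i).

(** The factor 2 in each coordinate pays for the two terms of the addition formula in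
    [Phi_kernel_bound]. *)
Definition cauchy n (a : R) (x y : 'rV[R]_n) : R :=
  \prod_i (2 * (16 * a / (1 + (a * (2 * pi * (x 0 i - y 0 i))) ^+ 2))).

Lemma rintegrable_Phi n a : rintegrable (lebesgue_rV n) (@Phi n a).
Proof.
by have [] := @prod_coord_integral R n (fun=> phi a) (fun=> rintegrable_phi a).
Qed.

Lemma Phi_ge0 n a xi : 0 < a -> 0 <= @Phi n a xi.
Proof. by move=> a0; apply: prodr_ge0 => i _; exact: phi_ge0. Qed.

(** Induction on the dimension. The phase [t] is arbitrary because splitting off the first
    coordinate by the addition formula produces sines, which are rewritten as cosines shifted by pi
    / 2. *)
Lemma Phi_kernel_bound n (a t : R) (x y : 'rV[R]_n) : 0 < a ->
  `|\int[lebesgue_rV n]_xi (Phi a xi * cos (2 * pi * dot (x - y) xi + t))| <=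
  cauchy a x y.
Proof.
move=> a0; elim: n t x y => [|n ih] t x y.
  by rewrite Rintegral_rV0 /Phi /cauchy !big_ord0 mul1r cos_norm_le1.
pose x' := \row_i x 0 (lift ord0 i); pose y' := \row_i y 0 (lift ord0 i).
have xE : x = row_cons (x 0 ord0 : measurableTypeR R, x') by exact: row_cons_surj.
have yE : y = row_cons (y 0 ord0 : measurableTypeR R, y') by exact: row_cons_surj.
pose w := 2 * pi * (x 0 ord0 - y 0 ord0).
pose A t s := phi a s * cos (w * s + t).
pose B t xi := Phi a xi * cos (2 * pi * dot (x' - y') xi + t).
have hA t' : rintegrable leb (A t').
  apply: (@rintegrable_bounded _ _ _ _ _ _ 1); first exact: rintegrable_phi.
    exact: measurable_cos_affine.
  by move=> s; exact: cos_norm_le1.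
have hB t' : rintegrable (lebesgue_rV n) (B t').
  apply: (@rintegrable_bounded _ _ _ _ _ _ 1); first exact: rintegrable_Phi.
    apply: measurable_cos_comp; apply: measurable_funD => //.
    apply: measurable_funM => //; apply: measurable_dot => //.
  by move=> s; exact: cos_norm_le1.
have FE (z : measurableTypeR R * 'rV[R]_n) :
    Phi a (row_cons z) * cos (2 * pi * dot (x - y) (row_cons z) + t) =
    A 0 z.1 * B t z.2 - A (- (pi / 2)) z.1 * B (t - pi / 2) z.2.
  rewrite /Phi big_ord_recl row_cons0.
  under eq_bigr do rewrite row_consS.
  have -> : 2 * pi * dot (x - y) (row_cons z) + t =
      (w * z.1 + 0) + (2 * pi * dot (x' - y') z.2 + t).
    have dx : dot x (row_cons z) = x 0 ord0 * z.1 + dot x' z.2.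
      by rewrite {1}xE dot_row_cons.
    have dy : dot y (row_cons z) = y 0 ord0 * z.1 + dot y' z.2.
      by rewrite {1}yE dot_row_cons.
    rewrite !dotBl dx dy /w; ring.
  rewrite cosD !sin_cosBpihalf /A /B /Phi addr0 addrA; ring.
have mF : measurable_fun setT
    (fun xi : 'rV[R]_n.+1 => Phi a xi * cos (2 * pi * dot (x - y) xi + t)).
  apply: measurable_funM; first exact/rintegrable_measurable/rintegrable_Phi.
  apply: measurable_cos_comp; apply: measurable_funD => //.
  by apply: measurable_funM => //; apply: measurable_dot.
have h1 := rintegrable_prod (hA 0) (hB t).
have h2 := rintegrable_prod (hA (- (pi / 2))) (hB (t - pi / 2)).
rewrite Rintegral_rV//; last first.
  by under eq_fun do rewrite FE; exact: rintegrableB h1 h2.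
under eq_Rintegral do rewrite FE.
rewrite (RintegralB measurableT h1 h2) !Rintegral_prod//.
rewrite /cauchy big_ord_recl -mulrA (_ : forall z : R, 2 * z = z + z); last by move=> z; ring.
apply: (le_trans (ler_normB _ _)); rewrite !normrM.
apply: lerD; apply: ler_pM => //.
- exact: phi_cos_bound.
- apply: le_trans (ih t x' y') _.
  by rewrite /cauchy; under eq_bigr do rewrite !mxE.
- exact: phi_cos_bound.
- apply: le_trans (ih _ x' y') _.
  by rewrite /cauchy; under eq_bigr do rewrite !mxE.
Qed.

Lemma cauchy_ge0 n (a : R) (x y : 'rV[R]_n) : 0 < a -> 0 <= cauchy a x y.
Proof.
move=> a0; apply: prodr_ge0 => i _; rewrite mulr_ge0// divr_ge0//.
  by rewrite mulr_ge0// ltW.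
by rewrite addr_ge0// sqr_ge0.
Qed.

Lemma cauchyC n (a : R) (x y : 'rV[R]_n) : cauchy a x y = cauchy a y x.
Proof.
apply: eq_bigr => i _; congr (_ * (_ / (1 + _))).
by rewrite !exprMn -(sqrrN (x 0 i - y 0 i)) opprB.
Qed.

Lemma cauchy_le n (a : R) (x y : 'rV[R]_n) : 0 < a -> cauchy a x y <= (32 * a) ^+ n.
Proof.
move=> a0; rewrite -[X in _ ^+ X]card_ord -prodr_const; apply: ler_prod => i _.
rewrite mulr_ge0//= ?divr_ge0 ?mulr_ge0 ?(ltW a0) ?addr_ge0 ?sqr_ge0//.
rewrite mulrA ler_pdivrMr ?ltr_pwDl ?sqr_ge0//.
have -> : 32 * a = 2 * (16 * a) by ring.
by rewrite ler_peMr ?mulr_ge0 ?(ltW a0)// lerDl sqr_ge0.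
Qed.

Lemma measurable_cauchy d (T : measurableType d) n a (f g : T -> 'rV[R]_n) :
  measurable_fun setT f -> measurable_fun setT g ->
  measurable_fun setT (fun t => cauchy a (f t) (g t)).
Proof.
move=> mf mg; apply: measurable_prod => i _.
apply: measurable_funM => //; apply: measurable_funM => //.
apply: (measurableT_comp (continuous_measurable_fun (@continuous_oneDsqrV R))).
do 2 apply: measurable_funM => //.
by apply: measurable_funB; apply: measurableT_comp (measurable_entry 0 i) _.
Qed.

(** Each coordinate contributes the mass 8 of [cauchy_kernel] times the factor 2 of [cauchy]; the
    bound is uniform in the window parameter. *)
Lemma cauchy_integral n (a : R) (x : 'rV[R]_n) : 0 < a ->
  rintegrable (lebesgue_rV n) (cauchy a x) /\
  \int[lebesgue_rV n]_y cauchy a x y <= 16 ^+ n.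
Proof.
move=> a0.
have h i := cauchy_kernel (x 0 i) a0.
have [i1 e1] := @prod_coord_integral R n
  (fun i y => 2 * (16 * a / (1 + (a * (2 * pi * (x 0 i - y))) ^+ 2)))
  (fun i => rintegrableZl 2 (h i).1).
split; first exact: i1.
rewrite /cauchy e1 -[X in _ ^+ X]card_ord -prodr_const; apply: ler_prod => i _.
rewrite RintegralZl//; last exact: (h i).1.
rewrite [X in X && _](_ : _ = true); last first.
  rewrite mulr_ge0//; apply: Rintegral_ge0 => y _.
  by rewrite divr_ge0 ?mulr_ge0 ?(ltW a0) ?addr_ge0 ?sqr_ge0.
by rewrite andTb; have := (h i).2; lra.
Qed.

Lemma cvg_bigprod (I : Type) (r : seq I) (F : nat -> I -> R) (l : I -> R) :
  (forall i, F k i @[k --> \oo] --> l i) ->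
  (\prod_(i <- r) F k i) @[k --> \oo] --> \prod_(i <- r) l i.
Proof.
move=> Fl; elim: r => [|i r ih].
  by rewrite big_nil; under eq_fun do rewrite big_nil; exact: cvg_cst.
by rewrite big_cons; under eq_fun do rewrite big_cons; apply: cvgM.
Qed.

Lemma phi_cvg s : phi k.+1%:R s @[k --> \oo] --> (1 : R).
Proof.
have h : (fun k : nat => 1 - (s / k.+1%:R) ^+ 2) @ \oo --> (1 : R).
  rewrite -[X in _ --> X]subr0; apply: cvgB; first exact: cvg_cst.
  have h0 : (fun k : nat => s / k.+1%:R) @ \oo --> (0 : R).
    by rewrite -(mulr0 s); apply: cvgM; [exact: cvg_cst|exact: cvg_harmonic].
  under eq_fun do rewrite expr2; rewrite -(mulr0 (0 : R)); exact: cvgM.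
apply: cvg_trans h; apply: near_eq_cvg.
near=> n; rewrite /phi patchE ifT// inE/= in_itv/= -ler_norml.
apply: ltW; apply: (lt_le_trans (archi_boundP (normr_ge0 s))).
rewrite ler_nat; apply: leqW; near: n; exact: nbhs_infty_ge.
Unshelve. all: by end_near. Qed.

Lemma Phi_cvg n xi : @Phi n k.+1%:R xi @[k --> \oo] --> (1 : R).
Proof.
rewrite [X in _ --> X](_ : 1 = \prod_(i < n) (1 : R)); last by rewrite big1.
by apply: cvg_bigprod => i; exact: phi_cvg.
Qed.

Section real_case.
Variables (n : nat) (u : 'rV[R]_n -> R).
Hypotheses (hu : rintegrable (lebesgue_rV n) u).
Hypotheses (hu2 : rintegrable (lebesgue_rV n) (fun x => u x ^+ 2)).
Local Notation mu := (@lebesgue_rV R n).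

Let mu_ := rintegrable_measurable hu.

Definition cosT (xi : 'rV[R]_n) := \int[mu]_x (u x * cos (2 * pi * dot x xi)).
Definition sinT (xi : 'rV[R]_n) := \int[mu]_x (u x * sin (2 * pi * dot x xi)).

Lemma measurable_pidot d (T : measurableType d) (f g : T -> 'rV[R]_n) :
  measurable_fun setT f -> measurable_fun setT g ->
  measurable_fun setT (fun t => 2 * pi * dot (f t) (g t)).
Proof. by move=> mf mg; apply: measurable_funM => //; exact: measurable_dot. Qed.

Lemma rintegrable_mulcos (f : 'rV[R]_n -> R) :
  measurable_fun setT f -> rintegrable mu (fun x => u x * cos (f x)).
Proof.
move=> mf; apply: (@rintegrable_bounded _ _ _ _ _ _ 1) => //.
  exact: measurable_cos_comp.
by move=> x; exact: cos_norm_le1.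
Qed.

Lemma rintegrable_mulsin (f : 'rV[R]_n -> R) :
  measurable_fun setT f -> rintegrable mu (fun x => u x * sin (f x)).
Proof.
move=> mf; apply: (@rintegrable_bounded _ _ _ _ _ _ 1) => //.
  exact: measurable_sin_comp.
by move=> x; exact: sin_norm_le1.
Qed.

Lemma measurable_cosT : measurable_fun setT cosT.
Proof.
apply: (@measurable_Rintegral_param _ _ _ _ R mu
  (fun z : 'rV[R]_n * 'rV[R]_n => u z.2 * cos (2 * pi * dot z.2 z.1))).
apply: measurable_funM; first exact: measurableT_comp.
by apply: measurable_cos_comp; apply: measurable_pidot.
Qed.

Lemma measurable_sinT : measurable_fun setT sinT.
Proof.
apply: (@measurable_Rintegral_param _ _ _ _ R mu
  (fun z : 'rV[R]_n * 'rV[R]_n => u z.2 * sin (2 * pi * dot z.2 z.1))).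
apply: measurable_funM; first exact: measurableT_comp.
by apply: measurable_sin_comp; apply: measurable_pidot.
Qed.

Let N := \int[mu]_x `|u x|.

Lemma cosT_le xi : `|cosT xi| <= N.
Proof.
apply: le_Rintegral_norm; first by apply: rintegrable_mulcos; exact: measurable_pidot.
  exact: rintegrable_norm.
by move=> x; rewrite normrM ler_piMr// cos_norm_le1.
Qed.

Lemma sinT_le xi : `|sinT xi| <= N.
Proof.
apply: le_Rintegral_norm; first by apply: rintegrable_mulsin; exact: measurable_pidot.
  exact: rintegrable_norm.
by move=> x; rewrite normrM ler_piMr// sin_norm_le1.
Qed.

Let k x xi := cosT xi * cos (2 * pi * dot x xi) + sinT xi * sin (2 * pi * dot x xi).

Let kE x xi : k x xi = \int[mu]_y (u y * cos (2 * pi * dot (x - y) xi)).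
Proof.
rewrite /k /cosT /sinT.
have m : measurable_fun setT (fun y : 'rV[R]_n => 2 * pi * dot y xi).
  exact: measurable_pidot.
rewrite -!RintegralZr//; [|exact: rintegrable_mulsin|exact: rintegrable_mulcos].
rewrite -RintegralD//; last first.
- under eq_fun do rewrite mulrC; apply: rintegrableZl; exact: rintegrable_mulsin.
- under eq_fun do rewrite mulrC; apply: rintegrableZl; exact: rintegrable_mulcos.
apply: eq_Rintegral => y _.
rewrite dotBl mulrBr cosB; ring.
Qed.

Let k_le x xi : `|k x xi| <= 2 * N.
Proof.
apply: (le_trans (ler_normD _ _)); rewrite !normrM (_ : 2 * N = N + N); last by ring.
apply: lerD.
  by apply: le_trans (cosT_le xi); rewrite ler_piMr// cos_norm_le1.
by apply: le_trans (sinT_le xi); rewrite ler_piMr// sin_norm_le1.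
Qed.

Let mk : measurable_fun setT (fun z : 'rV[R]_n * 'rV[R]_n => k z.2 z.1).
Proof.
apply: measurable_funD; apply: measurable_funM.
- exact: measurableT_comp measurable_cosT _.
- by apply: measurable_cos_comp; exact: measurable_pidot.
- exact: measurableT_comp measurable_sinT _.
- by apply: measurable_sin_comp; exact: measurable_pidot.
Qed.

Let K a x y := \int[mu]_xi (Phi a xi * cos (2 * pi * dot (x - y) xi)).

Let K_le a x y : 0 < a -> `|K a x y| <= cauchy a x y.
Proof.
move=> a0; have := Phi_kernel_bound 0 x y a0.
by under eq_Rintegral do rewrite addr0.
Qed.

Lemma rintegrable_Phi_sqr a : 0 < a ->
  rintegrable mu (fun xi => Phi a xi * (cosT xi ^+ 2 + sinT xi ^+ 2)).
Proof.
move=> a0; apply: (@rintegrable_bounded _ _ _ _ _ _ (N ^+ 2 + N ^+ 2)).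
- exact: rintegrable_Phi.
- by apply: measurable_funD; apply: measurable_funX;
    [exact: measurable_cosT|exact: measurable_sinT].
- move=> xi; rewrite ger0_norm ?addr_ge0 ?sqr_ge0//.
  have N0 : 0 <= N by apply: Rintegral_ge0 => x _.
  rewrite -[cosT xi ^+ 2]real_normK ?num_real// -[sinT xi ^+ 2]real_normK ?num_real//.
  by apply: lerD; rewrite lerXn2r ?nnegrE ?cosT_le ?sinT_le.
Qed.

(** Expand the squares and exchange the integrals twice; both exchanges are legitimate because
    [Phi a] is integrable. The weighted energy of the transform is then the quadratic form of the
    kernel [K a], whose size is controlled by [cauchy]. *)
Lemma Phi_sqr_kernel a : 0 < a ->
  \int[mu]_xi (Phi a xi * (cosT xi ^+ 2 + sinT xi ^+ 2)) =
  \int[mu]_x (u x * \int[mu]_y (u y * K a x y)).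
Proof.
move=> a0.
have N0 : 0 <= N by apply: Rintegral_ge0 => x _.
have m xi : measurable_fun setT (fun x : 'rV[R]_n => 2 * pi * dot x xi).
  exact: measurable_pidot.
transitivity (\int[mu]_xi \int[mu]_x (Phi a xi * (u x * k x xi))).
  apply: eq_Rintegral => xi _.
  have i1 : rintegrable mu (fun x => u x * cos (2 * pi * dot x xi) * cosT xi).
    by under eq_fun do rewrite mulrC; apply: rintegrableZl; exact: rintegrable_mulcos.
  have i2 : rintegrable mu (fun x => u x * sin (2 * pi * dot x xi) * sinT xi).
    by under eq_fun do rewrite mulrC; apply: rintegrableZl; exact: rintegrable_mulsin.
  have E : (fun x => u x * k x xi) = (fun x => u x * cos (2 * pi * dot x xi) * cosT xi +
      u x * sin (2 * pi * dot x xi) * sinT xi).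
    by apply/funext => x; rewrite /k; ring.
  rewrite RintegralZl//; last by rewrite E; exact: rintegrableD.
  congr (_ * _); rewrite E RintegralD// !RintegralZr//.
  - exact: rintegrable_mulsin.
  - exact: rintegrable_mulcos.
rewrite (@Rintegral_swap _ _ _ _ _ mu mu (Phi a) (fun x => 2 * N * u x)
  (fun z => Phi a z.1 * (u z.2 * k z.2 z.1))); last first.
- move=> xi x /=; rewrite !normrM ler_wpM2l// mulrC ler_wpM2r//.
  by rewrite normr_nat (ger0_norm N0).
- apply: measurable_funM.
    by apply: measurableT_comp => //; exact/rintegrable_measurable/rintegrable_Phi.
  by apply: measurable_funM => //; exact: measurableT_comp.
- exact: rintegrableZl.
- exact: rintegrable_Phi.
apply: eq_Rintegral => x _ /=.
have mkx : measurable_fun setT (fun xi => k x xi).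
  exact: measurableT_comp mk (pair2_measurable x).
transitivity (\int[mu]_xi (u x * (Phi a xi * k x xi))).
  by apply: eq_Rintegral => xi _; ring.
rewrite RintegralZl//; last first.
  exact: (rintegrable_bounded (rintegrable_Phi n a) mkx (k_le x)).
congr (_ * _).
transitivity (\int[mu]_xi \int[mu]_y (Phi a xi * (u y * cos (2 * pi * dot (x - y) xi)))).
  apply: eq_Rintegral => xi _; rewrite RintegralZl ?kE//.
  apply: rintegrable_mulcos; apply: measurable_pidot => //.
  exact: measurable_mxB.
rewrite (@Rintegral_swap _ _ _ _ _ mu mu (Phi a) u
  (fun z => Phi a z.1 * (u z.2 * cos (2 * pi * dot (x - z.2) z.1)))); last first.
- move=> xi y /=; rewrite !normrM ler_wpM2l// ler_piMr// cos_norm_le1//.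
- apply: measurable_funM.
    by apply: measurableT_comp => //; exact/rintegrable_measurable/rintegrable_Phi.
  apply: measurable_funM; first exact: measurableT_comp.
  apply: measurable_cos_comp; apply: measurable_pidot => //.
  exact: measurable_mxB.
- exact: hu.
- exact: rintegrable_Phi.
apply: eq_Rintegral => y _ /=.
transitivity (\int[mu]_xi (u y * (Phi a xi * cos (2 * pi * dot (x - y) xi)))).
  by apply: eq_Rintegral => xi _; ring.
rewrite RintegralZl//.
apply: (@rintegrable_bounded _ _ _ _ _ _ 1); first exact: rintegrable_Phi.
  by apply: measurable_cos_comp; exact: measurable_pidot.
by move=> xi; exact: cos_norm_le1.
Qed.

(** The half of the Schur test in which the square sits at the inner variable. By Tonelli's theorem
    and the symmetry of [cauchy], its integral again reduces to the mass of the kernel. *)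
Let L a x := \int[mu]_y (u y ^+ 2 * cauchy a x y).

Let mcauchy a : measurable_fun setT (fun z : 'rV[R]_n * 'rV[R]_n => cauchy a z.1 z.2).
Proof. exact: measurable_cauchy. Qed.

Let L_integral a : 0 < a ->
  rintegrable mu (L a) /\ \int[mu]_x L a x <= 16 ^+ n * \int[mu]_x u x ^+ 2.
Proof.
move=> a0.
have mF : measurable_fun setT
    (fun z : 'rV[R]_n * 'rV[R]_n => u z.2 ^+ 2 * cauchy a z.1 z.2).
  by apply: measurable_funM => //; apply: measurable_funX; exact: measurableT_comp.
have iy x : rintegrable mu (fun y => u y ^+ 2 * cauchy a x y).
  apply: (rintegrable_bounded hu2 _ (c := (32 * a) ^+ n)).
    exact: measurable_cauchy.
  by move=> y; rewrite ger0_norm ?cauchy_ge0// cauchy_le.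
have ix y : rintegrable mu (fun x => u y ^+ 2 * cauchy a x y).
  apply: rintegrableZl; under eq_fun do rewrite cauchyC.
  exact: (cauchy_integral y a0).1.
have F0 (z : 'rV[R]_n * 'rV[R]_n) : (0 <= (u z.2 ^+ 2 * cauchy a z.1 z.2)%:E)%E.
  by rewrite lee_fin mulr_ge0 ?sqr_ge0// cauchy_ge0.
have le : (\int[mu]_x (L a x)%:E <= (16 ^+ n * \int[mu]_x u x ^+ 2)%:E)%E.
  under eq_integral do rewrite /L -Rintegral_EFin//.
  rewrite (fubini_tonelli (fun z : 'rV[R]_n * 'rV[R]_n =>
    (u z.2 ^+ 2 * cauchy a z.1 z.2)%:E)) //=; last exact/measurable_EFinP.
  rewrite -RintegralZl// -Rintegral_EFin; last exact: rintegrableZl.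
  apply: ge0_le_integral => //.
  - by move=> y _; apply: integral_ge0 => x _; exact: (F0 (x, y)).
  - apply: (measurable_fun_fubini_tonelli_G (fun z : 'rV[R]_n * 'rV[R]_n =>
      (u z.2 ^+ 2 * cauchy a z.1 z.2)%:E)) => //; exact/measurable_EFinP.
  - apply/measurable_EFinP/measurable_funM => //.
    exact: rintegrable_measurable hu2.
  - move=> y _; rewrite Rintegral_EFin// lee_fin RintegralZl//; last first.
      under eq_fun do rewrite cauchyC; exact: (cauchy_integral y a0).1.
    rewrite mulrC ler_wpM2r ?sqr_ge0//.
    under eq_Rintegral do rewrite cauchyC.
    exact: (cauchy_integral y a0).2.
have hL : rintegrable mu (L a).
  apply: ge0_rintegrable (ltry _) le.
    exact: (@measurable_Rintegral_param _ _ _ _ R mu _ mF).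
  by move=> x; apply: Rintegral_ge0 => y _; have := F0 (x, y); rewrite lee_fin.
by split => //; rewrite -lee_fin -Rintegral_EFin.
Qed.

(** Schur's test: |u(x) u(y) K(x, y)| is at most half of (u(x)^2 + u(y)^2) [cauchy a x y], and each
    of the two terms integrates to at most 16^n times the integral of u^2. The bound does not depend
    on [a]. *)
Lemma plancherel_Phi a : 0 < a ->
  \int[mu]_xi (Phi a xi * (cosT xi ^+ 2 + sinT xi ^+ 2)) <=
  16 ^+ n * \int[mu]_x u x ^+ 2.
Proof.
move=> a0; rewrite Phi_sqr_kernel//; apply: (le_trans (ler_norm _)).
have [hL Lle] := L_integral a0.
have hc (x : 'rV[R]_n) := cauchy_integral x a0.
have mK : measurable_fun setT (fun z : 'rV[R]_n * 'rV[R]_n => K a z.1 z.2).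
  apply: (@measurable_Rintegral_param _ _ _ _ R mu (fun w : ('rV[R]_n * 'rV[R]_n) * 'rV[R]_n =>
    Phi a w.2 * cos (2 * pi * dot (w.1.1 - w.1.2) w.2))).
  apply: measurable_funM.
    by apply: measurableT_comp => //; exact/rintegrable_measurable/rintegrable_Phi.
  apply: measurable_cos_comp; apply: measurable_pidot => //.
  by apply: measurable_mxB; apply: measurableT_comp.
have iuK x : rintegrable mu (fun y => u y * K a x y).
  apply: (rintegrable_bounded hu _ (c := (32 * a) ^+ n)).
    exact: measurableT_comp mK (pair1_measurable x).
  by move=> y; apply: le_trans (cauchy_le x y a0); exact: K_le.
have iu2c x : rintegrable mu (fun y => u y ^+ 2 * cauchy a x y).
  apply: (rintegrable_bounded hu2 _ (c := (32 * a) ^+ n)).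
    exact: measurable_cauchy.
  by move=> y; rewrite ger0_norm ?cauchy_ge0// cauchy_le.
have bound x : `|u x * \int[mu]_y (u y * K a x y)| <=
    2^-1 * (16 ^+ n * u x ^+ 2) + 2^-1 * L a x.
  have i1 : rintegrable mu (fun y => 2^-1 * u x ^+ 2 * cauchy a x y).
    exact: rintegrableZl (hc x).1.
  have i2 : rintegrable mu (fun y => 2^-1 * (u y ^+ 2 * cauchy a x y)).
    exact: rintegrableZl (iu2c x).
  apply: (@le_trans _ _ (\int[mu]_y (2^-1 * u x ^+ 2 * cauchy a x y +
      2^-1 * (u y ^+ 2 * cauchy a x y)))); last first.
    rewrite RintegralD// !RintegralZl//; try exact: iu2c; try exact: (hc x).1.
    rewrite lerD2r.
    have -> : 2^-1 * (16 ^+ n * u x ^+ 2) = 2^-1 * u x ^+ 2 * 16 ^+ n by ring.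
    by apply: ler_wpM2l; [rewrite mulr_ge0 ?sqr_ge0|exact: (hc x).2].
  have -> : u x * \int[mu]_y (u y * K a x y) = \int[mu]_y (u x * (u y * K a x y)).
    by rewrite RintegralZl//; exact: iuK.
  apply: le_Rintegral_norm.
  - exact: rintegrableZl.
  - exact: rintegrableD.
  - move=> y; rewrite !normrM.
    have := K_le x y a0; have := cauchy_ge0 x y a0.
    move: (cauchy a x y) `|K a x y| => c0 k0 c0_ge0 kc.
    apply: (@le_trans _ _ (`|u x| * `|u y| * c0)).
      by rewrite mulrA ler_wpM2l// mulr_ge0.
    have -> : 2^-1 * u x ^+ 2 * c0 + 2^-1 * (u y ^+ 2 * c0) =
        2^-1 * (u x ^+ 2 + u y ^+ 2) * c0 by ring.
    rewrite ler_wpM2r// -[u x ^+ 2]real_normK ?num_real//.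
    rewrite -[u y ^+ 2]real_normK ?num_real//.
    have := sqr_ge0 (`|u x| - `|u y|); lra.
apply: (@le_trans _ _ (\int[mu]_x (2^-1 * (16 ^+ n * u x ^+ 2) + 2^-1 * L a x))).
  apply: (le_Rintegral_norm _ _ bound).
  - have mI : measurable_fun setT (fun x => u x * \int[mu]_y (u y * K a x y)).
      apply: measurable_funM => //.
      apply: (@measurable_Rintegral_param _ _ _ _ R mu (fun z => u z.2 * K a z.1 z.2)).
      by apply: measurable_funM => //; exact: measurableT_comp.
    apply: (rintegrable_le mI _ bound).
    by apply: rintegrableD; apply: rintegrableZl => //; exact: rintegrableZl.
  - by apply: rintegrableD; apply: rintegrableZl => //; exact: rintegrableZl.
rewrite RintegralD//; [|by do 2 apply: rintegrableZl|exact: rintegrableZl].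
rewrite !RintegralZl//; last exact: rintegrableZl.
by move: Lle; lra.
Qed.

(** The windows tend to 1 pointwise as the parameter [k.+1] grows, so Fatou's lemma removes them. *)
Lemma plancherel_real :
  (\int[mu]_xi (cosT xi ^+ 2 + sinT xi ^+ 2)%:E <=
  (16 ^+ n * \int[mu]_x u x ^+ 2)%:E)%E.
Proof.
apply: (@fatou_le _ _ _ _
  (fun k xi => Phi k.+1%:R xi * (cosT xi ^+ 2 + sinT xi ^+ 2))).
- by move=> k0; exact/rintegrable_measurable/rintegrable_Phi_sqr.
- by move=> k0 xi; rewrite mulr_ge0// ?addr_ge0 ?sqr_ge0// Phi_ge0.
- move=> xi; rewrite -[X in _ --> X]mul1r; apply: cvgMl; exact: Phi_cvg.
- move=> k0; rewrite Rintegral_EFin ?lee_fin ?plancherel_Phi//.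
  exact: rintegrable_Phi_sqr.
Qed.
End real_case.
End plancherel.

Local Open Scope complex_scope.

(** * Complex-valued functions *)

Section cmod.
Variable R : realType.
Implicit Types z w : R[i].

Lemma cmod_ge0 z : 0 <= cmod z.
Proof. by case: z => a b; exact: sqrtr_ge0. Qed.

Lemma cmodM z w : cmod (z * w) = cmod z * cmod w.
Proof. exact: ComplexField.Normc.normcM. Qed.

Lemma cmodD z w : cmod (z + w) <= cmod z + cmod w.
Proof. exact: le_normcD. Qed.

Lemma cmod_sqr z : cmod z ^+ 2 = complex.Re z ^+ 2 + complex.Im z ^+ 2.
Proof. by case: z => a b; rewrite sqr_sqrtr// addr_ge0// sqr_ge0. Qed.

Lemma cmod0 : cmod (0 : R[i]) = 0.
Proof. exact: ComplexField.Normc.normc0. Qed.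

Lemma cmod1 : cmod (1 : R[i]) = 1.
Proof. exact: ComplexField.Normc.normc1. Qed.

Lemma cmod_real (x : R) : cmod x%:C = `|x|.
Proof. by rewrite /cmod /= expr0n/= addr0 sqrtr_sqr. Qed.

Lemma Re_le_cmod z : `|complex.Re z| <= cmod z.
Proof.
rewrite -(@ler_pXn2r _ 2)// ?nnegrE ?cmod_ge0// real_normK ?num_real//.
by rewrite cmod_sqr lerDl sqr_ge0.
Qed.

Lemma Im_le_cmod z : `|complex.Im z| <= cmod z.
Proof.
rewrite -(@ler_pXn2r _ 2)// ?nnegrE ?cmod_ge0// real_normK ?num_real//.
by rewrite cmod_sqr lerDr sqr_ge0.
Qed.

Lemma cmod_le z : cmod z <= `|complex.Re z| + `|complex.Im z|.
Proof.
rewrite -(@ler_pXn2r _ 2)// ?nnegrE ?cmod_ge0 ?addr_ge0//.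
rewrite cmod_sqr sqrrD !real_normK ?num_real// addrAC lerDl.
by rewrite mulrn_wge0// mulr_ge0.
Qed.

Lemma cmod_sum (I : Type) (r : seq I) (P : pred I) (F : I -> R[i]) :
  cmod (\sum_(i <- r | P i) F i) <= \sum_(i <- r | P i) cmod (F i).
Proof.
elim/big_ind2 : _ => [|x a y b xa yb|//]; first by rewrite cmod0.
by apply: (le_trans (cmodD _ _)); rewrite lerD.
Qed.

Lemma cmod_prod (I : Type) (r : seq I) (P : pred I) (F : I -> R[i]) :
  cmod (\prod_(i <- r | P i) F i) = \prod_(i <- r | P i) cmod (F i).
Proof.
elim/big_ind2 : _ => [|x a y b <- <-|//]; first by rewrite cmod1.
by rewrite cmodM.
Qed.

Lemma cReM z w : complex.Re (z * w) =
  complex.Re z * complex.Re w - complex.Im z * complex.Im w.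
Proof. by case: z => a b; case: w. Qed.

Lemma cImM z w : complex.Im (z * w) =
  complex.Re z * complex.Im w + complex.Im z * complex.Re w.
Proof. by case: z => a b; case: w. Qed.

Lemma cReD z w : complex.Re (z + w) = complex.Re z + complex.Re w.
Proof. by case: z => a b; case: w. Qed.

Lemma cImD z w : complex.Im (z + w) = complex.Im z + complex.Im w.
Proof. by case: z => a b; case: w. Qed.

Lemma complex_eq z w : complex.Re z = complex.Re w -> complex.Im z = complex.Im w -> z = w.
Proof. by case: z => a b; case: w => c e /= -> ->. Qed.

Lemma cmod_e2pi (t : R) : cmod (e2pi t) = 1.
Proof. by rewrite /cmod /= cos2Dsin2 sqrtr1. Qed.

Lemma e2piD (s t : R) : e2pi (s + t) = e2pi s * e2pi t.
Proof.
apply: complex_eq; first by rewrite cReM /= mulrDr cosD.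
by rewrite cImM /= mulrDr sinD addrC mulrC addrC [X in _ + X]mulrC addrC mulrC.
Qed.

Lemma e2pi_sum (I : Type) (r : seq I) (F : I -> R) :
  e2pi (\sum_(i <- r) F i) = \prod_(i <- r) e2pi (F i).
Proof.
elim: r => [|i r ih]; last by rewrite !big_cons e2piD ih.
by rewrite !big_nil; apply: complex_eq; rewrite /= mulr0 ?cos0 ?sin0.
Qed.

End cmod.

Section cintegral.
Context d (T : measurableType d) (R : realType) (mu : {measure set T -> \bar R}).
Implicit Types f g : T -> R[i].

Definition cmeasurable f := measurable_fun setT (fun x => complex.Re (f x)) /\
  measurable_fun setT (fun x => complex.Im (f x)).

Definition cintegrable f := rintegrable mu (fun x => complex.Re (f x)) /\
  rintegrable mu (fun x => complex.Im (f x)).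

Lemma cintegrable_measurable f : cintegrable f -> cmeasurable f.
Proof. by move=> [/rintegrable_measurable ? /rintegrable_measurable ?]. Qed.

Lemma cmeasurableM f g : cmeasurable f -> cmeasurable g ->
  cmeasurable (fun x => f x * g x).
Proof.
move=> [f1 f2] [g1 g2]; split.
  by under eq_fun do rewrite cReM; apply: measurable_funB; apply: measurable_funM.
by under eq_fun do rewrite cImM; apply: measurable_funD; apply: measurable_funM.
Qed.

Lemma cmeasurableD f g : cmeasurable f -> cmeasurable g ->
  cmeasurable (fun x => f x + g x).
Proof.
move=> [f1 f2] [g1 g2]; split.
  by under eq_fun do rewrite cReD; apply: measurable_funD.
by under eq_fun do rewrite cImD; apply: measurable_funD.
Qed.

Lemma cmeasurable_cst (c : R[i]) : cmeasurable (fun=> c).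
Proof. by split. Qed.

Lemma cmeasurable_prod (I : Type) (r : seq I) (F : I -> T -> R[i]) :
  (forall i, cmeasurable (F i)) -> cmeasurable (fun x => \prod_(i <- r) F i x).
Proof.
move=> hF; elim: r => [|i r ih].
  by under eq_fun do rewrite big_nil; exact: cmeasurable_cst.
by under eq_fun do rewrite big_cons; exact: cmeasurableM.
Qed.

Lemma cmeasurable_sum (I : Type) (r : seq I) (F : I -> T -> R[i]) :
  (forall i, cmeasurable (F i)) -> cmeasurable (fun x => \sum_(i <- r) F i x).
Proof.
move=> hF; elim: r => [|i r ih].
  by under eq_fun do rewrite big_nil; exact: cmeasurable_cst.
by under eq_fun do rewrite big_cons; exact: cmeasurableD.
Qed.

Lemma measurable_cmod f : cmeasurable f -> measurable_fun setT (fun x => cmod (f x)).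
Proof.
move=> [f1 f2].
rewrite (_ : (fun x => _) = (fun x => Num.sqrt (complex.Re (f x) ^+ 2 + complex.Im (f x) ^+ 2))).
  apply: (measurableT_comp (continuous_measurable_fun (@sqrt_continuous R))).
  by apply: measurable_funD; apply: measurable_funX.
by apply/funext => x; rewrite -cmod_sqr sqrtr_sqr ger0_norm ?cmod_ge0.
Qed.

Lemma cmeasurable_e2pi (f : T -> R) : measurable_fun setT f ->
  cmeasurable (fun x => e2pi (f x)).
Proof.
by move=> mf; split; [apply: measurable_cos_comp|apply: measurable_sin_comp];
  apply: measurable_funM.
Qed.

Lemma cintegrable_le f (g : T -> R) : cmeasurable f -> rintegrable mu g ->
  (forall x, cmod (f x) <= g x) -> cintegrable f.
Proof.
move=> [f1 f2] hg fg; split.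
  by apply: (rintegrable_le f1 hg) => x; apply: le_trans (fg x); exact: Re_le_cmod.
by apply: (rintegrable_le f2 hg) => x; apply: le_trans (fg x); exact: Im_le_cmod.
Qed.

Lemma cintegrable_cmod f : cintegrable f -> rintegrable mu (fun x => cmod (f x)).
Proof.
move=> hf; have [h1 h2] := hf.
apply: (rintegrable_le (measurable_cmod (cintegrable_measurable hf))
  (rintegrableD (rintegrable_norm h1) (rintegrable_norm h2))) => x.
by rewrite ger0_norm ?cmod_ge0// cmod_le.
Qed.

Lemma cintegrableZl c f : cintegrable f -> cintegrable (fun x => c * f x).
Proof.
move=> hf; apply: (@cintegrable_le _ (fun x => cmod c * cmod (f x))).
- by apply: cmeasurableM; [exact: cmeasurable_cst|exact: cintegrable_measurable].
- exact/rintegrableZl/cintegrable_cmod.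
- by move=> x; rewrite cmodM.
Qed.

Lemma cintegrableD f g : cintegrable f -> cintegrable g ->
  cintegrable (fun x => f x + g x).
Proof.
move=> [f1 f2] [g1 g2]; split.
  by under eq_fun do rewrite cReD; exact: rintegrableD.
by under eq_fun do rewrite cImD; exact: rintegrableD.
Qed.

Lemma cintegrable0 : cintegrable (fun=> 0).
Proof. by split; exact: rintegrable0. Qed.

Lemma cintegrable_sum (I : Type) (s : seq I) (F : I -> T -> R[i]) :
  (forall i, cintegrable (F i)) -> cintegrable (fun x => \sum_(i <- s) F i x).
Proof.
move=> hF; elim: s => [|i s ih].
  by under eq_fun do rewrite big_nil; exact: cintegrable0.
by under eq_fun do rewrite big_cons; exact: cintegrableD.
Qed.

Lemma cintegralD f g : cintegrable f -> cintegrable g ->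
  cintegral mu (fun x => f x + g x) = cintegral mu f + cintegral mu g.
Proof.
move=> [f1 f2] [g1 g2]; apply: complex_eq; rewrite ?(cReD, cImD) /=.
  by under eq_Rintegral do rewrite cReD; rewrite RintegralD.
by under eq_Rintegral do rewrite cImD; rewrite RintegralD.
Qed.

Lemma cintegralZl c f : cintegrable f ->
  cintegral mu (fun x => c * f x) = c * cintegral mu f.
Proof.
move=> [f1 f2]; apply: complex_eq; rewrite ?(cReM, cImM) /=.
  under eq_Rintegral do rewrite cReM.
  by rewrite RintegralB ?RintegralZl//; exact: rintegrableZl.
under eq_Rintegral do rewrite cImM.
by rewrite RintegralD ?RintegralZl//; exact: rintegrableZl.
Qed.

Lemma cintegral_sum (I : Type) (s : seq I) (F : I -> T -> R[i]) :
  (forall i, cintegrable (F i)) ->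
  cintegral mu (fun x => \sum_(i <- s) F i x) = \sum_(i <- s) cintegral mu (F i).
Proof.
move=> hF; elim: s => [|i s ih].
  rewrite big_nil; under [X in cintegral _ X]eq_fun do rewrite big_nil.
  by apply: complex_eq; rewrite /= /Rintegral integral0.
rewrite big_cons -ih -cintegralD//; last exact: cintegrable_sum.
by congr cintegral; apply/funext => x; rewrite big_cons.
Qed.

End cintegral.
Arguments cintegrable {d T R} mu f.

Section cintegral_product.
Context d1 d2 (T1 : measurableType d1) (T2 : measurableType d2) (R : realType).
Variable mu : {sigma_finite_measure set T1 -> \bar R}.
Variable nu : {sigma_finite_measure set T2 -> \bar R}.

Lemma cintegral_prod (f : T1 -> R[i]) (g : T2 -> R[i]) :
  cintegrable mu f -> cintegrable nu g ->
  cintegrable (mu \x nu)%E (fun z => f z.1 * g z.2) /\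
  cintegral (mu \x nu)%E (fun z => f z.1 * g z.2) = cintegral mu f * cintegral nu g.
Proof.
move=> [f1 f2] [g1 g2].
have i11 := rintegrable_prod f1 g1; have i12 := rintegrable_prod f1 g2.
have i21 := rintegrable_prod f2 g1; have i22 := rintegrable_prod f2 g2.
split.
  split.
    by under eq_fun do rewrite cReM; exact: rintegrableB i11 i22.
  by under eq_fun do rewrite cImM; exact: rintegrableD i12 i21.
apply: complex_eq; rewrite ?(cReM, cImM) /=.
  under [LHS]eq_Rintegral do rewrite cReM.
  by rewrite (RintegralB measurableT i11 i22); congr (_ - _); exact: Rintegral_prod.
under [LHS]eq_Rintegral do rewrite cImM.
by rewrite (RintegralD measurableT i12 i21); congr (_ + _); exact: Rintegral_prod.
Qed.

End cintegral_product.

Section cintegral_mx.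
Variable R : realType.

Lemma cintegral_prod_row m n (f : 'I_m -> 'rV[R]_n -> R[i]) :
  (forall j, cintegrable (lebesgue_rV n) (f j)) ->
  cintegrable (lebesgue_mx m n) (fun A => \prod_j f j (row j A)) /\
  cintegral (lebesgue_mx m n) (fun A => \prod_j f j (row j A)) =
  \prod_j cintegral (lebesgue_rV n) (f j).
Proof.
elim: m f => [|m ih] f hf.
  rewrite big_ord0; split; first by split; exact: rintegrable_mx0.
  by apply: complex_eq; rewrite /= Rintegral_mx0 big_ord0.
have [iv iE] := ih _ (fun j => hf (lift ord0 j)).
have [[i1 i2] e] := cintegral_prod (hf ord0) iv.
have FE (z : 'rV[R]_n * 'M[R]_(m, n)) : \prod_j f j (row j (mx_cons z)) =
    f ord0 z.1 * \prod_j f (lift ord0 j) (row j z.2).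
  rewrite big_ord_recl row_mx_cons0; congr (_ * _).
  by apply: eq_bigr => j _; rewrite row_mx_consS.
have [m1 m2] : cmeasurable (fun A : 'M[R]_(m.+1, n) => \prod_j f j (row j A)).
  apply: cmeasurable_prod => j; have [h1 h2] := cintegrable_measurable (hf j).
  by split; [apply: measurableT_comp h1 _|apply: measurableT_comp h2 _]; exact: measurable_row.
have j1 : rintegrable (lebesgue_rV n \x lebesgue_mx m n)%E
    (fun z => complex.Re (\prod_j f j (row j (mx_cons z)))).
  by under eq_fun do rewrite FE.
have j2 : rintegrable (lebesgue_rV n \x lebesgue_mx m n)%E
    (fun z => complex.Im (\prod_j f j (row j (mx_cons z)))).
  by under eq_fun do rewrite FE.
split; first by split; exact: rintegrable_mx.
rewrite big_ord_recl -iE -e; apply: complex_eq => /=; rewrite Rintegral_mx//.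
  by apply: eq_Rintegral => z _; rewrite FE.
by apply: eq_Rintegral => z _; rewrite FE.
Qed.

End cintegral_mx.

Section plancherel_complex.
Variables (R : realType) (n : nat).
Local Notation mu := (@lebesgue_rV R n).

(** The value [true] gives the Fourier transform and [false] the inverse one. Both signs are needed:
    the former for the functions [f j], the latter for the operator applied to a tensor piece. *)
Definition fint (b : bool) (f : 'rV[R]_n -> R[i]) (xi : 'rV[R]_n) : R[i] :=
  cintegral mu (fun x => f x * e2pi ((-1) ^+ b * dot x xi)).

Lemma cintegrable_fint b f xi : cintegrable mu f ->
  cintegrable mu (fun x => f x * e2pi ((-1) ^+ b * dot x xi)).
Proof.
move=> hf; apply: cintegrable_le (cintegrable_cmod hf) _.
  apply: cmeasurableM; first exact: cintegrable_measurable hf.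
  by apply: cmeasurable_e2pi; apply: measurable_funM => //; exact: measurable_dot.
by move=> x; rewrite cmodM cmod_e2pi mulr1.
Qed.

Lemma cmeasurable_fint b f : cmeasurable f -> cmeasurable (fint b f).
Proof.
move=> mf.
have mF : cmeasurable (fun z : 'rV[R]_n * 'rV[R]_n =>
    f z.2 * e2pi ((-1) ^+ b * dot z.2 z.1)).
  apply: cmeasurableM.
    by case: mf => h1 h2; split; [exact: measurableT_comp h1 _|exact: measurableT_comp h2 _].
  by apply: cmeasurable_e2pi; apply: measurable_funM => //; exact: measurable_dot.
by split; [apply: (@measurable_Rintegral_param _ _ _ _ R mu _ mF.1)|
  apply: (@measurable_Rintegral_param _ _ _ _ R mu _ mF.2)].
Qed.

Lemma plancherel b f : cintegrable mu f ->
  rintegrable mu (fun x => cmod (f x) ^+ 2) ->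
  rintegrable mu (fun xi => cmod (fint b f xi) ^+ 2) /\
  \int[mu]_xi cmod (fint b f xi) ^+ 2 <= 2 * 16 ^+ n * \int[mu]_x cmod (f x) ^+ 2.
Proof.
move=> hf hf2; have [hu hv] := hf.
pose u x := complex.Re (f x); pose v x := complex.Im (f x).
have hu2 : rintegrable mu (fun x => u x ^+ 2).
  apply: (rintegrable_le _ hf2); first exact: measurable_funX (rintegrable_measurable hu).
  by move=> x; rewrite ger0_norm ?sqr_ge0// cmod_sqr lerDl sqr_ge0.
have hv2 : rintegrable mu (fun x => v x ^+ 2).
  apply: (rintegrable_le _ hf2); first exact: measurable_funX (rintegrable_measurable hv).
  by move=> x; rewrite ger0_norm ?sqr_ge0// cmod_sqr lerDr sqr_ge0.
have md xi : measurable_fun setT (fun x : 'rV[R]_n => 2 * pi * dot x xi).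
  exact: measurable_pidot.
have s2 : ((-1) ^+ b : R) ^+ 2 = 1 by case: b; rewrite ?expr1 ?expr0 ?sqrrN expr1n.
have csE (r : R) : cos (2 * pi * ((-1) ^+ b * r)) = cos (2 * pi * r).
  by case: b {s2}; rewrite ?expr1 ?expr0 ?mul1r// mulN1r mulrN cosN.
have snE (r : R) : sin (2 * pi * ((-1) ^+ b * r)) = (-1) ^+ b * sin (2 * pi * r).
  by case: b {s2 csE}; rewrite ?expr1 ?expr0 ?mul1r// mulN1r mulrN sinN mulN1r.
have ReE xi : complex.Re (fint b f xi) = cosT u xi - (-1) ^+ b * sinT v xi.
  rewrite /fint /= /cosT /sinT -RintegralZl//; last exact: rintegrable_mulsin.
  rewrite -RintegralB//; [|exact: rintegrable_mulcos|].
    by apply: eq_Rintegral => x _; rewrite cReM /= csE snE /u /v; ring.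
  by apply: rintegrableZl; exact: rintegrable_mulsin.
have ImE xi : complex.Im (fint b f xi) = (-1) ^+ b * sinT u xi + cosT v xi.
  rewrite /fint /= /cosT /sinT -RintegralZl//; last exact: rintegrable_mulsin.
  rewrite -RintegralD//;
    [|by apply: rintegrableZl; exact: rintegrable_mulsin|exact: rintegrable_mulcos].
  by apply: eq_Rintegral => x _; rewrite cImM /= csE snE /u /v; ring.
have mfi := cmeasurable_fint b (cintegrable_measurable hf).
pose Eu xi := cosT u xi ^+ 2 + sinT u xi ^+ 2.
pose Ev xi := cosT v xi ^+ 2 + sinT v xi ^+ 2.
(* The cross terms between the transforms of the real and imaginary parts are absorbed pointwise, at
   the price of the factor 2, instead of being shown to cancel after integration. *)
have ptw xi : cmod (fint b f xi) ^+ 2 <= 2 * (Eu xi + Ev xi).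
  rewrite cmod_sqr ReE ImE /Eu /Ev.
  move: s2; move: (_ ^+ b) (cosT u xi) (sinT u xi) (cosT v xi) (sinT v xi) => s a c e g s2.
  rewrite -subr_ge0.
  have -> : 2 * (a ^+ 2 + c ^+ 2 + (e ^+ 2 + g ^+ 2)) - ((a - s * g) ^+ 2 + (s * c + e) ^+ 2)
      = (a + s * g) ^+ 2 + (s * c - e) ^+ 2 + 2 * (1 - s ^+ 2) * (g ^+ 2 + c ^+ 2) by ring.
  by rewrite s2 subrr mulr0 mul0r addr0 addr_ge0 ?sqr_ge0.
have iE w : rintegrable mu w -> rintegrable mu (fun x => w x ^+ 2) ->
    rintegrable mu (fun xi => cosT w xi ^+ 2 + sinT w xi ^+ 2) /\
    \int[mu]_xi (cosT w xi ^+ 2 + sinT w xi ^+ 2) <= 16 ^+ n * \int[mu]_x w x ^+ 2.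
  move=> hw hw2; have le := plancherel_real hw hw2.
  have hE : rintegrable mu (fun xi => cosT w xi ^+ 2 + sinT w xi ^+ 2).
    apply: ge0_rintegrable (ltry _) le.
      by apply: measurable_funD; apply: measurable_funX;
        [exact: measurable_cosT|exact: measurable_sinT].
    by move=> xi; rewrite addr_ge0 ?sqr_ge0.
  by split => //; rewrite -lee_fin -Rintegral_EFin.
have [iu lu] := iE u hu hu2; have [iv lv] := iE v hv hv2.
have iS : rintegrable mu (fun xi => 2 * (Eu xi + Ev xi)).
  exact/rintegrableZl/rintegrableD.
have i2 : rintegrable mu (fun xi => cmod (fint b f xi) ^+ 2).
  apply: (rintegrable_le _ iS); first exact/measurable_funX/measurable_cmod.
  by move=> xi; rewrite ger0_norm ?sqr_ge0.
split => //; apply: (le_trans (le_Rintegral measurableT i2 iS (fun x _ => ptw x))).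
rewrite RintegralZl//; last exact: rintegrableD iu iv.
rewrite (RintegralD measurableT iu iv) -mulrA ler_wpM2l// (_ : \int[mu]_x cmod (f x) ^+ 2 =
  \int[mu]_x u x ^+ 2 + \int[mu]_x v x ^+ 2) ?mulrDr ?lerD//.
by rewrite -(RintegralD measurableT hu2 hv2); apply: eq_Rintegral => x _; rewrite cmod_sqr.
Qed.

End plancherel_complex.

(** * Sums of tensor products in L^(2/m) *)

Section finite_sums.
Variable R : realType.

(** Cauchy-Schwarz: the sum of the squares of A v - C u equals A (A B - C^2). When A = 0 every [u i]
    in the sum vanishes. *)
Lemma sqr_sum_le (I : finType) (P : pred I) (u v : I -> R) :
  (\sum_(i | P i) u i * v i) ^+ 2 <=
  (\sum_(i | P i) u i ^+ 2) * (\sum_(i | P i) v i ^+ 2).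
Proof.
set A := \sum_(i | P i) u i ^+ 2; set B := \sum_(i | P i) v i ^+ 2.
set C := \sum_(i | P i) _.
have A0 : 0 <= A by apply: sumr_ge0 => i _; exact: sqr_ge0.
have h : 0 <= \sum_(i | P i) (A * v i - C * u i) ^+ 2.
  by apply: sumr_ge0 => i _; exact: sqr_ge0.
have E : \sum_(i | P i) (A * v i - C * u i) ^+ 2 = A * (A * B - C ^+ 2).
  transitivity (\sum_(i | P i) (A ^+ 2 * v i ^+ 2 - 2 * A * C * (u i * v i) + C ^+ 2 * u i ^+ 2)).
    by apply: eq_bigr => i _; ring.
  by rewrite big_split sumrB -!mulr_sumr -/A -/B -/C /=; ring.
have [A00|An0] := eqVneq A 0; last first.
  have Ap : 0 < A by rewrite lt_def An0.
  by move: h; rewrite E pmulr_rge0// subr_ge0.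
have u0 i : P i -> u i = 0.
  move=> Pi; apply/eqP; rewrite -sqrf_eq0; apply/eqP.
  by move: A00 => /psumr_eq0P; apply => // j _; exact: sqr_ge0.
rewrite A00 mul0r /C big1 ?expr0n//= => i Pi.
by rewrite u0// mul0r.
Qed.

(** A ratio c/(a+b) in [0, 1] is at most its power of exponent r; apply this to c = a and c = b and
    add. With r = 2/m this is the substitute for the triangle inequality in L^(2/m). *)
Lemma powR_subadditive (r a b : R) : 0 < r <= 1 -> 0 <= a -> 0 <= b ->
  (a + b) `^ r <= a `^ r + b `^ r.
Proof.
move=> /andP[r0 r1] a0 b0.
have [ab0|abn0] := eqVneq (a + b) 0.
  by rewrite ab0 powR0 ?gt_eqF// addr_ge0// powR_ge0.
have abp : 0 < a + b by rewrite lt_def abn0 addr_ge0.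
have key (c : R) : 0 <= c -> c <= a + b -> c / (a + b) * (a + b) `^ r <= c `^ r.
  move=> c0 cab; have -> : c `^ r = (c / (a + b)) `^ r * (a + b) `^ r.
    by rewrite -powRM ?divr_ge0 ?(ltW abp)// divfK.
  rewrite ler_wpM2r ?powR_ge0//.
  have q0 : 0 <= c / (a + b) by rewrite divr_ge0// ltW.
  have q1 : c / (a + b) <= 1 by rewrite ler_pdivrMr ?mul1r.
  have [->|qn0] := eqVneq (c / (a + b)) 0; first by rewrite powR_ge0.
  by apply: ger1_powR => //; rewrite lt_def qn0 q0 q1.
have := lerD (key a a0 _) (key b b0 _).
rewrite -mulrDl -mulrDl mulfV// mul1r; apply; rewrite ?lerDl ?lerDr//.
Qed.

Lemma powR_sum_le (r : R) (I : finType) (u : I -> R) : 0 < r <= 1 ->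
  (forall i, 0 <= u i) -> (\sum_i u i) `^ r <= \sum_i u i `^ r.
Proof.
move=> r01 u0; have [r0 _] := andP r01.
suff [//] : (\sum_i u i) `^ r <= \sum_i u i `^ r /\ 0 <= \sum_i u i.
elim/big_ind2 : _ => [|x a y b [xa x0] [yb y0]|i _]; last by split.
  by rewrite powR0 ?gt_eqF.
split; last exact: addr_ge0.
by apply: (le_trans (powR_subadditive r01 x0 y0)); rewrite lerD.
Qed.

(** The inequality of the means for the normalised numbers [u i / V i]. With [V i] a bound on the
    integral of [u i], the mean on the right integrates to at most 1, which does the work of
    Hölder's inequality. *)
Lemma geom_mean_le (m : nat) (u V : 'I_m.+1 -> R) : (forall i, 0 <= u i) ->
  (forall i, 0 < V i) ->
  (\prod_i u i) `^ (m.+1%:R^-1) <=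
  (\prod_i V i) `^ (m.+1%:R^-1) * (\sum_i u i / V i / m.+1%:R).
Proof.
move=> u0 V0.
have V0' : 0 <= \prod_i V i by apply: prodr_ge0 => i _; exact: ltW.
have w0 i : 0 <= u i / V i by rewrite divr_ge0// ltW.
have -> : \prod_i u i = (\prod_i V i) * \prod_i (u i / V i).
  by rewrite -big_split /=; apply: eq_bigr => i _; rewrite mulrC divfK// gt_eqF.
have w0' : 0 <= \prod_i (u i / V i) by exact: prodr_ge0.
rewrite powRM//; apply: ler_wpM2l; first exact: powR_ge0.
have := (@leif_AGM R _ [set: 'I_m.+1]%SET (fun i => u i / V i) (fun i _ => w0 i)).1.
rewrite cardsT card_ord => h.
have S0 : 0 <= \sum_i u i / V i / m.+1%:R.
  by apply: sumr_ge0 => i _; rewrite divr_ge0.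
apply: (@le_trans _ _ (((\sum_i u i / V i / m.+1%:R) ^+ m.+1) `^ m.+1%:R^-1)).
  apply: ge0_ler_powR; rewrite ?nnegrE ?invr_ge0 ?prodr_ge0 ?exprn_ge0//.
  by move: h; rewrite -mulr_suml; under eq_bigl do rewrite inE;
     under [X in _ <= (X / _) ^+ _ -> _]eq_bigl do rewrite inE.
by rewrite -powR_mulrn// -powRrM mulfV ?powRr1// pnatr_eq0.
Qed.

(** Distributivity with the i-th index frozen: a factor that is the indicator of [a] is inserted at
    position [i]. *)
Lemma sum_slice (m : nat) (I : finType) (i : 'I_m) (a : I) (G : 'I_m -> I -> R) :
  \sum_(k : {ffun 'I_m -> I} | k i == a) \prod_(j | j != i) G j (k j) =
  \prod_(j | j != i) \sum_b G j b.
Proof.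
pose H j b := if j == i then (b == a)%:R else G j b.
transitivity (\prod_j \sum_b H j b); last first.
  rewrite (bigD1 i)//= /H eqxx (bigD1 a)//= eqxx big1 ?addr0 ?mul1r.
    by apply: eq_bigr => j ji; apply: eq_bigr => b _; rewrite (negbTE ji).
  by move=> b /negbTE ->.
rewrite bigA_distr_bigA big_mkcond /=; apply: eq_bigr => k _.
rewrite [RHS](bigD1 i)//= /H eqxx; case: ifPn => [_|/negbTE _]; last by rewrite mul0r.
by rewrite mul1r; apply: eq_bigr => j /negbTE ->.
Qed.

End finite_sums.

(** * Division of the multi-indices according to their lightest slice *)

Section slices.
Variables (R : realType) (p : nat) (I : finType).
Local Notation m := p.+1.
Local Notation K := {ffun 'I_m -> I}.
Variable beta : K -> R.
Hypotheses (p0 : (0 < p)%N) (beta0 : forall k, 0 <= beta k).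
Hypothesis beta1 : \sum_k beta k ^+ m <= 1.

Definition slice_mass (i : 'I_m) (a : I) := \sum_(k : K | k i == a) beta k ^+ m.

(** Each multi-index goes to the part of a direction in which the slice through it is lightest. The
    other slices through it are then at least as heavy, which is what limits how many such indices a
    slice can contain. *)
Definition slice_index (k : K) : 'I_m := [arg min_(i < ord0) slice_mass i (k i)]%O.

Lemma slice_index_min k j :
  slice_mass (slice_index k) (k (slice_index k)) <= slice_mass j (k j).
Proof. by rewrite /slice_index; case: arg_minP => // i _; exact. Qed.

Lemma slice_mass_ge0 i a : 0 <= slice_mass i a.
Proof. by apply: sumr_ge0 => k _; rewrite exprn_ge0. Qed.

Lemma slice_mass_sum j : \sum_b slice_mass j b <= 1.
Proof.
apply: le_trans beta1; rewrite /slice_mass.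
by rewrite [leRHS](partition_big (fun k : K => k j) xpredT).
Qed.

(* On the slice, [beta k ^+ m <= S] and every slice mass through [k] is at least
   [S := slice_mass i a], so that [beta k ^+ p <= S ^+ p + beta k ^+ m / S], and the
   number of such [k] is at most [S ^- p]. *)
Lemma slice_bound i a :
  \sum_(k : K | (k i == a) && (slice_index k == i)) beta k ^+ p <= 2.
Proof.
have s0 := slice_mass_ge0 i a.
have [s00|sn0] := eqVneq (slice_mass i a) 0.
  rewrite big1 ?ler0n// => k /andP[ka _].
  have /eqP : beta k ^+ m = 0.
    by move: s00 => /psumr_eq0P; apply => // l _; rewrite exprn_ge0.
  by rewrite expf_eq0 /= => /eqP ->; rewrite expr0n -leqn0 leqNgt p0.
have sp : 0 < slice_mass i a by rewrite lt_def sn0.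
set s := slice_mass i a in s0 sn0 sp.
have ptw k : beta k ^+ p <= s ^+ p + beta k ^+ m / s.
  have [bs|sb] := lerP (beta k) s.
    apply: (@le_trans _ _ (s ^+ p)); first by rewrite lerXn2r ?nnegrE.
    by rewrite lerDl divr_ge0// exprn_ge0.
  apply: (@le_trans _ _ (beta k ^+ m / s)); last by rewrite lerDr exprn_ge0.
  by rewrite ler_pdivlMr// exprSr ler_wpM2l ?exprn_ge0// ltW.
apply: (@le_trans _ _ (\sum_(k : K | (k i == a) && (slice_index k == i))
    (s ^+ p + beta k ^+ m / s))); first by apply: ler_sum => k _.
rewrite big_split /= (_ : 2 = 1 + 1 :> R)//; apply: lerD.
  (* The count: for [k] in this part, s ^+ p is at most the product of the p slice masses in the
     other directions, and over the whole slice these products sum to a product of total masses,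
     each at most 1. *)
  apply: (@le_trans _ _ (\sum_(k : K | k i == a)
      \prod_(j | j != i) slice_mass j (k j))); last first.
    rewrite sum_slice; apply: prodr_ile1 => j _; rewrite slice_mass_sum andbT.
    by apply: sumr_ge0 => b _; exact: slice_mass_ge0.
  rewrite [leRHS](bigID (fun k : K => slice_index k == i)) /= -[leLHS]addr0.
  apply: lerD; last first.
    by apply: sumr_ge0 => k _; apply: prodr_ge0 => j _; exact: slice_mass_ge0.
  apply: ler_sum => k /andP[/eqP ka /eqP ki].
  have -> : s ^+ p = \prod_(j < m | j != i) s.
    rewrite prodr_const; congr (_ ^+ _).
    by rewrite (cardC1 i) card_ord.
  apply: ler_prod => j _; rewrite s0 /=.
  by have := slice_index_min k j; rewrite ki ka.
rewrite -mulr_suml ler_pdivrMr// mul1r /s /slice_mass.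
rewrite [leRHS](bigID (fun k : K => slice_index k == i)) /= lerDl.
by apply: sumr_ge0 => k _; rewrite exprn_ge0.
Qed.

End slices.

Section tensor_bound.
Context d (T : measurableType d) (R : realType).
Variable mu : {measure set T -> \bar R}.
Variables (p : nat) (I : finType) (a0 : I).
Local Notation m := p.+1.
Local Notation K := {ffun 'I_m -> I}.
Hypothesis p0 : (0 < p)%N.
Variables (F : 'I_m -> I -> T -> R[i]) (W : 'I_m -> I -> R) (V : 'I_m -> R).
Hypothesis mF : forall j a, cmeasurable (F j a).
Hypothesis F2 : forall j (c : I -> R),
  rintegrable mu (fun x => cmod (\sum_a (c a)%:C * F j a x) ^+ 2) /\
  \int[mu]_x cmod (\sum_a (c a)%:C * F j a x) ^+ 2 <= \sum_a c a ^+ 2 * W j a.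
Hypothesis W0 : forall j a, 0 <= W j a.
Hypothesis WV : forall j, \sum_a W j a <= V j.
Hypothesis V0 : forall j, 0 < V j.

Let F2a j a : rintegrable mu (fun x => cmod (F j a x) ^+ 2) /\
  \int[mu]_x cmod (F j a x) ^+ 2 <= W j a.
Proof.
have [] := F2 j (fun b => (b == a)%:R).
have E x : \sum_b ((b == a)%:R : R)%:C * F j b x = F j a x.
  by rewrite (bigD1 a)//= eqxx mul1r big1 ?addr0// => b /negbTE ->; rewrite mul0r.
have Ef : (fun x => cmod (\sum_b ((b == a)%:R : R)%:C * F j b x) ^+ 2) =
    (fun x => cmod (F j a x) ^+ 2) by apply/funext => x; rewrite E.
rewrite Ef.
by rewrite (bigD1 a)//= eqxx expr1n mul1r big1 ?addr0// => b /negbTE ->; rewrite expr0n mul0r.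
Qed.

Definition upd (k : K) (i : 'I_m) (a : I) : K := [ffun j => if j == i then a else k j].

(** Summation along the lines in direction [i]. The base point [a0] serves to pick one
    representative on each line, namely the multi-index whose i-th entry is [a0]. *)
Lemma sum_upd (U : nmodType) (i : 'I_m) (f : K -> U) :
  \sum_k f k = \sum_(k : K | k i == a0) \sum_a f (upd k i a).
Proof.
rewrite (partition_big (fun k => upd k i a0) (fun k : K => k i == a0)) /=; last first.
  by move=> k _; rewrite ffunE eqxx.
apply: eq_bigr => k /eqP ka0.
rewrite (reindex_onto (fun a => upd k i a) (fun k' : K => k' i)) /=; last first.
  move=> k' /eqP kE; apply/ffunP => j; rewrite ffunE; case: eqP => [->//|/eqP ji].
  by have /ffunP/(_ j) := kE; rewrite ffunE (negbTE ji).
apply: eq_bigl => a; rewrite ffunE eqxx eqxx andbT.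
apply/eqP/ffunP => j; rewrite !ffunE; case: eqP => [->//|//].
Qed.

Section one_index.
Variables (B : K -> R) (i : 'I_m) (s : R).
Hypothesis s0 : 0 < s.
Hypothesis Bs : forall a, \sum_(k : K | k i == a) B k ^+ 2 <= s.

Definition tensor_sum (x : T) : R[i] := \sum_k (B k)%:C * \prod_j F j (k j) x.

Let h (k : K) x : R[i] := \sum_a (B (upd k i a))%:C * F i a x.

(** The m functions whose product dominates the square of the sum: in the distinguished direction
    the squares of the sums along the lines, which contain the coefficients, and in each other
    direction the plain sum of squares of the factors. *)
Let u (j : 'I_m) x : R := if j == i then \sum_(k : K | k i == a0) cmod (h k x) ^+ 2
  else \sum_a cmod (F j a x) ^+ 2.

Let Vs (j : 'I_m) : R := if j == i then s * V i else V j.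

Let u_ge0 j x : 0 <= u j x.
Proof. by rewrite /u; case: ifP => _; apply: sumr_ge0 => k _; exact: sqr_ge0. Qed.

Let u_integral j : rintegrable mu (u j) /\ \int[mu]_x u j x <= Vs j.
Proof.
rewrite /u /Vs; case: ifPn => [/eqP _|ji]; last first.
  split; first by apply: rintegrable_sum => a; exact: (F2a j a).1.
  rewrite Rintegral_sum; last by move=> a; exact: (F2a j a).1.
  by apply: le_trans (WV j); apply: ler_sum => a _; exact: (F2a j a).2.
have hi k : rintegrable mu (fun x => cmod (h k x) ^+ 2).
  exact: (F2 i (fun a => B (upd k i a))).1.
have E : (fun x => \sum_(k : K | k i == a0) cmod (h k x) ^+ 2) =
    (fun x => \sum_(k <- [seq k : K <- index_enum K | k i == a0]) cmod (h k x) ^+ 2).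
  by apply/funext => x; rewrite big_filter.
split; first by rewrite E; apply: rintegrable_sum.
under eq_Rintegral do rewrite -big_filter; rewrite Rintegral_sum// big_filter.
apply: (@le_trans _ _ (\sum_(k : K | k i == a0) \sum_a B (upd k i a) ^+ 2 * W i a)).
  by apply: ler_sum => k _; exact: (F2 i (fun a => B (upd k i a))).2.
have -> : \sum_(k : K | k i == a0) \sum_a B (upd k i a) ^+ 2 * W i a =
    \sum_k B k ^+ 2 * W i (k i).
  rewrite (sum_upd i); apply: eq_bigr => k _; apply: eq_bigr => a _.
  by rewrite [upd k i a i]ffunE eqxx.
rewrite (partition_big (fun k : K => k i) xpredT) //=.
apply: (@le_trans _ _ (\sum_a s * W i a)); last first.
  by rewrite -mulr_sumr ler_wpM2l// ltW.
apply: ler_sum => a _; apply: (@le_trans _ _ ((\sum_(k : K | k i == a) B k ^+ 2) * W i a)).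
  by rewrite mulr_suml le_eqVlt; apply/orP; left; apply/eqP/eq_bigr => k /eqP ->.
by rewrite ler_wpM2r.
Qed.

(** Group the terms into lines in direction [i] and apply Cauchy-Schwarz over the set of lines. The
    sum of the products of the remaining factors squared then factorises. *)
Let tensor_sum_sqr x : cmod (tensor_sum x) ^+ 2 <= \prod_j u j x.
Proof.
have -> : tensor_sum x = \sum_(k : K | k i == a0) (\prod_(j | j != i) F j (k j) x) * h k x.
  rewrite /tensor_sum (sum_upd i); apply: eq_bigr => k _; rewrite mulr_sumr.
  apply: eq_bigr => a _; rewrite (bigD1 i)//= [upd k i a i]ffunE eqxx mulrCA mulrA mulrC.
  rewrite [F i a x * _]mulrC; congr (_ * _).
  by apply: eq_bigr => j ji; rewrite ffunE (negbTE ji).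
apply: (@le_trans _ _ ((\sum_(k : K | k i == a0)
    (\prod_(j | j != i) cmod (F j (k j) x)) * cmod (h k x)) ^+ 2)).
  rewrite ler_pXn2r// ?nnegrE ?cmod_ge0//; last first.
    by apply: sumr_ge0 => k _; rewrite mulr_ge0 ?cmod_ge0// prodr_ge0// => j _; exact: cmod_ge0.
  apply: (le_trans (cmod_sum _ _ _)); apply: ler_sum => k _.
  by rewrite cmodM cmod_prod.
apply: (le_trans (sqr_sum_le _ _ _)).
rewrite [leRHS](bigD1 i)//= mulrC /u eqxx.
rewrite le_eqVlt; apply/orP; left; apply/eqP; congr (_ * _).
transitivity (\sum_(k : K | k i == a0) \prod_(j | j != i) cmod (F j (k j) x) ^+ 2).
  by apply: eq_bigr => k _; rewrite prodrXl.
rewrite (sum_slice i a0 (fun j b => cmod (F j b x) ^+ 2)).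
by apply: eq_bigr => j /negbTE ->.
Qed.

Lemma cmeasurable_tensor_sum : cmeasurable tensor_sum.
Proof.
apply: cmeasurable_sum => k; apply: cmeasurableM; first exact: cmeasurable_cst.
exact: cmeasurable_prod.
Qed.

(** The integral of the m-th root of the product of the [u j] is bounded by [geom_mean_le] with
    weights [Vs j]; the integral of the mean is at most 1 because [u j] integrates to at most
    [Vs j]. *)
Lemma tensor_sum_one :
  (\int[mu]_x ((cmod (tensor_sum x) ^+ 2) `^ m%:R^-1)%:E <=
   ((s * \prod_j V j) `^ m%:R^-1)%:E)%E.
Proof.
have Vs0 j : 0 < Vs j by rewrite /Vs; case: ifP => _; rewrite ?mulr_gt0.
have VsE : \prod_j Vs j = s * \prod_j V j.
  rewrite (bigD1 i)//= [in RHS](bigD1 i)//= /Vs eqxx mulrA; congr (_ * _).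
  by apply: eq_bigr => j /negbTE ->.
have iu : rintegrable mu (fun x => \sum_j (Vs j * m%:R)^-1 * u j x).
  by apply: rintegrable_sum => j; apply: rintegrableZl; exact: (u_integral j).1.
apply: (@le_trans _ _ (\int[mu]_x ((\prod_j Vs j) `^ m%:R^-1 *
    \sum_j (Vs j * m%:R)^-1 * u j x)%:E)%E).
  apply: ge0_le_integral => //.
  - by move=> x _; rewrite lee_fin powR_ge0.
  - apply/measurable_EFinP; apply: (measurableT_comp (measurable_powR _)).
    exact/measurable_funX/measurable_cmod/cmeasurable_tensor_sum.
  - by apply/measurable_EFinP/measurable_funM => //; exact: rintegrable_measurable iu.
  - move=> x _; rewrite lee_fin.
    apply: (@le_trans _ _ ((\prod_j u j x) `^ m%:R^-1)).
      by apply: ge0_ler_powR; rewrite ?nnegrE ?invr_ge0 ?sqr_ge0 ?tensor_sum_sqr//;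
        apply: prodr_ge0.
    apply: (le_trans (geom_mean_le (fun j => u_ge0 j x) Vs0)).
    rewrite ler_wpM2l ?powR_ge0// le_eqVlt; apply/orP; left; apply/eqP/eq_bigr => j _.
    by rewrite invfM -mulrA mulrC.
rewrite Rintegral_EFin ?lee_fin; last exact: rintegrableZl.
rewrite RintegralZl// VsE -[leRHS]mulr1 ler_wpM2l ?powR_ge0//.
rewrite Rintegral_sum; last by move=> j; apply: rintegrableZl; exact: (u_integral j).1.
apply: (@le_trans _ _ (\sum_(j < m) m%:R^-1)); last first.
  rewrite sumr_const card_ord.
  have -> : (m%:R^-1 : R) *+ m = m%:R * m%:R^-1 by rewrite mulr_natl.
  by rewrite mulfV// pnatr_eq0.
apply: ler_sum => j _; rewrite RintegralZl//; last exact: (u_integral j).1.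
rewrite invfM mulrAC ler_piMl ?invr_ge0// mulrC ler_pdivrMr// mul1r.
exact: (u_integral j).2.
Qed.

End one_index.

Lemma tensor_sum_bound (B : K -> R) (X : R) : 0 < X ->
  \sum_k `|B k| `^ (2 * m%:R / p%:R) <= X `^ (2 * m%:R / p%:R) ->
  (\int[mu]_x (cmod (tensor_sum B x) `^ (2 / m%:R))%:E <=
   (m%:R * (2 * X ^+ 2 * \prod_j V j) `^ m%:R^-1)%:E)%E.
Proof.
move=> X0 BX.
have pR : (p%:R : R) != 0 by rewrite pnatr_eq0 -lt0n.
(* The normalisation for which both sides of the slice argument match: the sum of [beta k ^+ m] is
   at most 1 by hypothesis, while [beta k ^+ p] is [B k ^+ 2 / X ^+ 2]. Hence [slice_bound] bounds
   the sums of squares along slices by [2 * X ^+ 2]. *)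
pose beta (k : K) : R := (`|B k| / X) `^ (2 / p%:R).
have beta0 k : 0 <= beta k by exact: powR_ge0.
have betam k : beta k ^+ m = (`|B k| / X) `^ (2 * m%:R / p%:R).
  by rewrite -powR_mulrn// -powRrM mulrAC.
have betap k : beta k ^+ p = B k ^+ 2 / X ^+ 2.
  rewrite -powR_mulrn// -powRrM divfK// powR_mulrn ?divr_ge0 ?(ltW X0)//.
  by rewrite expr_div_n real_normK ?num_real.
have beta1 : \sum_k beta k ^+ m <= 1.
  have XX : 0 < X `^ (2 * m%:R / p%:R) by exact: powR_gt0.
  under eq_bigr do rewrite betam powRM ?invr_ge0 ?(ltW X0)//.
  rewrite -mulr_suml -[X^-1]powR_inv1 ?(ltW X0)// -powRrM mulN1r powRN.
  by rewrite ler_pdivrMr// mul1r.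
pose Bi (i : 'I_m) (k : K) : R := if slice_index beta k == i then B k else 0.
have BiE k : B k = \sum_i Bi i k.
  rewrite (bigD1 (slice_index beta k))//= /Bi eqxx big1 ?addr0// => i.
  by rewrite eq_sym => /negbTE ->.
have TE x : tensor_sum B x = \sum_i tensor_sum (Bi i) x.
  rewrite /tensor_sum exchange_big /=; apply: eq_bigr => k _.
  by rewrite BiE rmorph_sum mulr_suml.
have sl i a : \sum_(k : K | k i == a) Bi i k ^+ 2 <= 2 * X ^+ 2.
  have -> : \sum_(k : K | k i == a) Bi i k ^+ 2 =
      (\sum_(k : K | (k i == a) && (slice_index beta k == i)) beta k ^+ p) * X ^+ 2.
    rewrite big_mkcondr mulr_suml; apply: eq_bigr => k _; rewrite /Bi.
    by case: ifP => _; rewrite ?expr0n ?mul0r// betap divfK// expf_neq0// gt_eqF.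
  by rewrite ler_wpM2r ?sqr_ge0//; exact: slice_bound.
have s0 : 0 < 2 * X ^+ 2 by rewrite mulr_gt0// exprn_gt0.
have powE z : cmod z `^ (2 / m%:R) = (cmod z ^+ 2) `^ m%:R^-1.
  by rewrite powRrM powR_mulrn// cmod_ge0.
have mi (i : 'I_m) : measurable_fun setT (fun x => (cmod (tensor_sum (Bi i) x) ^+ 2) `^ m%:R^-1).
  apply: (measurableT_comp (measurable_powR _)).
  exact/measurable_funX/measurable_cmod/cmeasurable_tensor_sum.
apply: (@le_trans _ _ (\int[mu]_x (\sum_i
    ((cmod (tensor_sum (Bi i) x) ^+ 2) `^ m%:R^-1)%:E))%E).
  apply: ge0_le_integral => //.
  - by move=> x _; rewrite lee_fin powR_ge0.
  - apply/measurable_EFinP; apply: (measurableT_comp (measurable_powR _)).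
    exact/measurable_cmod/cmeasurable_tensor_sum.
  - by apply: emeasurable_sum => i; exact/measurable_EFinP.
  - move=> x _; rewrite sumEFin lee_fin TE.
    apply: (@le_trans _ _ ((\sum_i cmod (tensor_sum (Bi i) x)) `^ (2 / m%:R))).
      apply: ge0_ler_powR; rewrite ?nnegrE ?divr_ge0 ?cmod_ge0//; last exact: cmod_sum.
      by apply: sumr_ge0 => i _; exact: cmod_ge0.
    under [leRHS]eq_bigr do rewrite -powE.
    apply: powR_sum_le => [|i]; last exact: cmod_ge0.
    by rewrite divr_gt0//= ler_pdivrMr// mul1r ler_nat ltnS.
rewrite ge0_integral_sum//; last by move=> i x _; rewrite lee_fin powR_ge0.
  2: by move=> i; exact/measurable_EFinP.
apply: (@le_trans _ _ (\sum_(i < m) ((2 * X ^+ 2 * \prod_j V j) `^ m%:R^-1)%:E)%E).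
  by apply: lee_sum => i _; exact: tensor_sum_one.
by rewrite sumEFin lee_fin sumr_const card_ord [leRHS]mulr_natl.
Qed.

End tensor_bound.

(** * Fourier transforms of Schwartz functions *)

Section continuous_measurable.
Variables (R : realType) (m n : nat).

(* The sigma-algebra is generated by the coordinates, so the measurability of a
   continuous function is obtained from its values at rounded points. *)
Definition mxgrid (k : nat) (A : 'M[R]_(m, n)) : 'M[int]_(m, n) :=
  \matrix_(i, j) Num.floor (A i j * k.+1%:R).

Definition mxround (k : nat) (z : 'M[int]_(m, n)) : 'M[R]_(m, n) :=
  \matrix_(i, j) ((z i j)%:~R / k.+1%:R).

Lemma mxround_cvg (A : 'M[R]_(m, n)) : mxround k (mxgrid k A) @[k --> \oo] --> A.
Proof.
apply/cvg_ballP => e e0.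
near=> k; split => // i j; rewrite /ball/= !mxE.
have k0 : (0 : R) < k.+1%:R by rewrite ltr0n.
have -> : A i j - (Num.floor (A i j * k.+1%:R))%:~R / k.+1%:R =
    (A i j * k.+1%:R - (Num.floor (A i j * k.+1%:R))%:~R) / k.+1%:R.
  by rewrite mulrBl mulfK// gt_eqF.
rewrite normrM normfV (gtr0_norm k0) ltr_pdivrMr// ger0_norm ?subr_ge0 ?ge_floor//.
apply: (@lt_le_trans _ _ 1).
  by rewrite ltrBlDl; have := floorD1_gt (A i j * k.+1%:R); rewrite intrD.
have : e^-1 < k.+1%:R.
  near: k; exists (Num.bound e^-1) => // k /= bk.
  apply: (lt_le_trans (archi_boundP _)); first by rewrite invr_ge0 ltW.
  by rewrite ler_nat ltnW.
by rewrite -(ltr_pM2l e0) mulfV ?gt_eqF// => /ltW.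
Unshelve. all: by end_near. Qed.

Lemma measurable_floor_eq (z : int) (k : nat) (i : 'I_m) (j : 'I_n) :
  measurable [set A : 'M[R]_(m, n) | Num.floor (A i j * k.+1%:R) = z].
Proof.
have -> : [set A : 'M[R]_(m, n) | Num.floor (A i j * k.+1%:R) = z] =
    (fun A : 'M[R]_(m, n) => A i j * k.+1%:R) @^-1` `[z%:~R, (z + 1)%:~R[.
  apply/seteqP; split => A /=; rewrite in_itv/=.
    by move=> <-; rewrite ge_floor floorD1_gt.
  by move=> h; apply: floor_def; rewrite andbC andbC.
rewrite -[X in measurable X]setTI.
have : measurable_fun setT (fun A : 'M[R]_(m, n) => A i j * k.+1%:R).
  by apply: measurable_funM => //; exact: measurable_entry.
by apply.
Qed.

Lemma continuous_mx_measurable (f : 'M[R]_(m, n) -> R) :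
  continuous f -> measurable_fun setT f.
Proof.
move=> cf; apply: (measurable_fun_cvg (h := fun k A => f (mxround k (mxgrid k A)))).
  move=> k _ Y mY; rewrite setTI.
  (* The rounded point takes countably many values; the preimage is the union, over the codes [N] of
     integer matrices, of the grid cells at whose node [f] lies in [Y]. *)
  have -> : (fun A => f (mxround k (mxgrid k A))) @^-1` Y =
      \bigcup_(N in [set N | if unpickle N is Some z then Y (f (mxround k z)) else False])
      (if @unpickle 'M[int]_(m, n) N is Some z then
       \bigcap_(ij in [set: 'I_m * 'I_n]) [set A | Num.floor (A ij.1 ij.2 * k.+1%:R) = z ij.1 ij.2]
       else set0).
    apply/seteqP; split => A /=.
      move=> YA; exists (pickle (mxgrid k A)); rewrite /= pickleK//.
      by move=> [i j] _ /=; rewrite mxE.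
    move=> [N /=]; case: unpickle => // z Yz Az.
    rewrite (_ : mxgrid k A = z)//; apply/matrixP => i j.
    by rewrite mxE; exact: (Az (i, j)).
  apply: bigcup_measurable => N _.
  case: (@unpickle 'M[int]_(m, n) N) => [z|]; last exact: measurable0.
  by apply: fin_bigcap_measurable => // -[i j] _; exact: measurable_floor_eq.
move=> A _; apply: (continuous_cvg _ (cf A)); exact: mxround_cvg.
Qed.

End continuous_measurable.

Section directional.
Variable R : realType.

(** The two difference quotients are the same function of [h], so the directional derivative of [g]
    along [w] is enough and no differentiability of [g] is required, as it would be by the chain
    rule. *)
Lemma is_derive_line (V W : normedModType R) (U : normedModType R) (phi : V -> W) (g : W -> U)
  (x v : V) (w : W) (dg : U) :
  (forall h : R, phi (h *: v + x) = h *: w + phi x) ->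
  is_derive (phi x) w g dg -> is_derive x v (g \o phi) dg.
Proof.
move=> phiE [dg1 dg2].
have E : (fun h : R => h^-1 *: (((g \o phi) \o shift x) (h *: v) - (g \o phi) x)) =
    (fun h : R => h^-1 *: ((g \o shift (phi x)) (h *: w) - g (phi x))).
  by apply/funext => h /=; rewrite phiE.
by split; rewrite /derivable /derive ?E.
Qed.

Lemma mx_lineE m n (h : R) (A B : 'M[R]_(m, n)) i j :
  (h *: A + B) i j = h * A i j + B i j.
Proof. by rewrite !mxE. Qed.

Lemma row_cons_line0 n (s h : R) (x : 'rV[R]_n) :
  row_cons (h *: 1 + s : measurableTypeR R, x) =
  h *: delta_mx 0 ord0 + row_cons (s : measurableTypeR R, x).
Proof.
apply/rowP => j; rewrite mx_lineE [delta_mx _ _ _ _]mxE.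
case: (unliftP ord0 j) => [k ->|->].
  by rewrite !row_consS /= mulr0 add0r.
by rewrite !row_cons0 /= /GRing.scale/= !mulr1.
Qed.

Lemma row_consE0 n (s : R) (x : 'rV[R]_n) :
  row_cons (s : measurableTypeR R, x) =
  s *: delta_mx 0 ord0 + row_cons (0 : measurableTypeR R, x).
Proof.
rewrite -row_cons_line0; congr row_cons; congr pair.
by rewrite addr0 /GRing.scale/= mulr1.
Qed.

Lemma row_cons_lineS n (s h : R) i (x : 'rV[R]_n) :
  row_cons (s : measurableTypeR R, h *: delta_mx 0 i + x) =
  h *: delta_mx 0 (lift ord0 i) + row_cons (s : measurableTypeR R, x).
Proof.
apply/rowP => j; rewrite mx_lineE [delta_mx _ _ _ _]mxE.
case: (unliftP ord0 j) => [k ->|->].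
  by rewrite !row_consS /= mx_lineE [delta_mx _ _ _ _]mxE (inj_eq (@lift_inj _ ord0)).
by rewrite !row_cons0 /= mulr0 add0r.
Qed.

Lemma is_derive_row_cons0 n (g g' : 'rV[R]_n.+1 -> R) (x : 'rV[R]_n) :
  (forall y, is_derive y (delta_mx 0 ord0) g (g' y)) ->
  forall s : R, is_derive s 1 (fun s : R => g (row_cons (s : measurableTypeR R, x)))
    (g' (row_cons (s : measurableTypeR R, x))).
Proof.
move=> dg s.
apply: (@is_derive_line _ _ _ (fun s : R => row_cons (s : measurableTypeR R, x)) g _ _
  (delta_mx 0 ord0)) => // h.
exact: row_cons_line0.
Qed.

Lemma is_derive_row_consS n i (g g' : 'rV[R]_n.+1 -> R) (s : R) :
  (forall y, is_derive y (delta_mx 0 (lift ord0 i)) g (g' y)) ->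
  forall x : 'rV[R]_n, is_derive x (delta_mx 0 i)
    (fun x => g (row_cons (s : measurableTypeR R, x)))
    (g' (row_cons (s : measurableTypeR R, x))).
Proof.
move=> dg x.
apply: (@is_derive_line _ _ _ (fun x => row_cons (s : measurableTypeR R, x)) g _ _
  (delta_mx 0 (lift ord0 i))) => // h.
exact: row_cons_lineS.
Qed.

End directional.

(** * Decay of Schwartz functions and of their Fourier transforms *)

Section decay.
Variable R : realType.
Local Notation leb := (@lebesgue_measure R).

Lemma oneDsqr_gt0_real (s : R) : 0 < 1 + s ^+ 2.
Proof. by rewrite ltr_pwDl// sqr_ge0. Qed.

Lemma rintegrable_oneDsqr : rintegrable leb (fun s : R => (1 + s ^+ 2)^-1).
Proof.
have [] // := @ge0_integral_le_FTC R atan (fun s => (1 + s ^+ 2)^-1) pi.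
- exact: continuous_oneDsqrV.
- by move=> s; rewrite invr_ge0 ltW// oneDsqr_gt0_real.
- by move=> x y; have := atan_ltpi2 y; have := atan_gtNpi2 x; lra.
Qed.

(** An integrable majorant in tensor form, so that it also serves as the product majorant in
    Fubini's theorem when a coordinate is split off. *)
Definition decay n (x : 'rV[R]_n) : R := \prod_i (1 + x 0 i ^+ 2)^-1.

Lemma decay_gt0 n (x : 'rV[R]_n) : 0 < decay x.
Proof. by apply: prodr_gt0 => i _; rewrite invr_gt0 oneDsqr_gt0_real. Qed.

Lemma decay_le1 n (x : 'rV[R]_n) : decay x <= 1.
Proof.
apply: prodr_ile1 => i _; rewrite invr_ge0 (ltW (oneDsqr_gt0_real _)) /=.
by rewrite invf_le1 ?oneDsqr_gt0_real// lerDl sqr_ge0.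
Qed.

Lemma rintegrable_decay n : rintegrable (lebesgue_rV n) (@decay n).
Proof. by have [] := prod_coord_integral (fun _ : 'I_n => rintegrable_oneDsqr). Qed.

Lemma decay_row_cons n (s : R) (x : 'rV[R]_n) :
  decay (row_cons (s : measurableTypeR R, x)) = (1 + s ^+ 2)^-1 * decay x.
Proof.
rewrite /decay big_ord_recl row_cons0; congr (_ * _).
by apply: eq_bigr => i _; rewrite row_consS.
Qed.

(** The largest coordinate y controls the product by (1 + y)^n, which is at most 2^n or 2^n y^n
    according to whether y <= 1. A largest coordinate can be missing only when n = 0. *)
Lemma prodD1_le n (y : 'I_n -> R) : (forall i, 0 <= y i) ->
  \prod_i (1 + y i) <= 2 ^+ n * (1 + \sum_i y i ^+ n).
Proof.
move=> y0; pose Y := \sum_i y i ^+ n.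
have Y0 : 0 <= Y by apply: sumr_ge0 => i _; exact: exprn_ge0.
have [/existsP[i0 /forallP i0max]|] := boolP [exists i, forall j, y j <= y i]; last first.
  case: n y y0 Y Y0 => [|n] y y0 Y Y0.
    by rewrite !big_ord0 expr0 addr0 mulr1.
  move=> /existsPn /(_ [arg max_(i > ord0) y i]%O); case: arg_maxP => // i _ imax.
  by move=> /forallP; case=> j; exact: imax.
have n0 : (0 < n)%N by case: n y y0 i0 i0max {Y Y0} => // ? ? [].
have yi : y i0 ^+ n <= Y.
  by rewrite /Y (bigD1 i0)//= lerDl sumr_ge0// => j _; exact: exprn_ge0.
apply: (@le_trans _ _ ((1 + y i0) ^+ n)).
  rewrite -[X in _ ^+ X]card_ord -prodr_const; apply: ler_prod => j _.
  by rewrite addr_ge0//= lerD2l.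
have [y1|y1] := lerP (y i0) 1.
  apply: (@le_trans _ _ (2 ^+ n)).
    by rewrite lerXn2r ?nnegrE ?addr_ge0// (_ : 2 = 1 + 1 :> R)// lerD2l.
  by rewrite ler_peMr ?exprn_ge0// lerDl.
apply: (@le_trans _ _ ((2 * y i0) ^+ n)).
  by rewrite lerXn2r ?nnegrE ?addr_ge0 ?mulr_ge0//; lra.
rewrite exprMn ler_wpM2l ?exprn_ge0// (le_trans yi)// lerDr//.
Qed.

(** Through [prodD1_le] with y_i = x_i^2, bounds on [c] and on [c] times the pure powers x_i^(2n)
    control the product of all factors; no mixed monomial has to be estimated. *)
Lemma decay_bound n (x : 'rV[R]_n) (c K : R) : 0 <= c -> c <= K ->
  (forall i, c * x 0 i ^+ (2 * n) <= K) -> c <= 2 ^+ n * (n.+1%:R * K) * decay x.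
Proof.
move=> c0 cK cxK.
have P0 : 0 < \prod_i (1 + x 0 i ^+ 2) by apply: prodr_gt0 => i _; exact: oneDsqr_gt0_real.
rewrite /decay prodfV ler_pdivlMr//.
apply: (@le_trans _ _ (c * (2 ^+ n * (1 + \sum_i (x 0 i ^+ 2) ^+ n)))).
  by rewrite ler_wpM2l//; apply: prodD1_le => i; exact: sqr_ge0.
rewrite mulrCA ler_wpM2l ?exprn_ge0// mulrDr mulr1 mulr_sumr.
apply: (@le_trans _ _ (K + \sum_(i < n) K)).
  by rewrite lerD//; apply: ler_sum => i _; rewrite -exprM.
by rewrite sumr_const card_ord mulr_natl mulrS.
Qed.

End decay.

Section integration_by_parts.
Variable R : realType.
Local Notation leb := (@lebesgue_measure R).

Lemma measurable_row_cons_snd n (s : R) :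
  measurable_fun setT (fun x : 'rV[R]_n => row_cons (s : measurableTypeR R, x)).
Proof. exact: measurableT_comp (@measurable_row_cons R n) (pair1_measurable _). Qed.

Lemma cosD_pihalf (x : R) : cos (x + pi / 2) = - sin x.
Proof. by rewrite cosD cos_pihalf sin_pihalf mulr0 add0r mulr1. Qed.

(** The derivative of g(s) sin(w s + t) integrates to 0 because of the decay of g. Writing -sin as
    the cosine shifted by pi / 2 keeps the shape of the integral, so that the formula can be
    iterated. *)
Lemma ibp_line (g g' : R -> R) (K w t : R) :
  (forall s : R, is_derive s 1 g (g' s)) -> continuous g' ->
  (forall s, `|g s| <= K * (1 + s ^+ 2)^-1) ->
  (forall s, `|g' s| <= K * (1 + s ^+ 2)^-1) ->
  w * \int[leb]_s (g s * cos (w * s + t)) =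
  \int[leb]_s (g' s * cos (w * s + t + pi / 2)).
Proof.
move=> dg cg' gK g'K; have cg := is_derive_continuous dg.
have iK : rintegrable leb (fun s : R => K * (1 + s ^+ 2)^-1).
  exact/rintegrableZl/rintegrable_oneDsqr.
have ig : rintegrable leb g.
  by apply: (rintegrable_le _ iK) => //; exact: continuous_measurable_fun.
have ig' : rintegrable leb g'.
  by apply: (rintegrable_le _ iK) => //; exact: continuous_measurable_fun.
have mc (u : R) : measurable_fun setT (fun s : R => cos (w * s + u)).
  exact: measurable_cos_affine.
have i1 : rintegrable leb (fun s => g s * cos (w * s + t)).
  by apply: (rintegrable_bounded ig (mc t) (c := 1)) => s; exact: cos_norm_le1.
have i2 : rintegrable leb (fun s => g' s * cos (w * s + t + pi / 2)).
  apply: (rintegrable_bounded ig' _ (c := 1)).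
    by under eq_fun do rewrite -addrA; exact: mc.
  by move=> s; exact: cos_norm_le1.
apply/eqP; rewrite -subr_eq0 -RintegralZl//; apply/eqP.
rewrite -RintegralB//; last exact: rintegrableZl.
apply: (@Rintegral_derive_eq0 R (fun s => g s * sin (w * s + t))).
- move=> s.
  have dl : is_derive s 1 (fun s : R => w * s + t) w.
    by apply: is_derive_eq; rewrite addr0 ?mulr1// /GRing.scale/= mulr1.
  have ds : is_derive s 1 (fun s : R => sin (w * s + t)) (w * cos (w * s + t)).
    by have := @is_derive1_comp _ sin (fun s : R => w * s + t) s _ _
      (is_derive_sin (w * s + t)) dl; rewrite mulrC.
  have dgs := dg s.
  by apply: is_derive_eq; rewrite /GRing.scale/= cosD_pihalf; ring.
- move=> s; apply: cvgB.
    apply: cvgM; first exact: cvg_cst.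
    by apply: cvgM; [exact: cg|exact: continuous_cos_affine].
  apply: cvgM; first exact: cg'.
  under eq_fun do rewrite -addrA; rewrite -addrA; exact: continuous_cos_affine.
- by apply: rintegrableB => //; exact: rintegrableZl.
- have K0 : 0 <= K.
    by have := gK 0; rewrite expr0n/= addr0 invr1 mulr1; exact: le_trans.
  have b (s : R) : `|g s * sin (w * s + t)| <= K * (1 + s ^+ 2)^-1.
    by rewrite normrM; apply: le_trans (gK s); rewrite ler_piMr// sin_norm_le1.
  have hK : (2 * K * k.+1%:R^-1) @[k --> \oo] --> (0 : R).
    rewrite -[X in _ --> X](mulr0 (2 * K)); apply: cvgM; first exact: cvg_cst.
    exact: cvg_harmonic.
  have bound (k : nat) : `|g k.+1%:R * sin (w * k.+1%:R + t) -
      g (- k.+1%:R) * sin (w * - k.+1%:R + t)| <= 2 * K * k.+1%:R^-1.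
    apply: (le_trans (ler_normB _ _)).
    have q : K * (1 + (k.+1%:R : R) ^+ 2)^-1 <= K * k.+1%:R^-1.
      rewrite ler_wpM2l// lef_pV2 ?posrE ?oneDsqr_gt0_real//.
      by rewrite (@le_trans _ _ (k.+1%:R ^+ 2)) ?lerDr// expr2 ler_peMr// ler1n.
    apply: (@le_trans _ _ (K * k.+1%:R^-1 + K * k.+1%:R^-1)); last first.
      by rewrite -mulrDl -mulr2n mulr_natl.
    apply: lerD; first exact: le_trans (b _) q.
    by apply: le_trans (b _) _; rewrite sqrrN.
  apply/cvgr0Pnorm_le => e e0.
  have /cvgr0Pnorm_le/(_ e e0) := hK; apply: filterS => k; apply: le_trans.
  by apply: (le_trans (bound k)); exact: ler_norm.
Qed.

(** Induction on the dimension. If [i] is the first coordinate, it is made the inner variable and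
    [ibp_line] applies; otherwise the first coordinate is frozen and its contribution to the phase
    is absorbed into [t], which is why [t] is arbitrary. *)
Lemma ibp n (i : 'I_n) (g g' : 'rV[R]_n -> R) (K t : R) (xi : 'rV[R]_n) :
  (forall x, is_derive x (delta_mx 0 i) g (g' x)) ->
  (forall x, continuous (fun s : R => g' (s *: delta_mx 0 i + x))) ->
  measurable_fun setT g -> measurable_fun setT g' ->
  (forall x, `|g x| <= K * decay x) -> (forall x, `|g' x| <= K * decay x) ->
  2 * pi * xi 0 i * \int[lebesgue_rV n]_x (g x * cos (2 * pi * dot x xi + t)) =
  \int[lebesgue_rV n]_x (g' x * cos (2 * pi * dot x xi + t + pi / 2)).
Proof.
elim: n i g g' K t xi => [[]//|n ih] i g g' K t xi dg cg' mg mg' gK g'K.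
pose xi0 := xi 0 ord0; pose xi' : 'rV[R]_n := \row_j xi 0 (lift ord0 j).
have xiE : xi = row_cons (xi0 : measurableTypeR R, xi') by exact: row_cons_surj.
have dE (z : measurableTypeR R * 'rV[R]_n) : dot (row_cons z) xi = z.1 * xi0 + dot z.2 xi'.
  by rewrite xiE dot_row_cons.
have K0 : 0 <= K.
  have := gK 0; have := decay_gt0 (0 : 'rV[R]_n.+1); have := normr_ge0 (g 0).
  by move=> a b c; rewrite -(pmulr_lge0 _ b); exact: le_trans c.
have hu : rintegrable leb (fun s : R => (1 + s ^+ 2)^-1) := rintegrable_oneDsqr R.
have hv : rintegrable (lebesgue_rV n) (fun x => K * decay x).
  exact/rintegrableZl/rintegrable_decay.
have mcos (u : R) : measurable_fun setT (fun x : 'rV[R]_n.+1 => cos (2 * pi * dot x xi + u)).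
  by apply: measurable_cos_comp; apply: measurable_funD => //; exact: measurable_pidot.
have mF (f : 'rV[R]_n.+1 -> R) u : measurable_fun setT f ->
    measurable_fun setT (fun x => f x * cos (2 * pi * dot x xi + u)).
  by move=> mf; exact: measurable_funM.
have bF (f : 'rV[R]_n.+1 -> R) (u s : R) x : (forall x, `|f x| <= K * decay x) ->
    `|f (row_cons (s : measurableTypeR R, x)) *
      cos (2 * pi * dot (row_cons (s : measurableTypeR R, x)) xi + u)| <=
    `|(1 + s ^+ 2)^-1| * `|K * decay x|.
  move=> fK; rewrite normrM (@le_trans _ _ (K * decay (row_cons (s : measurableTypeR R, x))))//.
    by apply: le_trans (fK _); rewrite ler_piMr// cos_norm_le1.
  rewrite decay_row_cons !ger0_norm ?invr_ge0 ?(ltW (oneDsqr_gt0_real _))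
    ?mulr_ge0 ?(ltW (decay_gt0 _))//.
  by rewrite mulrCA.
have mg'2 : measurable_fun setT (fun x => g' x * cos (2 * pi * dot x xi + t + pi / 2)).
  by under eq_fun do rewrite -addrA; exact: mF.
have bg'2 (s : R) x : `|g' (row_cons (s : measurableTypeR R, x)) *
     cos (2 * pi * dot (row_cons (s : measurableTypeR R, x)) xi + t + pi / 2)| <=
    `|(1 + s ^+ 2)^-1| * `|K * decay x|.
  by rewrite -addrA; exact: bF.
have mfs (f : 'rV[R]_n.+1 -> R) (s : R) : measurable_fun setT f ->
    measurable_fun setT (fun x => f (row_cons (s : measurableTypeR R, x))).
  by move=> mf; exact: measurableT_comp mf (measurable_row_cons_snd s).
case: (unliftP ord0 i) => [j ij|i0]; last first.
- rewrite (Rintegral_rV2 hu hv (mF g t mg) (fun s x => bF g t s x gK)).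
  rewrite (Rintegral_rV2 hu hv mg'2 bg'2).
  have iT := fubini_integrable_snd hu hv (measurableT_comp (mF g t mg) (@measurable_row_cons R n))
    (fun s x => bF g t s x gK).
  rewrite -RintegralZl//.
  apply: eq_Rintegral => x _.
  have aE (s : R) : 2 * pi * xi0 * s + (2 * pi * dot x xi' + t) =
      2 * pi * (s * xi0 + dot x xi') + t by ring.
  under eq_Rintegral do rewrite dE /= -aE.
  under [RHS]eq_Rintegral do rewrite dE /= -aE.
  rewrite i0 -/xi0; apply: (ibp_line (K := K * decay x)).
  + by move=> s; apply: is_derive_row_cons0; rewrite -i0.
  + have -> : (fun s : R => g' (row_cons (s : measurableTypeR R, x))) =
        (fun s : R => g' (s *: delta_mx 0 i + row_cons (0 : measurableTypeR R, x))).
      by apply/funext => s; rewrite i0 -row_consE0.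
    exact: cg'.
  + by move=> s; apply: (le_trans (gK _)); rewrite decay_row_cons mulrA mulrAC.
  + by move=> s; apply: (le_trans (g'K _)); rewrite decay_row_cons mulrA mulrAC.
- rewrite (Rintegral_rV1 hu hv (mF g t mg) (fun s x => bF g t s x gK)).
  rewrite (Rintegral_rV1 hu hv mg'2 bg'2).
  have iT := fubini_integrable_fst hu hv (measurableT_comp (mF g t mg) (@measurable_row_cons R n))
    (fun s x => bF g t s x gK).
  rewrite -RintegralZl//.
  apply: eq_Rintegral => s _.
  have aE x : 2 * pi * dot x xi' + (2 * pi * (s * xi0) + t) =
      2 * pi * dot (row_cons (s : measurableTypeR R, x)) xi + t.
    by rewrite dE /=; ring.
  under eq_Rintegral do rewrite -aE.
  under [RHS]eq_Rintegral do rewrite -aE.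
  have -> : xi 0 i = xi' 0 j by rewrite mxE -ij.
  apply: (ih j _ _ ((1 + s ^+ 2)^-1 * K)).
  + by apply: is_derive_row_consS; rewrite -ij.
  + by move=> x; under eq_fun do rewrite row_cons_lineS -ij; exact: cg'.
  + exact: mfs.
  + exact: mfs.
  + by move=> x; apply: (le_trans (gK _)); rewrite decay_row_cons mulrA [_ * K]mulrC.
  + by move=> x; apply: (le_trans (g'K _)); rewrite decay_row_cons mulrA [_ * K]mulrC.
Qed.

End integration_by_parts.

Section multi_index.
Variables (R : realType) (m n : nat).

Definition mdelta (k : nat) (i : 'I_m) (j : 'I_n) : 'M[nat]_(m, n) :=
  \matrix_(i', j') (if (i', j') == (i, j) then k else 0%N).

Lemma mdeg_mdelta k i j : mdeg (mdelta k i j) = k.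
Proof.
rewrite /mdeg (bigD1 i)//= (bigD1 j)//= mxE eqxx !big1 ?addn0//.
  by move=> i' /negbTE i'i; apply: big1 => j' _; rewrite mxE xpair_eqE i'i.
by move=> j' /negbTE j'j; rewrite mxE xpair_eqE j'j andbF.
Qed.

Lemma mpower_mdelta k i j (x : 'M[R]_(m, n)) : mpower (mdelta k i j) x = x i j ^+ k.
Proof.
rewrite /mpower (bigD1 i)//= (bigD1 j)//= mxE eqxx !big1 ?mulr1//.
  by move=> i' /negbTE i'i; apply: big1 => j' _; rewrite mxE xpair_eqE i'i expr0.
by move=> j' /negbTE j'j; rewrite mxE xpair_eqE j'j andbF expr0.
Qed.

Lemma mpartial_mdelta k i j (g : 'M[R]_(m, n) -> R) :
  mpartial_real (mdelta k i j) g = iter k (partial i j) g.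
Proof.
rewrite /mpartial_real.
have H (s : seq ('I_m * 'I_n)) : uniq s ->
    foldr (fun ij => iter (mdelta k i j ij.1 ij.2) (partial ij.1 ij.2)) g s =
    if (i, j) \in s then iter k (partial i j) g else g.
  elim: s => // -[a b] s ih /= /andP[abs us]; rewrite ih// in_cons mxE eq_sym.
  by case: eqP => [[-> ->]|_] //=; rewrite (negbTE abs).
by rewrite H ?enum_uniq// mem_enum.
Qed.

Lemma Ck_real_partial k i j (g : 'M[R]_(m, n) -> R) :
  Ck_real k.+1 g -> Ck_real k (partial i j g).
Proof. by move=> [_ /(_ i j)[]]. Qed.

Lemma Ck_real_iter k l i j (g : 'M[R]_(m, n) -> R) :
  Ck_real (l + k)%N g -> Ck_real k (iter l (partial i j) g).
Proof.
elim: l k => // l ih k h; rewrite iterS; apply: Ck_real_partial; apply: ih.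
by rewrite addnS -addSn.
Qed.

Lemma Ck_real_continuous k (g : 'M[R]_(m, n) -> R) : Ck_real k g -> continuous g.
Proof. by case: k => [|k] []. Qed.

Lemma Ck_real_is_derive k i j (g : 'M[R]_(m, n) -> R) : Ck_real k.+1 g ->
  forall x, is_derive x (delta_mx i j) g (partial i j g x).
Proof. by move=> [_ /(_ i j)[dg _]] x; apply: DeriveDef. Qed.

End multi_index.

Section real_schwartz.
Variables (R : realType) (n : nat).
Implicit Type g : 'rV[R]_n -> R.
Local Notation mu := (@lebesgue_rV R n).

Definition real_schwartz g := (forall k, Ck_real k g) /\
  forall a b : 'M[nat]_(1, n), exists K : R, forall x,
    `|mpower a x| * `|mpartial_real b g x| <= K.

Lemma schwartz_Re (f : 'rV[R]_n -> R[i]) : schwartz f ->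
  real_schwartz (fun x => complex.Re (f x)).
Proof.
move=> [fk fK]; split=> [k|a b]; first by have [] := fk k.
have [K hK] := fK a b; exists K => x; apply: le_trans (hK x).
by rewrite ler_wpM2l//; exact: (Re_le_cmod (mpartial b f x)).
Qed.

Lemma schwartz_Im (f : 'rV[R]_n -> R[i]) : schwartz f ->
  real_schwartz (fun x => complex.Im (f x)).
Proof.
move=> [fk fK]; split=> [k|a b]; first by have [] := fk k.
have [K hK] := fK a b; exists K => x; apply: le_trans (hK x).
by rewrite ler_wpM2l//; exact: (Im_le_cmod (mpartial b f x)).
Qed.

Lemma schwartz_decay g l i : real_schwartz g ->
  exists K : R, forall x, `|iter l (partial 0 i) g x| <= K * decay x.
Proof.
move=> [_ gK].
have [K0 hK0] := gK (mdelta 0 0 i) (mdelta l 0 i).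
have /choice[K hK] : forall j : 'I_n, exists K : R, forall x,
    `|iter l (partial 0 i) g x| * x 0 j ^+ (2 * n) <= K.
  move=> j; have [K hK] := gK (mdelta (2 * n) 0 j) (mdelta l 0 i).
  exists K => x; apply: le_trans (hK x); rewrite mpower_mdelta mpartial_mdelta mulrC.
  by rewrite ler_wpM2r// ler_norm.
have Kj0 j : 0 <= K j.
  by apply: le_trans (hK j 0); rewrite mulr_ge0// mulnC exprM sqr_ge0.
have hK0' x : `|iter l (partial 0 i) g x| <= K0.
  by have := hK0 x; rewrite mpower_mdelta expr0 normr1 mul1r mpartial_mdelta.
exists (2 ^+ n * (n.+1%:R * (K0 + \sum_j K j))) => x; apply: decay_bound => //.
  by apply: (le_trans (hK0' x)); rewrite lerDl sumr_ge0.
move=> j; apply: (le_trans (hK j x)).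
rewrite (bigD1 j)//= addrCA lerDl addr_ge0 ?sumr_ge0//.
by apply: le_trans (hK0' x).
Qed.

Lemma real_schwartz_decay g : real_schwartz g ->
  exists K : R, forall x, `|g x| <= K * decay x.
Proof.
(* [schwartz_decay] asks for a coordinate direction, so dimension 0, where the space is a single
   point, is treated apart. *)
move=> gS; have [n0|n0] := posnP n; last exact: (schwartz_decay 0 (Ordinal n0) gS).
have nI : 'I_n -> False by case=> i; rewrite n0.
exists `|g 0| => x; rewrite /decay big1 ?mulr1; last by move=> i; case: (nI i).
by rewrite (_ : x = 0)//; apply/rowP => i; case: (nI i).
Qed.

Lemma real_schwartz_continuous g : real_schwartz g -> continuous g.
Proof. by move=> [/(_ 0%N) h _]; exact: Ck_real_continuous h. Qed.

Lemma real_schwartz_measurable g : real_schwartz g -> measurable_fun setT g.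
Proof. by move=> gS; apply: continuous_mx_measurable; exact: real_schwartz_continuous. Qed.

Lemma real_schwartz_integrable g : real_schwartz g -> rintegrable mu g.
Proof.
move=> gS; have [K hK] := real_schwartz_decay gS.
apply: (rintegrable_le _ (rintegrableZl K (rintegrable_decay R n)) hK).
exact: real_schwartz_measurable.
Qed.

Lemma real_schwartz_sqr g : real_schwartz g -> rintegrable mu (fun x => g x ^+ 2).
Proof.
move=> gS; have [K hK] := real_schwartz_decay gS.
apply: (rintegrable_le _ (rintegrableZl (K ^+ 2) (rintegrable_decay R n))).
  by apply: measurable_funX; exact: real_schwartz_measurable.
move=> x; rewrite ger0_norm ?sqr_ge0// -real_normK ?num_real//.
have d0 := decay_gt0 x; have d1 := decay_le1 x.
apply: (@le_trans _ _ ((K * decay x) ^+ 2)).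
  by rewrite lerXn2r ?nnegrE//; exact: le_trans (hK x).
by rewrite exprMn ler_wpM2l ?sqr_ge0// expr2 ler_piMl// ltW.
Qed.

Lemma ibp_iter g l i (t : R) (xi : 'rV[R]_n) : real_schwartz g ->
  (2 * pi * xi 0 i) ^+ l * \int[mu]_x (g x * cos (2 * pi * dot x xi + t)) =
  \int[mu]_x (iter l (partial 0 i) g x * cos (2 * pi * dot x xi + (t + (pi / 2) *+ l))).
Proof.
move=> gS; elim: l => [|l ih]; first by rewrite expr0 mul1r mulr0n addr0.
have [K hK] := schwartz_decay l i gS; have [K' hK'] := schwartz_decay l.+1 i gS.
have KK x : `|iter l (partial 0 i) g x| <= (`|K| + `|K'|) * decay x.
  apply: (le_trans (hK x)); rewrite ler_wpM2r ?(ltW (decay_gt0 x))//.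
  by apply: (le_trans (ler_norm K)); rewrite lerDl.
have KK' x : `|iter l.+1 (partial 0 i) g x| <= (`|K| + `|K'|) * decay x.
  apply: (le_trans (hK' x)); rewrite ler_wpM2r ?(ltW (decay_gt0 x))//.
  by apply: (le_trans (ler_norm K')); rewrite lerDr.
have Cl : Ck_real 1 (iter l (partial 0 i) g) by apply: Ck_real_iter; exact: gS.1.
have Cl' : continuous (iter l.+1 (partial 0 i) g).
  by apply: (@Ck_real_continuous _ _ _ 0); exact: Ck_real_partial.
rewrite exprS -mulrA ih (ibp _ _ _ _ _ _ KK KK').
- by apply: eq_Rintegral => x _; rewrite [pi / 2 *+ l.+1]mulrSr !addrA.
- exact: (@Ck_real_is_derive _ _ _ 0 0 i _ Cl).
- move=> x s; apply: (@continuous_comp _ _ _ (fun s : R => s *: delta_mx 0 i + x)); last exact: Cl'.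
  by apply: cvgD; [exact: scalel_continuous|exact: cvg_cst].
- by apply: continuous_mx_measurable; exact: (Ck_real_continuous Cl).
- exact: continuous_mx_measurable.
Qed.

(** Integrating by parts 2n times in direction i brings out (2 pi xi_i)^(2n), which dominates
    xi_i^(2n), and the pure powers are what [decay_bound] asks for. Uniformity in the phase [t]
    covers cosine and sine integrals at once. *)
Lemma fourier_real_decay g : real_schwartz g ->
  exists K : R, forall xi t,
    `|\int[mu]_x (g x * cos (2 * pi * dot x xi + t))| <= K * decay xi.
Proof.
move=> gS.
have /choice[K hK] : forall i : 'I_n, exists K : R, forall x,
    `|iter (2 * n) (partial 0 i) g x| <= K * decay x.
  by move=> i; exact: schwartz_decay.
have [K0 hK0] := real_schwartz_decay gS.
pose I0 := \int[mu]_x decay x.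
have id := rintegrable_decay R n.
have I0_ge0 : 0 <= I0 by apply: Rintegral_ge0 => x _; exact/ltW/decay_gt0.
have mc t xi : measurable_fun setT (fun x : 'rV[R]_n => cos (2 * pi * dot x xi + t)).
  by apply: measurable_cos_comp; apply: measurable_funD => //; exact: measurable_pidot.
have bnd (f : 'rV[R]_n -> R) (C t : R) xi : measurable_fun setT f ->
    (forall x, `|f x| <= C * decay x) ->
    `|\int[mu]_x (f x * cos (2 * pi * dot x xi + t))| <= C * I0.
  move=> mf fC; rewrite /I0 -RintegralZl//.
  have fc x : `|f x * cos (2 * pi * dot x xi + t)| <= C * decay x.
    by rewrite normrM; apply: le_trans (fC x); rewrite ler_piMr// cos_norm_le1.
  apply: le_Rintegral_norm => //; last exact: rintegrableZl.
  apply: (rintegrable_le _ (rintegrableZl C id) fc).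
  exact: measurable_funM.
have K00 : 0 <= K0.
  by rewrite -(pmulr_lge0 _ (decay_gt0 (0 : 'rV[R]_n))); exact: le_trans (hK0 0).
have Ki0 i : 0 <= K i.
  by rewrite -(pmulr_lge0 _ (decay_gt0 (0 : 'rV[R]_n))); exact: le_trans (hK i 0).
exists (2 ^+ n * (n.+1%:R * ((K0 + \sum_i K i) * I0))) => xi t.
apply: decay_bound => //.
  apply: (@le_trans _ _ (K0 * I0)).
    apply: bnd => //; exact: real_schwartz_measurable.
  by rewrite ler_wpM2r// lerDl sumr_ge0.
move=> i.
apply: (@le_trans _ _ (K i * I0)); last first.
  rewrite ler_wpM2r// (bigD1 i)//= addrCA lerDl addr_ge0 ?sumr_ge0//.
set J := \int[mu]_x _.
have -> : `|J| * xi 0 i ^+ (2 * n) = `|xi 0 i ^+ (2 * n) * J|.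
  by rewrite normrM mulrC [in RHS]ger0_norm// mulnC exprM sqr_ge0.
apply: (@le_trans _ _ `|(2 * pi * xi 0 i) ^+ (2 * n) * J|).
  rewrite !normrM ler_wpM2r// !normrX lerXn2r ?nnegrE//.
  rewrite normrM ler_peMl// ger0_norm ?mulr_ge0 ?pi_ge0//.
  by have := @pi_ge2 R; lra.
have Cn : Ck_real 0 (iter (2 * n) (partial 0 i) g) by apply: Ck_real_iter; exact: gS.1.
rewrite ibp_iter//; apply: bnd => //.
by apply: continuous_mx_measurable; exact: (Ck_real_continuous Cn).
Qed.

End real_schwartz.

Section schwartz_fourier.
Variables (R : realType) (n : nat) (f : 'rV[R]_n -> R[i]).
Hypothesis fS : schwartz f.
Local Notation mu := (@lebesgue_rV R n).

Lemma schwartz_cintegrable : cintegrable mu f.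
Proof. by split; apply: real_schwartz_integrable; [exact: schwartz_Re|exact: schwartz_Im]. Qed.

Lemma schwartz_cmod_sqr : rintegrable mu (fun x => cmod (f x) ^+ 2).
Proof.
under eq_fun do rewrite cmod_sqr.
by apply: rintegrableD; apply: real_schwartz_sqr; [exact: schwartz_Re|exact: schwartz_Im].
Qed.

Lemma fourierE xi : fourier f xi = fint true f xi.
Proof.
by rewrite /fourier /fint; congr cintegral; apply/funext => x; rewrite expr1 mulN1r.
Qed.

(** This makes the integral that defines the operator absolutely convergent for every bounded
    measurable symbol, and provides the majorant for the limit in the symbol. *)
Lemma fourier_cintegrable : cintegrable mu (fourier f).
Proof.
have uS := schwartz_Re fS; have vS := schwartz_Im fS.
have [K hK] := fourier_real_decay uS; have [K' hK'] := fourier_real_decay vS.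
have iu := real_schwartz_integrable uS; have iv := real_schwartz_integrable vS.
have md xi : measurable_fun setT (fun x : 'rV[R]_n => 2 * pi * dot x xi).
  exact: measurable_pidot.
have mdt xi t : measurable_fun setT (fun x : 'rV[R]_n => 2 * pi * dot x xi + t).
  by apply: measurable_funD.
have fE : fourier f = fint true f by apply/funext => xi; exact: fourierE.
have mf : cmeasurable (fourier f).
  by rewrite fE; exact/cmeasurable_fint/cintegrable_measurable/schwartz_cintegrable.
have ic (w : 'rV[R]_n -> R) xi t : rintegrable mu w ->
    rintegrable mu (fun x => w x * cos (2 * pi * dot x xi + t)).
  by move=> iw; exact: rintegrable_mulcos.
apply: (@cintegrable_le _ _ _ _ _ (fun xi => 2 * (`|K| + `|K'|) * decay xi)) => //.
  exact/rintegrableZl/rintegrable_decay.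
move=> xi; apply: (le_trans (cmod_le _)).
have dK : K * decay xi <= `|K| * decay xi by rewrite ler_wpM2r ?ler_norm ?(ltW (decay_gt0 _)).
have dK' : K' * decay xi <= `|K'| * decay xi by rewrite ler_wpM2r ?ler_norm ?(ltW (decay_gt0 _)).
have -> : complex.Re (fourier f xi) =
    \int[mu]_x (complex.Re (f x) * cos (2 * pi * dot x xi + 0)) +
    \int[mu]_x (complex.Im (f x) * cos (2 * pi * dot x xi + - (pi / 2))).
  rewrite -RintegralD//; [|exact: ic|exact: ic]; apply: eq_Rintegral => x _.
  by rewrite cReM /= mulrN cosN sinN addr0 -sin_cosBpihalf mulrN opprK.
have -> : complex.Im (fourier f xi) =
    \int[mu]_x (complex.Im (f x) * cos (2 * pi * dot x xi + 0)) -
    \int[mu]_x (complex.Re (f x) * cos (2 * pi * dot x xi + - (pi / 2))).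
  rewrite -RintegralB//; [|exact: ic|exact: ic]; apply: eq_Rintegral => x _.
  by rewrite cImM /= mulrN cosN sinN addr0 -sin_cosBpihalf mulrN addrC.
apply: (le_trans (lerD (ler_normD _ _) (ler_normB _ _))).
have := hK xi 0; have := hK' xi 0; have := hK xi (- (pi / 2)); have := hK' xi (- (pi / 2)).
lra.
Qed.

End schwartz_fourier.

(** * Piecewise polynomial projections *)

Section polynomials.
Variable R : realType.
Local Notation leb := (@lebesgue_measure R).
Implicit Types p : {poly R}.

Definition coef_norm p : R := \sum_(i < size p) `|p`_i|.

Lemma coef_norm_ge0 p : 0 <= coef_norm p.
Proof. exact: sumr_ge0. Qed.

Lemma horner_coef_norm p x : 0 <= x <= 1 -> `|p.[x]| <= coef_norm p.
Proof.
move=> /andP[x0 x1]; rewrite horner_coef; apply: le_trans (ler_norm_sum _ _ _) _.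
apply: ler_sum => i _; rewrite normrM ler_piMr// normrX ger0_norm//.
exact: exprn_ile1.
Qed.

(** The primitive that vanishes at 0: the coefficient at i = 0 is a division by zero, whose value is
    0. *)
Definition primitive p : {poly R} := \poly_(i < (size p).+1) (p`_i.-1 / i%:R).

Lemma size_primitive p : (size (primitive p) <= (size p).+1)%N.
Proof. exact: size_poly. Qed.

Lemma primitive0 p : (primitive p).[0] = 0.
Proof. by rewrite horner_coef0 coef_poly/= invr0 mulr0. Qed.

Lemma deriv_primitive p : (primitive p)^`() = p.
Proof.
apply/polyP => i; rewrite coef_deriv coef_poly ltnS.
have [ip|pi] := ltnP i (size p).
  by rewrite -[LHS]mulr_natr divfK // pnatr_eq0.
by rewrite mul0rn nth_default.
Qed.

(** Induction on the order: integrate the approximant of the derivative and bound the error by the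
    mean value theorem. The factor 1/M! is lost, which is harmless. [F l] stands for the l-th
    derivative. *)
Lemma taylor_poly (M : nat) (F : nat -> R -> R) (D a : R) :
  (forall l x, (l < M)%N -> is_derive x (1 : R) (F l) (F l.+1 x)) ->
  (forall x, `|F M x| <= D) ->
  exists2 p : {poly R}, (size p <= M)%N &
    forall x, a <= x -> `|F 0%N x - p.[x - a]| <= D * (x - a) ^+ M.
Proof.
elim: M F => [|M IH] F dF FD.
  by exists 0 => [|x _]; rewrite ?size_poly0// horner0 subr0 expr0 mulr1.
have [||p sp pD] := IH (fun l => F l.+1).
- by move=> l x lM; apply: dF.
- exact: FD.
exists (primitive p + (F 0%N a)%:P).
  rewrite (leq_trans (size_polyD _ _))// geq_max.
  rewrite (leq_trans (size_primitive p)) ?ltnS//=.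
  by rewrite (leq_trans (size_polyC_leq1 _)).
move=> x ax.
pose psi y := F 0%N y - (primitive p).[y - a].
have dpsi (y : R) : is_derive y (1 : R) psi (F 1%N y - p.[y - a]).
  apply: is_deriveB; first exact: dF.
  have dB : is_derive y (1 : R) (fun y : R => y - a) 1.
    by apply: is_derive_eq; rewrite subr0.
  have := @is_derive1_comp R (horner (primitive p)) (fun y => y - a) y
    (primitive p)^`().[y - a] 1 (is_derive_poly _ _) dB.
  by rewrite deriv_primitive mulr1.
have cpsi : continuous psi by apply: is_derive_continuous => y; exact: dpsi.
have [c cab cE] := MVT_segment ax (fun y _ => dpsi y) (continuous_subspaceT cpsi).
move: cab; rewrite in_itv/= => /andP[ac cx].
rewrite hornerD hornerC opprD addrA -/(psi x).
have -> : psi x - F 0%N a = (F 1%N c - p.[c - a]) * (x - a).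
  by rewrite -cE /psi subrr primitive0 subr0.
rewrite normrM [`|x - a|]ger0_norm ?subr_ge0// exprSr mulrA ler_wpM2r ?subr_ge0//.
apply: (le_trans (pD c ac)); apply: ler_wpM2l.
  exact: le_trans (normr_ge0 _) (FD 0).
by rewrite lerXn2r// ?nnegrE ?subr_ge0// lerD2r.
Qed.

Lemma size_comp_affine p (r : {poly R}) : (size r <= 2)%N ->
  (size (p \Po r) <= size p)%N.
Proof.
move=> sr; have [->|] := eqVneq p 0.
  by rewrite comp_poly0.
rewrite -size_poly_gt0 => p0.
rewrite (leq_trans (size_comp_poly_leq _ _))// -[X in (_ <= X)%N](prednK p0) ltnS.
rewrite -[X in (_ <= X)%N]muln1 leq_mul2l; apply/orP; right.
by case: (size r) sr => [|[|[]]].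
Qed.

End polynomials.

Section half_open.
Variable R : realType.
Local Notation leb := (@lebesgue_measure R).

Lemma rintegrable_itvo (f : R -> R) (a b : R) : continuous f ->
  rintegrable leb (f \_ `[a, b[).
Proof.
move=> cf.
have cn : continuous (fun x => `|f x|).
  by move=> x; apply: continuous_comp; [exact: cf|exact: norm_continuous].
apply: (rintegrable_le _ (rintegrable_itv a b cn)).
  apply/measurable_restrict => //; apply: measurable_funTS.
  exact: continuous_measurable_fun.
move=> x; rewrite !patchE; case: ifPn => [xab|_].
  rewrite ifT//; move: xab; rewrite !inE/= !in_itv/= => /andP[-> /ltW].
  by [].
by rewrite normr0; case: ifP.
Qed.

Lemma Rintegral_FTC_itvo (F f : R -> R) (a b : R) : a <= b ->
  (forall x : R, is_derive x 1 F (f x)) -> continuous f ->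
  \int[leb]_x (f \_ `[a, b[) x = F b - F a.
Proof.
rewrite le_eqVlt => /predU1P[<- _ _|ab dF cf].
  rewrite subrr set_itv_ge ?bnd_simp ?ltxx//.
  by rewrite (_ : _ \_ _ = cst 0) ?Rintegral_cst ?mul0r// patch_set0.
rewrite -Rintegral_mkcond Rintegral_itv_bndo_bndc ?(Rintegral_FTC ab dF cf)//.
have := rintegrable_itvo a b cf.
by rewrite /rintegrable -restrict_EFin => /integrable_restrict; rewrite setTI; apply.
Qed.

End half_open.

Section projection.
Variables (R : realType) (M L : nat).
Hypothesis M0 : (0 < M)%N.
Local Notation leb := (@lebesgue_measure R).

Definition node (j : nat) : R := j%:R / M%:R.

Let M0R : 0 < M%:R :> R. Proof. by rewrite ltr0n. Qed.

Lemma node_inj : injective node.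
Proof.
move=> i j /(congr1 (fun t => t * M%:R)); rewrite !divfK ?gt_eqF//.
by move/eqP; rewrite eqr_nat => /eqP.
Qed.

Lemma node_ge0 j : 0 <= node j.
Proof. by rewrite divr_ge0. Qed.

Lemma node_le1 (j : 'I_M.+1) : node j <= 1.
Proof. by rewrite ler_pdivrMr// mul1r ler_nat -ltnS. Qed.

Definition node_poly (j : 'I_M.+1) : {poly R} := tnth (lagrange M.+1 node) j.

(** A bound on [0, 1] for the sum of the absolute values of the derivatives of the Lagrange
    polynomials. It depends on [M] alone, so the constants derived from it are the same at all
    scales and in all boxes. *)
Definition node_poly_norm : R := \sum_j coef_norm (node_poly j)^`().

Lemma node_poly_norm_ge0 : 0 <= node_poly_norm.
Proof. by apply: sumr_ge0 => j _; exact: coef_norm_ge0. Qed.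

Lemma size_deriv_node_poly j : (size (node_poly j)^`() <= M)%N.
Proof.
have := lt_size_deriv (p := node_poly j); rewrite /node_poly.
rewrite size_lagrange_ //; last exact: node_inj.
by rewrite ltnS; apply; rewrite -size_poly_eq0 size_lagrange_ //; exact: node_inj.
Qed.

Section level.
Variable N : nat.
Hypothesis N0 : (0 < N)%N.

Let N0R : 0 < N%:R :> R. Proof. by rewrite ltr0n. Qed.

(** The affine coordinate in which the c-th cell of side 1/N of the box [-L, L) becomes [0, 1). *)
Definition cellpos (c : nat) (x : R) : R := N%:R * (x + L%:R) - c%:R.

Local Notation J := ('I_(2 * L * N) * 'I_M.+1)%type.

(** An index is a pair of a cell and a node. The derivative of the Lagrange polynomial appears
    because the coefficients are nodal values of a primitive: differentiating the interpolant of the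
    primitive recovers the function. *)
Definition cell_poly (k : J) (x : R) : R :=
  if 0 <= cellpos k.1 x < 1 then (node_poly k.2)^`().[cellpos k.1 x] else 0.

(** N times the integral against this indicator is the value at the node, in the rescaled
    coordinate, of the primitive that vanishes at the left end of the cell. The dual functions are
    thus nonnegative, as Jensen's inequality requires. *)
Definition cell_dual (k : J) (y : R) : R :=
  if 0 <= cellpos k.1 y < node k.2 then 1 else 0.

Definition cell_kernel (x y : R) : R := N%:R * \sum_k cell_poly k x * cell_dual k y.

Lemma cell_patch (c : nat) (v : R) (f : R -> R) :
  (fun x => if 0 <= cellpos c x < v then f x else 0) =
  f \_ `[c%:R / N%:R - L%:R, c%:R / N%:R - L%:R + v / N%:R[.
Proof.
apply/funext => x; rewrite patchE; congr (if _ then _ else _).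
rewrite mem_setE in_itv/= /cellpos subr_ge0 lerBlDr ler_pdivrMr// mulrC; congr andb.
by rewrite addrAC -mulrDl ltrBrDr ltr_pdivlMr// ltrBlDl mulrC.
Qed.

Lemma cellpos_unique (c c' : nat) (x : R) :
  0 <= cellpos c x < 1 -> 0 <= cellpos c' x < 1 -> c = c'.
Proof.
rewrite /cellpos !subr_ge0 !ltrBlDl; set z := N%:R * _.
move=> /andP[a b] /andP[a' b']; apply/eqP.
have le_nat (i j : nat) : i%:R < j%:R + 1 :> R -> (i <= j)%N.
  by rewrite natr1 ltr_nat ltnS.
by rewrite eqn_leq (le_nat _ _ (le_lt_trans a b')) (le_nat _ _ (le_lt_trans a' b)).
Qed.

Lemma cellpos_is_derive (c : nat) (x : R) : is_derive x (1 : R) (cellpos c) N%:R.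
Proof.
rewrite /cellpos; apply: is_derive_eq.
by rewrite addr0 subr0 /GRing.scale/= mulr1.
Qed.

Lemma horner_cellpos_is_derive (p : {poly R}) (c : nat) (x : R) :
  is_derive x (1 : R) (fun x => p.[cellpos c x]) (N%:R * p^`().[cellpos c x]).
Proof.
rewrite mulrC; apply: (@is_derive1_comp R (horner p) (cellpos c)).
exact: cellpos_is_derive.
Qed.

Lemma horner_cellpos_continuous (p : {poly R}) (c : nat) :
  continuous (fun x => p.[cellpos c x]).
Proof.
by apply: is_derive_continuous => x; exact: horner_cellpos_is_derive.
Qed.

Lemma cell_poly_integrable k : rintegrable leb (cell_poly k).
Proof.
rewrite /rintegrable (_ : cell_poly k = (fun x => (node_poly k.2)^`().[cellpos k.1 x]) \_
  `[k.1%:R / N%:R - L%:R, k.1%:R / N%:R - L%:R + 1 / N%:R[); last by rewrite -cell_patch.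
exact/rintegrable_itvo/horner_cellpos_continuous.
Qed.

Lemma cell_indicator_integrable c (v : R) :
  rintegrable leb (fun x => if 0 <= cellpos c x < v then 1 else 0).
Proof. by rewrite cell_patch; apply: rintegrable_itvo => x; exact: cst_continuous. Qed.

Lemma cell_indicator_integral c (v : R) : 0 <= v ->
  \int[leb]_x (if 0 <= cellpos c x < v then 1 else 0) = v / N%:R.
Proof.
move=> v0; rewrite cell_patch (@Rintegral_FTC_itvo _ id)//.
- by rewrite addrC addKr.
- by rewrite lerDl divr_ge0.
- by move=> x; exact: cst_continuous.
Qed.

Lemma cell_dual_ge0 k y : 0 <= cell_dual k y.
Proof. by rewrite /cell_dual; case: ifP. Qed.

Lemma cell_dual_integrable k : rintegrable leb (cell_dual k).
Proof. exact: cell_indicator_integrable. Qed.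

Lemma cell_dual_integral k : \int[leb]_y cell_dual k y <= N%:R^-1.
Proof.
rewrite cell_indicator_integral ?node_ge0// ler_piMl ?invr_ge0//.
exact: node_le1.
Qed.

Lemma sum_cell_le (a : nat -> R) (x B : R) : 0 <= B -> (forall c, a c <= B) ->
  \sum_(c < 2 * L * N) (if 0 <= cellpos c x < 1 then a c else 0) <= B.
Proof.
move=> B0 aB; rewrite -big_mkcond/=.
case: (pickP (fun c : 'I_(2 * L * N) => 0 <= cellpos c x < 1)) => [c0 h0|h].
  rewrite (big_pred1 c0)// => c; apply/idP/eqP => [h|->//].
  exact/val_inj/(cellpos_unique h h0).
by rewrite big_pred0.
Qed.

Lemma cell_poly_sum x : \sum_k `|cell_poly k x| <= node_poly_norm.
Proof.
rewrite -(pair_bigA _ (fun c j => `|cell_poly (c, j) x|))/=.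
have -> : \sum_i \sum_j `|cell_poly (i, j) x| = \sum_(c < 2 * L * N)
    (if 0 <= cellpos c x < 1 then
      (if 0 <= cellpos c x < 1 then \sum_j `|(node_poly j)^`().[cellpos c x]| else 0) else 0).
  apply: eq_bigr => c _; rewrite /cell_poly/=; case: ifP => h; first by rewrite h.
  by rewrite big1// => j _; rewrite normr0.
apply: (sum_cell_le (a := fun c => if 0 <= cellpos c x < 1 then
  \sum_j `|(node_poly j)^`().[cellpos c x]| else 0)); first exact: node_poly_norm_ge0.
move=> c; case: ifP => [/andP[u0 u1]|_]; last exact: node_poly_norm_ge0.
by apply: ler_sum => j _; apply: horner_coef_norm; rewrite u0 ltW.
Qed.

Lemma cell_poly_norm_le k x :
  `|cell_poly k x| <= node_poly_norm * (if 0 <= cellpos k.1 x < 1 then 1 else 0).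
Proof.
case: ifP => h; last by rewrite /cell_poly h normr0 mulr0.
rewrite mulr1; apply: le_trans (cell_poly_sum x).
by rewrite (bigD1 k)//= lerDl sumr_ge0.
Qed.

Lemma cell_poly_norm_integral k : \int[leb]_x `|cell_poly k x| <= node_poly_norm / N%:R.
Proof.
have hI := cell_indicator_integrable k.1 1.
have <- : \int[leb]_x (node_poly_norm * (if 0 <= cellpos k.1 x < 1 then 1 else 0)) =
    node_poly_norm / N%:R.
  by rewrite (RintegralZl _ measurableT hI) cell_indicator_integral// div1r.
apply: (le_Rintegral measurableT).
- exact/rintegrable_norm/cell_poly_integrable.
- exact: rintegrableZl.
- by move=> x _; exact: cell_poly_norm_le.
Qed.

Lemma cell_dual_sum y : \sum_k cell_dual k y <= M.+1%:R.
Proof.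
rewrite -(pair_bigA _ (fun c j => cell_dual (c, j) y))/=.
apply: (@le_trans _ _ (\sum_(c < 2 * L * N)
    (if 0 <= cellpos c y < 1 then M.+1%:R else 0))); last first.
  by apply: (sum_cell_le (a := fun=> M.+1%:R)) => //; rewrite ler0n.
apply: ler_sum => c _; case: ifPn => h.
  rewrite -[leRHS](_ : \sum_(j < M.+1) 1 = _); last by rewrite sumr_const card_ord.
  by apply: ler_sum => j _; rewrite /cell_dual; case: ifP.
rewrite big1// => j _; rewrite /cell_dual; case: ifP => // /andP[u0 u1].
by case/negP: h; rewrite u0 (lt_le_trans u1)//; exact: node_le1.
Qed.

Lemma measurable_cell_poly k : measurable_fun setT (cell_poly k).
Proof. exact: rintegrable_measurable (cell_poly_integrable k). Qed.

Lemma rintegrable_mul_cell_dual (f : R -> R) (B : R) k : measurable_fun setT f ->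
  (forall y, `|f y| <= B) -> rintegrable leb (fun y => f y * cell_dual k y).
Proof.
move=> mf fB; rewrite (_ : (fun _ => _) = fun y => cell_dual k y * f y).
  exact: (rintegrable_bounded (cell_dual_integrable k) mf fB).
by apply/funext => y; rewrite mulrC.
Qed.

Lemma cell_kernel_integrable x : rintegrable leb (cell_kernel x).
Proof.
apply: rintegrableZl; apply: rintegrable_sum => k; apply: rintegrableZl.
exact: cell_dual_integrable.
Qed.

Lemma cell_kernel_norm_integral x : \int[leb]_y `|cell_kernel x y| <= node_poly_norm.
Proof.
have hk k : rintegrable leb (fun y => `|cell_poly k x| * cell_dual k y).
  exact/rintegrableZl/cell_dual_integrable.
apply: (@le_trans _ _ (\int[leb]_y (N%:R * \sum_k `|cell_poly k x| * cell_dual k y))).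
  apply: (le_Rintegral measurableT).
  - exact/rintegrable_norm/cell_kernel_integrable.
  - exact/rintegrableZl/rintegrable_sum.
  - move=> y _; rewrite /cell_kernel normrM ger0_norm// ler_wpM2l//.
    apply: le_trans (ler_norm_sum _ _ _) _; apply: ler_sum => k _.
    by rewrite normrM [`|cell_dual k y|]ger0_norm ?cell_dual_ge0.
have hs := rintegrable_sum (index_enum J) hk.
rewrite (RintegralZl _ measurableT hs) (Rintegral_sum (index_enum J) hk).
apply: le_trans (cell_poly_sum x); rewrite mulr_sumr; apply: ler_sum => k _.
rewrite (RintegralZl _ measurableT (cell_dual_integrable k)) mulrCA ler_piMr//.
by rewrite -ler_pdivlMl// mulr1 cell_dual_integral.
Qed.

Lemma Rintegral_cell_kernel (f : R -> R) (B x : R) : measurable_fun setT f ->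
  (forall y, `|f y| <= B) ->
  \int[leb]_y (f y * cell_kernel x y) =
  \sum_k cell_poly k x * (N%:R * \int[leb]_y (f y * cell_dual k y)).
Proof.
move=> mf fB; have hk k := rintegrable_mul_cell_dual k mf fB.
transitivity (\int[leb]_y (\sum_k (cell_poly k x * N%:R) * (f y * cell_dual k y))).
  congr Rintegral; apply/funext => y; rewrite /cell_kernel mulrCA mulr_sumr mulr_sumr.
  by apply: eq_bigr => k _; ring.
rewrite (Rintegral_sum (index_enum J) (fun k => rintegrableZl (cell_poly k x * N%:R) (hk k))).
by apply: eq_bigr => k _; rewrite (RintegralZl _ measurableT (hk k)) mulrA.
Qed.

Lemma cell_dual_horner_integral (q : {poly R}) (k : J) :
  rintegrable leb (fun y => q.[cellpos k.1 y] * cell_dual k y) /\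
  N%:R * \int[leb]_y (q.[cellpos k.1 y] * cell_dual k y) = (primitive q).[node k.2].
Proof.
have -> : (fun y => q.[cellpos k.1 y] * cell_dual k y) =
    (fun y => q.[cellpos k.1 y]) \_ `[k.1%:R / N%:R - L%:R,
      k.1%:R / N%:R - L%:R + node k.2 / N%:R[.
  rewrite -cell_patch; apply/funext => y; rewrite /cell_dual.
  by case: ifP => _; rewrite (mulr1, mulr0).
have cq := @horner_cellpos_continuous q k.1.
split; first exact: rintegrable_itvo.
have dq (y : R) : is_derive y (1 : R)
    (fun y => N%:R^-1 * (primitive q).[cellpos k.1 y]) q.[cellpos k.1 y].
  have := horner_cellpos_is_derive (primitive q) k.1 y; rewrite deriv_primitive => d.
  have := @is_deriveZ R R R (fun y => (primitive q).[cellpos k.1 y]) N%:R^-1 y 1 _ d.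
  by rewrite /GRing.scale/= mulKf ?gt_eqF.
have ab : k.1%:R / N%:R - L%:R <= k.1%:R / N%:R - L%:R + node k.2 / N%:R.
  by rewrite lerDl divr_ge0 ?node_ge0.
rewrite (Rintegral_FTC_itvo ab dq cq) -mulrBr mulVKf ?gt_eqF//.
have -> : cellpos k.1 (k.1%:R / N%:R - L%:R) = 0.
  by rewrite /cellpos subrK mulrC divfK ?gt_eqF// subrr.
rewrite primitive0 subr0; congr horner.
by rewrite /cellpos; field; rewrite gt_eqF.
Qed.

(* On the cell containing [x] the kernel integrates [f] against the derivative of
   the interpolation polynomial of a primitive of [f], which is exact when [f] is
   a polynomial of degree less than [M]. *)
Lemma cell_kernel_local (f : R -> R) (B e x : R) (c : 'I_(2 * L * N)) (q : {poly R}) :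
  measurable_fun setT f -> (forall y, `|f y| <= B) ->
  (size q <= M)%N -> 0 <= cellpos c x < 1 ->
  (forall y, 0 <= cellpos c y < 1 -> `|f y - q.[cellpos c y]| <= e) ->
  `|\int[leb]_y (f y * cell_kernel x y) - f x| <= (node_poly_norm + 1) * e.
Proof.
move=> mf fB sq xc fq.
have e0 : 0 <= e := le_trans (normr_ge0 _) (fq x xc).
pose Q k : R := (primitive q).[node k].
have sQ : (size (primitive q) <= M.+1)%N := leq_trans (size_primitive q) (sq : (size q < M.+1)%N).
have pw0 (k : J) : k.1 != c -> cell_poly k x = 0.
  rewrite /cell_poly => kc; case: ifP => // kx; case/eqP: kc.
  exact/val_inj/(cellpos_unique kx xc).
have qE : q.[cellpos c x] = \sum_k cell_poly k x * Q k.2.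
  rewrite -(pair_bigA _ (fun c j => cell_poly (c, j) x * Q j))/= (bigD1 c)//=.
  rewrite [X in _ + X]big1 ?addr0 => [|i ic]; last first.
    by rewrite big1// => j _; rewrite pw0 ?mul0r.
  rewrite -[q in LHS]deriv_primitive (lagrange_gen _ node_inj sQ)//.
  rewrite raddf_sum horner_sum; apply: eq_bigr => j _.
  by rewrite mul_polyC /= derivZ hornerZ /cell_poly/= xc mulrC.
rewrite (Rintegral_cell_kernel x mf fB).
have -> : \sum_k cell_poly k x * (N%:R * \int[leb]_y (f y * cell_dual k y)) - f x =
    \sum_k cell_poly k x * (N%:R * \int[leb]_y (f y * cell_dual k y) - Q k.2) -
    (f x - q.[cellpos c x]).
  rewrite qE opprB addrA -big_split/=; congr (_ - _); apply: eq_bigr => k _.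
  by rewrite -mulrDr subrK.
apply: (le_trans (ler_normB _ _)); rewrite mulrDl mul1r; apply: lerD; last exact: fq.
apply: le_trans (ler_norm_sum _ _ _) _.
apply: (@le_trans _ _ (\sum_k `|cell_poly k x| * e)); last first.
  by rewrite -mulr_suml ler_wpM2r// cell_poly_sum.
apply: ler_sum => k _; rewrite normrM.
have [kc|/pw0 ->] := eqVneq k.1 c; last by rewrite normr0 !mul0r.
rewrite ler_wpM2l//.
rewrite /Q; have [iq <-] := cell_dual_horner_integral q k.
have hf := rintegrable_mul_cell_dual k mf fB.
rewrite -mulrBr -(RintegralB measurableT hf iq) normrM ger0_norm//.
rewrite -ler_pdivlMl//.
apply: (@le_trans _ _ (\int[leb]_y (e * cell_dual k y))); last first.
  rewrite (RintegralZl _ measurableT (cell_dual_integrable k)) mulrC.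
  by rewrite ler_wpM2r// cell_dual_integral.
apply: le_Rintegral_norm; [exact: rintegrableB|exact/rintegrableZl/cell_dual_integrable|].
move=> y; rewrite /= -mulrBl normrM [`|cell_dual k y|]ger0_norm ?cell_dual_ge0//.
rewrite /cell_dual; case: ifP => [/andP[u0 u1]|_]; last by rewrite !mulr0.
rewrite !mulr1 kc; apply: fq; rewrite -kc u0 (lt_le_trans u1)//; exact: node_le1.
Qed.

Lemma cell_kernel_outside x : (forall c : 'I_(2 * L * N), ~~ (0 <= cellpos c x < 1)) ->
  cell_kernel x = fun=> 0.
Proof.
move=> h; apply/funext => y; rewrite /cell_kernel big1 ?mulr0// => k _.
by rewrite /cell_poly (negbTE (h k.1)) mul0r.
Qed.

Lemma cell_exists x : - L%:R <= x < L%:R -> exists c : 'I_(2 * L * N), 0 <= cellpos c x < 1.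
Proof.
move=> /andP[x0 x1]; set z := N%:R * (x + L%:R).
have z0 : 0 <= z by rewrite mulr_ge0// -lerBlDr sub0r.
have /andP[t0 t1] := truncn_itv z0.
have lt : (Num.truncn z < 2 * L * N)%N.
  rewrite -(ltr_nat R) (le_lt_trans t0)// /z mulnC natrM ltr_pM2l//.
  by rewrite mul2n -addnn natrD ltrD2r.
exists (Ordinal lt); rewrite /cellpos -/z/= subr_ge0 t0 ltrBlDl natr1//.
Qed.

Lemma cell_box (c : 'I_(2 * L * N)) x : 0 <= cellpos c x < 1 -> - L%:R <= x < L%:R.
Proof.
rewrite /cellpos subr_ge0 ltrBlDl => /andP[z0 z1].
have kLN : (c%:R + 1 : R) <= N%:R * (L%:R + L%:R).
  rewrite natr1 -natrD -natrM ler_nat addnn -mul2n [leqRHS]mulnC; exact: ltn_ord.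
apply/andP; split.
  by rewrite -subr_ge0 opprK -(pmulr_rge0 _ N0R) (le_trans _ z0).
by rewrite -(ltrD2r L%:R) -(ltr_pM2l N0R) (lt_le_trans z1).
Qed.

(** The Taylor polynomial is taken at the left end of the cell containing [x]; on that cell the
    distance to this point is at most 1/N, and rescaling to [0, 1) does not raise the degree. *)
Lemma cell_kernel_taylor (F : nat -> R -> R) (B D x : R) :
  (forall l x, (l < M)%N -> is_derive x (1 : R) (F l) (F l.+1 x)) ->
  (forall x, `|F M x| <= D) ->
  measurable_fun setT (F 0%N) -> (forall y, `|F 0%N y| <= B) ->
  - L%:R <= x < L%:R ->
  `|\int[leb]_y (F 0%N y * cell_kernel x y) - F 0%N x| <=
    (node_poly_norm + 1) * (D * N%:R^-1 ^+ M).
Proof.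
move=> dF FD mf fB /cell_exists[c xc].
pose a : R := c%:R / N%:R - L%:R.
have [p sp pD] := taylor_poly a dF FD.
pose q := p \Po (N%:R^-1 *: 'X).
have sq : (size q <= M)%N.
  apply: leq_trans sp; apply: size_comp_affine.
  by rewrite (leq_trans (size_scale_leq _ _)) ?size_polyX.
have D0 : 0 <= D := le_trans (normr_ge0 _) (FD 0).
apply: (cell_kernel_local mf fB sq xc) => y /andP[y0 y1].
have yE : y - a = cellpos c y / N%:R.
  by rewrite /a /cellpos; field; rewrite gt_eqF.
have -> : q.[cellpos c y] = p.[y - a].
  by rewrite horner_comp !hornerE yE mulrC.
have ya : 0 <= y - a by rewrite yE divr_ge0.
rewrite subr_ge0 in ya; apply: (le_trans (pD y ya)); rewrite ler_wpM2l//.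
rewrite lerXn2r// ?nnegrE ?subr_ge0 ?invr_ge0// yE ler_piMl ?invr_ge0//.
exact: ltW.
Qed.

End level.

(** A piece of the coarse level is a polynomial of degree less than M on every cell of half the
    side, so the local estimate holds with error 0. This is the nestedness of the projections. *)
Lemma cell_kernel_reproduces N (k : 'I_(2 * L * N) * 'I_M.+1) x : (0 < N)%N ->
  \int[leb]_y (cell_poly k y * cell_kernel (2 * N) x y) = cell_poly k x.
Proof.
move=> N0; have N20 : (0 < 2 * N)%N by rewrite muln_gt0.
case: (pickP (fun c : 'I_(2 * L * (2 * N)) => 0 <= cellpos (2 * N) c x < 1)) => [c xc|h].
  (* The coarse piece in the coordinate of the fine cell [c]: this cell lies in [k.1] when [c] is
     [2 * k.1] or its successor, and then the coarse coordinate is half the fine one plus c/2 -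
     k.1. *)
  pose q := if (2 * k.1 <= c < 2 * k.1 + 2)%N then
    (node_poly k.2)^`() \Po (2^-1 *: 'X + (c%:R / 2 - k.1%:R)%:P) else 0.
  have sq : (size q <= M)%N.
    rewrite /q; case: ifP => _; last by rewrite size_poly0.
    apply: leq_trans (size_deriv_node_poly k.2); apply: size_comp_affine.
    rewrite (leq_trans (size_polyD _ _))// geq_max.
    rewrite (leq_trans (size_scale_leq _ _)) ?size_polyX//=.
    by rewrite (leq_trans (size_polyC_leq1 _)).
  have qE y : 0 <= cellpos (2 * N) c y < 1 -> cell_poly k y = q.[cellpos (2 * N) c y].
    rewrite /cellpos subr_ge0 ltrBlDl => /andP[].
    set z := _ * (y + _) => z0 z1.
    have zE : N%:R * (y + L%:R) = z / 2 by rewrite /z natrM; field.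
    have cE : (0 <= cellpos N k.1 y < 1) = (2 * k.1 <= c < 2 * k.1 + 2)%N.
      rewrite /cellpos zE subr_ge0 ltrBlDl ler_pdivlMr// ltr_pdivrMr// mulrDl.
      rewrite mulrC -natrM [_ + _](_ : _ = (2 * k.1 + 2)%:R); last by rewrite natrD; ring.
      congr andb.
        apply/idP/idP => [h|]; last by rewrite -(ler_nat R) => /le_trans; apply.
        by rewrite -ltnS -(ltr_nat R) -[ltRHS]natr1 (le_lt_trans h).
      apply/idP/idP => [h|h]; first by rewrite -(ltr_nat R) (le_lt_trans z0).
      by apply: (lt_le_trans z1); rewrite natr1 ler_nat.
    rewrite /cell_poly cE /q; case: ifP => _; last by rewrite horner0.
    rewrite horner_comp hornerD hornerZ hornerX hornerC; congr horner.
    by rewrite /cellpos zE; field.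
  have := cell_kernel_local N20 (measurable_cell_poly N0 k) _ sq xc.
  move=> /(_ node_poly_norm 0); rewrite mulr0 normr_le0 subr_eq0 => h; apply/eqP/h.
  - move=> y; apply: (@le_trans _ _ (node_poly_norm * _)); first exact: cell_poly_norm_le.
    rewrite ler_piMr ?node_poly_norm_ge0//.
    by case: (0 <= _ < 1).
  - by move=> y /qE ->; rewrite subrr normr0.
(* Outside the box both sides vanish. *)
rewrite cell_kernel_outside => [|c]; last by rewrite h.
rewrite (_ : (fun _ => _) = cst 0); last by apply/funext => y; rewrite mulr0.
rewrite Rintegral_cst// mul0r /cell_poly; case: ifP => // /(cell_box N0)/(cell_exists N20)[c].
by rewrite h.
Qed.

End projection.

(** * Jensen's inequality for weights of bounded total mass *)

Section jensen.
Variable R : realType.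
Implicit Types q s b : R.

(** Young's inequality for [s] and b^(q-1), linear in the q-th powers. Averaged over s with b the
    normalised mean, it yields Jensen's inequality by arithmetic. *)
Lemma young_powR q s b : 1 < q -> 0 <= s -> 0 <= b ->
  s * b `^ (q - 1) <= q^-1 * s `^ q + (1 - q^-1) * b `^ q.
Proof.
move=> q1 s0 b0; have q0 : 0 < q := lt_trans ltr01 q1.
have q10 : 0 < q - 1 by rewrite subr_gt0.
have e : 0 < q / (q - 1) by rewrite divr_gt0.
have h := @conjugate_powR R s (b `^ (q - 1)) q (q / (q - 1)) s0 (powR_ge0 _ _) q0 e.
apply: le_trans (h _) _; first by field; rewrite !gt_eqF.
rewrite -powRrM mulrC; have -> : (q - 1) * (q / (q - 1)) = q by field; rewrite gt_eqF.
apply: lerD => //; rewrite mulrC le_eqVlt; apply/orP; left; apply/eqP.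
by congr (_ * _); field; rewrite !gt_eqF.
Qed.

(** The weights [v] have total mass at most [A] rather than exactly [A]; [young_powR] is summed
    against them with b = S/A, and the missing mass only helps. *)
Lemma jensen_sum q (A : R) (I : finType) (u v : I -> R) : 1 < q -> 0 < A ->
  (forall i, 0 <= u i) -> (forall i, 0 <= v i) -> \sum_i v i <= A ->
  (\sum_i u i * v i) `^ q <= A `^ (q - 1) * \sum_i u i `^ q * v i.
Proof.
move=> q1 A0 u0 v0 vA; have q0 : 0 < q := lt_trans ltr01 q1.
set S := \sum_i u i * v i.
have S0 : 0 <= S by apply: sumr_ge0 => i _; rewrite mulr_ge0.
pose b := S / A; have b0 : 0 <= b by rewrite divr_ge0 // ltW.
have SE : S = A * b by rewrite /b mulrC divfK // gt_eqF.
have key : S * b `^ (q - 1) <= q^-1 * (\sum_i u i `^ q * v i) + (1 - q^-1) * b `^ q * A.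
  apply: (@le_trans _ _ (\sum_i (q^-1 * (u i `^ q * v i) + (1 - q^-1) * b `^ q * v i))).
    rewrite /S mulr_suml; apply: ler_sum => i _.
    rewrite mulrAC mulrA -mulrDl; apply: ler_wpM2r => //; exact: young_powR.
  rewrite big_split/= -!mulr_sumr lerD2l ler_wpM2l// mulr_ge0 ?powR_ge0//.
  by rewrite subr_ge0 invf_le1 // ltW.
have bE : b `^ (q - 1) * b = b `^ q.
  by rewrite mulrC mulr_powRB1// ltW.
move: key; rewrite {1}SE -mulrA mulrC [b * _]mulrC bE mulrC => key.
have {}key : A * b `^ q <= \sum_i u i `^ q * v i.
  move: key; rewrite mulrBl mul1r mulrBl addrCA -lerBlDl.
  rewrite mulrC [b `^ q * A]mulrC subrr -mulrA [b `^ q * A]mulrC -mulrBr.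
  by rewrite pmulr_rge0 ?invr_gt0// subr_ge0.
rewrite SE powRM ?(ltW A0)//; apply: le_trans (ler_wpM2l (powR_ge0 A (q - 1)) key).
by rewrite mulrA [A `^ (q - 1) * A]mulrC mulr_powRB1 // ltW.
Qed.

Lemma jensen_integral d (T : measurableType d) (mu : {measure set T -> \bar R})
    q (N : R) (u g : T -> R) : 1 < q -> 0 < N ->
  (forall x, 0 <= u x) -> (forall x, 0 <= g x) -> rintegrable mu g ->
  \int[mu]_x g x <= N^-1 -> rintegrable mu (fun x => u x * g x) ->
  rintegrable mu (fun x => u x `^ q * g x) ->
  (N * \int[mu]_x (u x * g x)) `^ q <= N * \int[mu]_x (u x `^ q * g x).
Proof.
move=> q1 N0 u0 g0 ig gN iug iuqg; have q0 : 0 < q := lt_trans ltr01 q1.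
set S := \int[mu]_x (u x * g x); set b := N * S.
have S0 : 0 <= S by apply: Rintegral_ge0 => x _; rewrite mulr_ge0.
have b0 : 0 <= b by rewrite mulr_ge0 // ltW.
have key : S * b `^ (q - 1) <= q^-1 * (\int[mu]_x (u x `^ q * g x)) +
    (1 - q^-1) * b `^ q * N^-1.
  have q10 : 0 <= (1 - q^-1) * b `^ q.
    by rewrite mulr_ge0 ?powR_ge0// subr_ge0 invf_le1 // ltW.
  apply: (@le_trans _ _ (\int[mu]_x (q^-1 * (u x `^ q * g x) +
      (1 - q^-1) * b `^ q * g x))).
    rewrite mulrC /S -(RintegralZl _ measurableT iug).
    apply: (le_Rintegral measurableT); first exact: rintegrableZl.
      by apply: rintegrableD; exact: rintegrableZl.
    move=> x _; rewrite mulrA [b `^ _ * _]mulrC mulrA -mulrDl.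
    by apply: ler_wpM2r => //; exact: young_powR.
  rewrite (RintegralD measurableT (rintegrableZl _ iuqg) (rintegrableZl _ ig)).
  rewrite (RintegralZl _ measurableT iuqg) (RintegralZl _ measurableT ig).
  by rewrite lerD2l ler_wpM2l.
have bE : b `^ (q - 1) * b = b `^ q by rewrite mulrC mulr_powRB1// ltW.
move: (ler_wpM2l (ltW N0) key); set I := \int[mu]_x _ => {}key.
have e1 : N * (S * b `^ (q - 1)) = b `^ q by rewrite mulrA mulrC bE.
have e2 : N * (q^-1 * I + (1 - q^-1) * b `^ q / N) = q^-1 * (N * I) + (1 - q^-1) * b `^ q.
  by field; rewrite !gt_eqF.
rewrite e1 e2 in key; rewrite -(ler_pM2l (_ : 0 < q^-1)) ?invr_gt0//.
by move: key; set B := b `^ q; set r := q^-1; set NI := N * I => key; lra.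
Qed.

End jensen.

(** * Projections on finite systems with nonnegative dual functions *)

Section frame.
Context d (T : measurableType d) (R : realType).
Variable mu : {measure set T -> \bar R}.

(* A finite system of functions [w k] with dual functions [g k]; the operator
   [f |-> \sum_k (N * \int f * g k) * w k] is bounded on every [L^q]. *)
Record frame (J : finType) (w g : J -> T -> R) (A G N : R) : Prop := Frame {
  frame_A0 : 0 < A;
  frame_G0 : 0 < G;
  frame_N0 : 0 < N;
  frame_wI : forall k, rintegrable mu (w k);
  frame_wsum : forall x, \sum_k `|w k x| <= A;
  frame_wint : forall k, \int[mu]_x `|w k x| <= A / N;
  frame_g0 : forall k x, 0 <= g k x;
  frame_gI : forall k, rintegrable mu (g k);
  frame_gint : forall k, \int[mu]_x g k x <= N^-1;
  frame_gsum : forall x, \sum_k g k x <= G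
}.

Definition fcoef (J : finType) (g : J -> T -> R) (N : R) (r : T -> R) (k : J) : R :=
  N * \int[mu]_x (r x * g k x).

Definition fproj (J : finType) (w g : J -> T -> R) (N : R) (r : T -> R) (x : T) : R :=
  \sum_k fcoef g N r k * w k x.

Definition fkernel (J : finType) (w g : J -> T -> R) (N : R) (x y : T) : R :=
  N * \sum_k w k x * g k y.

Section bounds.
Variables (J : finType) (w g : J -> T -> R) (A G N : R).
Hypothesis fr : frame w g A G N.

Let N0 := frame_N0 fr.
Let A0 := frame_A0 fr.
Let g0 := frame_g0 fr.
Let gI := frame_gI fr.
Let wI := frame_wI fr.

Section function.
Variables (r : T -> R) (B : R).
Hypotheses (mr : measurable_fun setT r) (rB : forall x, `|r x| <= B).

Lemma rintegrable_mul_dual k : rintegrable mu (fun x => r x * g k x).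
Proof.
rewrite (_ : (fun _ => _) = fun y => g k y * r y).
  exact: (rintegrable_bounded (gI k) mr rB).
by apply/funext => y; rewrite mulrC.
Qed.

Lemma fcoef_le (e : R) k : (forall x, `|r x| * g k x <= e * g k x) ->
  0 <= e -> `|fcoef g N r k| <= e.
Proof.
move=> re e0; rewrite normrM gtr0_norm// -ler_pdivlMl//.
apply: (@le_trans _ _ (\int[mu]_x (e * g k x))); last first.
  rewrite (RintegralZl _ measurableT (gI k)) mulrC.
  by apply: ler_wpM2r => //; exact: frame_gint fr k.
apply: le_Rintegral_norm; [exact: rintegrable_mul_dual|exact: rintegrableZl|].
by move=> x; rewrite normrM [`|g k x|]ger0_norm.
Qed.

Lemma fcoef_bound k : `|fcoef g N r k| <= B.
Proof.
apply: fcoef_le => [x|]; first by rewrite ler_wpM2r.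
exact: le_trans (normr_ge0 _) (rB point).
Qed.

Lemma fproj_bound x : `|fproj w g N r x| <= A * B.
Proof.
apply: le_trans (ler_norm_sum _ _ _) _.
apply: (@le_trans _ _ (\sum_k `|w k x| * B)).
  by apply: ler_sum => k _; rewrite normrM mulrC ler_wpM2l// fcoef_bound.
rewrite -mulr_suml ler_wpM2r ?(frame_wsum fr)//.
exact: le_trans (normr_ge0 _) (rB point).
Qed.

Lemma fproj_kernel x : fproj w g N r x = \int[mu]_y (r y * fkernel w g N x y).
Proof.
have hk k := rintegrable_mul_dual k.
symmetry; transitivity (\int[mu]_y (\sum_k (w k x * N) * (r y * g k y))).
  congr Rintegral; apply/funext => y; rewrite /fkernel !mulr_sumr.
  by apply: eq_bigr => k _; ring.
rewrite (Rintegral_sum (index_enum J) (fun k => rintegrableZl (w k x * N) (hk k))).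
apply: eq_bigr => k _; rewrite (RintegralZl _ measurableT (hk k)) /fcoef.
by rewrite -mulrA mulrC.
Qed.

Variable q : R.
Hypotheses (q1 : 1 < q) (rq : rintegrable mu (fun x => `|r x| `^ q)).

Lemma fcoef_powR k :
  rintegrable mu (fun x => `|r x| `^ q * g k x) /\
  `|fcoef g N r k| `^ q <= N * \int[mu]_x (`|r x| `^ q * g k x).
Proof.
have mq : measurable_fun setT (fun x => `|r x| `^ q).
  exact: rintegrable_measurable rq.
have iq : rintegrable mu (fun x => `|r x| `^ q * g k x).
  rewrite (_ : (fun _ => _) = fun y => g k y * `|r y| `^ q); last first.
    by apply/funext => y; rewrite mulrC.
  apply: (rintegrable_bounded (c := B `^ q) (gI k) mq) => x.
  rewrite ger0_norm ?powR_ge0// ge0_ler_powR//.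
    by rewrite (le_trans ler01)// ltW.
  by rewrite nnegrE (le_trans _ (rB x)).
split=> //.
have ir : rintegrable mu (fun x => `|r x| * g k x).
  rewrite (_ : (fun _ => _) = fun x => `|r x * g k x|).
    exact/rintegrable_norm/rintegrable_mul_dual.
  by apply/funext => x; rewrite normrM [`|g k x|]ger0_norm.
apply: le_trans (jensen_integral q1 N0 (fun x => normr_ge0 (r x)) (g0 k) (gI k)
  (frame_gint fr k) ir iq).
have q0 : 0 <= q by rewrite (le_trans ler01)// ltW.
apply: ge0_ler_powR => //; rewrite ?nnegrE//.
  by rewrite mulr_ge0 ?(ltW N0)// Rintegral_ge0// => x _; rewrite mulr_ge0.
rewrite normrM gtr0_norm// ler_wpM2l ?(ltW N0)//.
apply: le_Rintegral_norm => //; first exact: rintegrable_mul_dual.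
by move=> x; rewrite normrM [`|g k x|]ger0_norm.
Qed.

Lemma fcoef_powR_sum :
  \sum_k `|fcoef g N r k| `^ q <= G * N * \int[mu]_x `|r x| `^ q.
Proof.
apply: (@le_trans _ _ (\sum_k N * \int[mu]_x (`|r x| `^ q * g k x))).
  by apply: ler_sum => k _; have [] := fcoef_powR k.
have hk k : rintegrable mu (fun x => `|r x| `^ q * g k x) by have [] := fcoef_powR k.
rewrite -mulr_sumr [G * N]mulrC -mulrA ler_wpM2l ?(ltW N0)//.
rewrite -(Rintegral_sum (index_enum J) hk) -(RintegralZl _ measurableT rq).
apply: (le_Rintegral measurableT).
- exact: rintegrable_sum.
- exact: rintegrableZl.
- move=> x _; rewrite -mulr_sumr mulrC ler_wpM2r ?powR_ge0//.
  exact: (frame_gsum fr).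
Qed.

Lemma measurable_fproj : measurable_fun setT (fproj w g N r).
Proof.
apply: measurable_sum => k; apply: measurable_funM => //.
exact: rintegrable_measurable (wI k).
Qed.

(** Jensen's inequality is used twice: with the weights |w_k(x)| at each point, and with the dual
    functions inside the coefficients. The factor N from the sum of the coefficients cancels against
    the mass A/N of the pieces, so the bound is independent of the scale. *)
Lemma fproj_powR :
  rintegrable mu (fun x => `|fproj w g N r x| `^ q) /\
  \int[mu]_x `|fproj w g N r x| `^ q <=
  A `^ (q - 1) * A * G * \int[mu]_x `|r x| `^ q.
Proof.
have q0 : 0 <= q by rewrite (le_trans ler01)// ltW.
pose h x := A `^ (q - 1) * \sum_k `|fcoef g N r k| `^ q * `|w k x|.
have ih : rintegrable mu h.
  apply/rintegrableZl/rintegrable_sum => k; exact/rintegrableZl/rintegrable_norm.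
have fh x : `|fproj w g N r x| `^ q <= h x.
  apply: (@le_trans _ _ ((\sum_k `|fcoef g N r k| * `|w k x|) `^ q)).
    apply: ge0_ler_powR; rewrite ?nnegrE ?sumr_ge0//.
    apply: le_trans (ler_norm_sum _ _ _) _.
    by apply: ler_sum => k _; rewrite normrM.
  by apply: jensen_sum => //; exact: (frame_wsum fr).
have mf : measurable_fun setT (fun x => `|fproj w g N r x| `^ q).
  apply: (measurableT_comp (measurable_powR q)).
  exact: (measurableT_comp (@normr_measurable R setT) measurable_fproj).
have ifp : rintegrable mu (fun x => `|fproj w g N r x| `^ q).
  by apply: (rintegrable_le mf ih) => x; rewrite ger0_norm ?powR_ge0.
split=> //.
apply: (le_trans (le_Rintegral measurableT ifp ih (fun x _ => fh x))).
have hk k : rintegrable mu (fun x => `|fcoef g N r k| `^ q * `|w k x|).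
  exact/rintegrableZl/rintegrable_norm.
rewrite (RintegralZl _ measurableT (rintegrable_sum _ hk)).
rewrite -!mulrA ler_wpM2l ?powR_ge0// (Rintegral_sum (index_enum J) hk).
apply: (@le_trans _ _ (\sum_k `|fcoef g N r k| `^ q * (A / N))).
  apply: ler_sum => k _; rewrite (RintegralZl _ measurableT (rintegrable_norm (wI k))).
  by rewrite ler_wpM2l ?powR_ge0// (frame_wint fr).
rewrite -mulr_suml mulrC; apply: le_trans (ler_wpM2l _ fcoef_powR_sum) _.
  by rewrite divr_ge0 ?ltW.
by rewrite !mulrA [A / N * G]mulrAC divfK ?gt_eqF.
Qed.

End function.

Lemma fkernel_integrable x : rintegrable mu (fkernel w g N x).
Proof. by apply/rintegrableZl/rintegrable_sum => k; exact: rintegrableZl. Qed.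

Lemma fcoefB (r s : T -> R) (B : R) k :
  measurable_fun setT r -> (forall x, `|r x| <= B) ->
  measurable_fun setT s -> (forall x, `|s x| <= B) ->
  fcoef g N (fun x => r x - s x) k = fcoef g N r k - fcoef g N s k.
Proof.
move=> mr rB ms sB; rewrite /fcoef -mulrBr; congr (_ * _).
rewrite -(RintegralB measurableT (rintegrable_mul_dual mr rB k)
  (rintegrable_mul_dual ms sB k)).
by congr Rintegral; apply/funext => x; rewrite mulrBl.
Qed.

End bounds.

(** The finer projection fixes each [w k], hence by linearity every finite combination of them, in
    particular every coarser projection. *)
Lemma fproj_idem (J J' : finType) (w g : J -> T -> R) (w' g' : J' -> T -> R)
    (A G N A' G' N' : R) (r : T -> R) :
  frame w g A G N -> frame w' g' A' G' N' ->
  (forall k x, \int[mu]_y (w k y * fkernel w' g' N' x y) = w k x) ->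
  fproj w' g' N' (fproj w g N r) = fproj w g N r.
Proof.
move=> fr fr' ww; apply/funext => x.
have wb k y : `|w k y| <= A.
  apply: le_trans (frame_wsum fr y); rewrite (bigD1 k)//= lerDl.
  exact: sumr_ge0.
have mw k := rintegrable_measurable (frame_wI fr k).
have hk k k' := rintegrable_mul_dual fr' (mw k) (wb k) k'.
transitivity (\sum_k fcoef g N r k * fproj w' g' N' (w k) x); last first.
  by apply: eq_bigr => k _; rewrite (fproj_kernel fr' (mw k) (wb k)) ww.
rewrite /fproj; under [RHS]eq_bigr do rewrite mulr_sumr.
rewrite exchange_big/=; apply: eq_bigr => k' _.
under [RHS]eq_bigr do rewrite mulrA.
rewrite -mulr_suml; congr (_ * _); rewrite {1}/fcoef.
under eq_Rintegral do rewrite mulr_suml.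
under eq_Rintegral do under eq_bigr do rewrite -mulrA.
rewrite (Rintegral_sum (index_enum J) (fun k => rintegrableZl (fcoef g N r k) (hk k k'))).
rewrite mulr_sumr; apply: eq_bigr => k _.
by rewrite (RintegralZl _ measurableT (hk k k')) mulrCA.
Qed.

End frame.

Section frame_product.
Context d d' (T : measurableType d) (S : measurableType d') (R : realType).
Variables (mu : {measure set T -> \bar R}) (nu : {measure set S -> \bar R}).
Variables (n : nat) (pi : 'I_n -> S -> T).
Hypothesis prod_int : forall u : 'I_n -> T -> R, (forall i, rintegrable mu (u i)) ->
  rintegrable nu (fun s => \prod_i u i (pi i s)) /\
  \int[nu]_s \prod_i u i (pi i s) = \prod_i \int[mu]_x u i x.

(** The construction is used twice, with [pi] the coordinates of a point of R^n and with [pi] the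
    rows of a point of (R^n)^m; the hypothesis [prod_int] is what Fubini's theorem supplies in the
    two cases. *)
Definition tensor (J : finType) (w : J -> T -> R) (k : {ffun 'I_n -> J}) (s : S) : R :=
  \prod_i w (k i) (pi i s).

Lemma norm_tensor (J : finType) (w : J -> T -> R) k s :
  `|tensor w k s| = tensor (fun k x => `|w k x|) k s.
Proof. exact: normr_prod. Qed.

Lemma sum_tensor (J : finType) (w : J -> T -> R) s :
  \sum_k tensor w k s = \prod_i \sum_j w j (pi i s).
Proof. by rewrite bigA_distr_bigA. Qed.

Lemma prodr_le_const (u : 'I_n -> R) (c : R) :
  (forall i, 0 <= u i) -> (forall i, u i <= c) -> \prod_i u i <= c ^+ n.
Proof.
move=> u0 uc; rewrite -[X in c ^+ X]card_ord -prodr_const.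
by apply: ler_prod => i _; rewrite u0 uc.
Qed.

Lemma frame_tensor (J : finType) (w g : J -> T -> R) (A G N : R) :
  frame mu w g A G N ->
  frame nu (tensor w) (tensor g) (A ^+ n) (G ^+ n) (N ^+ n).
Proof.
move=> fr; have [A0 G0 N0 wI ws wint g0 gI gint gs] := fr.
have wn k := rintegrable_norm (wI k).
split; rewrite ?exprn_gt0//.
- by move=> k; have [] := prod_int (fun i => wI (k i)).
- move=> s; under eq_bigr do rewrite norm_tensor.
  rewrite sum_tensor; apply: prodr_le_const => i; last exact: ws.
  exact: sumr_ge0.
- move=> k; have [_] := prod_int (fun i => wn (k i)).
  rewrite -exprVn -exprMn => intE.
  rewrite (_ : \int[nu]_s _ = \prod_i \int[mu]_x `|w (k i) x|).
    by apply: prodr_le_const => i; [exact: Rintegral_ge0|exact: wint].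
  by rewrite -intE; congr Rintegral; apply/funext => s; rewrite norm_tensor.
- by move=> k s; apply: prodr_ge0 => i _.
- by move=> k; have [] := prod_int (fun i => gI (k i)).
- move=> k; have [_] := prod_int (fun i => gI (k i)).
  rewrite -exprVn /tensor => ->; apply: prodr_le_const => i; last exact: gint.
  by apply: Rintegral_ge0 => x _.
- move=> s; rewrite sum_tensor; apply: prodr_le_const => i; last exact: gs.
  by apply: sumr_ge0.
Qed.

Lemma fkernel_tensor (J : finType) (w g : J -> T -> R) (N : R) s t :
  fkernel (tensor w) (tensor g) (N ^+ n) s t =
  \prod_i fkernel w g N (pi i s) (pi i t).
Proof.
rewrite /fkernel big_split/= prodr_const card_ord; congr (_ * _).
by rewrite bigA_distr_bigA; apply: eq_bigr => k _; rewrite /tensor big_split.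
Qed.

Lemma tensor_reproduces (J J' : finType) (w g : J -> T -> R) (w' g' : J' -> T -> R)
    (A G N A' G' N' : R) : frame mu w g A G N -> frame mu w' g' A' G' N' ->
  (forall k x, \int[mu]_y (w k y * fkernel w' g' N' x y) = w k x) ->
  forall k s, \int[nu]_t (tensor w k t * fkernel (tensor w') (tensor g') (N' ^+ n) s t) =
    tensor w k s.
Proof.
move=> fr fr' ww k s.
have wb j y : `|w j y| <= A.
  apply: le_trans (frame_wsum fr y); rewrite (bigD1 j)//= lerDl; exact: sumr_ge0.
have hk i : rintegrable mu (fun y => w (k i) y * fkernel w' g' N' (pi i s) y).
  rewrite (_ : (fun _ => _) = fun y => fkernel w' g' N' (pi i s) y * w (k i) y).
    apply: (rintegrable_bounded (fkernel_integrable fr' _) _ (wb (k i))).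
    exact: rintegrable_measurable (frame_wI fr (k i)).
  by apply/funext => y; rewrite mulrC.
have [_ intE] := prod_int hk.
transitivity (\prod_i \int[mu]_y (w (k i) y * fkernel w' g' N' (pi i s) y)).
  rewrite -intE; congr Rintegral; apply/funext => t.
  by rewrite fkernel_tensor /tensor [RHS]big_split.
by apply: eq_bigr => i _; rewrite ww.
Qed.

End frame_product.

(** * Approximation error of a product kernel from the errors in single variables *)

Section kernel_error.
Variable R : realType.
Local Notation leb := (@lebesgue_measure R).

Lemma prod_kernel_error d1 d2 (T1 : measurableType d1) (T2 : measurableType d2)
    (mu : {sigma_finite_measure set T1 -> \bar R})
    (nu : {sigma_finite_measure set T2 -> \bar R})
    (u : T1 -> R) (v : T2 -> R) (F : T1 * T2 -> R) (s0 : T1) (y0 : T2)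
    (A B e1 e2 : R) :
  rintegrable mu u -> rintegrable nu v -> measurable_fun setT F ->
  (forall z, `|F z| <= B) -> \int[mu]_s `|u s| <= A -> 0 <= e2 ->
  (forall s, `|\int[nu]_y (F (s, y) * v y) - F (s, y0)| <= e2) ->
  `|\int[mu]_s (F (s, y0) * u s) - F (s0, y0)| <= e1 ->
  rintegrable (mu \x nu)%E (fun z => F z * (u z.1 * v z.2)) /\
  `|\int[(mu \x nu)%E]_z (F z * (u z.1 * v z.2)) - F (s0, y0)| <= e2 * A + e1.
Proof.
move=> iu iv mF FB uA e20 Fv Fu.
have B0 : 0 <= B := le_trans (normr_ge0 _) (FB (s0, y0)).
have mG : measurable_fun setT (fun z => F z * (u z.1 * v z.2)).
  apply: measurable_funM => //; apply: measurable_funM.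
    exact: (measurableT_comp (rintegrable_measurable iu) measurable_fst).
  exact: (measurableT_comp (rintegrable_measurable iv) measurable_snd).
have iBu := rintegrableZl B iu.
have Guv s y : `|F (s, y) * (u s * v y)| <= `|B * u s| * `|v y|.
  rewrite !normrM [`|B|]ger0_norm// mulrA; apply: ler_wpM2r => //.
  by apply: ler_wpM2r.
split; first exact: (fubini_integrable iBu iv mG Guv).
rewrite (Rintegral_prod1 iBu iv mG Guv).
have mF2 s : measurable_fun setT (fun y => F (s, y)).
  exact: (measurableT_comp mF (measurable_pair1 s)).
have mF1 y : measurable_fun setT (fun s => F (s, y)).
  exact: (measurableT_comp mF (measurable_pair2 y)).
have isec s : rintegrable nu (fun y => F (s, y) * v y).
  rewrite (_ : (fun _ => _) = fun y => v y * F (s, y)).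
    exact: (rintegrable_bounded iv (mF2 s) (fun y => FB _)).
  by apply/funext => y; rewrite mulrC.
pose h s := \int[nu]_y (F (s, y) * v y).
have hE s : \int[nu]_y (F (s, y) * (u s * v y)) = u s * h s.
  rewrite /h -(RintegralZl _ measurableT (isec s)).
  by congr Rintegral; apply/funext => y; rewrite mulrCA.
have ih : rintegrable mu (fun s => u s * h s).
  have := fubini_integrable_fst iBu iv mG Guv.
  by rewrite (_ : (fun _ => _) = fun s => u s * h s)//; apply/funext => s; exact: hE.
rewrite (_ : (fun _ => _) = fun s => u s * h s); last by apply/funext => s; exact: hE.
have i0 : rintegrable mu (fun s => u s * F (s, y0)).
  exact: (rintegrable_bounded iu (mF1 y0) (fun y => FB _)).
have -> : \int[mu]_s (u s * h s) - F (s0, y0) =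
    \int[mu]_s (u s * h s - u s * F (s, y0)) +
    (\int[mu]_s (F (s, y0) * u s) - F (s0, y0)).
  rewrite (RintegralB measurableT ih i0) addrA; congr (_ - _).
  rewrite (_ : (fun s => F (s, y0) * u s) = fun s => u s * F (s, y0)) ?subrK//.
  by apply/funext => s; rewrite mulrC.
apply: (le_trans (ler_normD _ _)); apply: lerD => //.
apply: (@le_trans _ _ (\int[mu]_s (e2 * `|u s|))); last first.
  by rewrite (RintegralZl _ measurableT (rintegrable_norm iu)) ler_wpM2l.
apply: le_Rintegral_norm; first exact: rintegrableB.
  exact/rintegrableZl/rintegrable_norm.
move=> s; rewrite -mulrBr normrM mulrC; apply: ler_wpM2r => //; exact: Fv.
Qed.

(** The recursion for the accumulated error when one more variable is added: the old error is
    multiplied by the mass of the new kernel and a new error e is added. *)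
Lemma error_step (A e : R) (n : nat) : 1 <= A -> 0 <= e ->
  e * (n%:R * A ^+ n) * A + e <= e * (n.+1%:R * A ^+ n.+1).
Proof.
move=> A1 e0; rewrite -!mulrA -[X in _ + X]mulr1 -mulrDr ler_wpM2l//.
rewrite mulrSr mulrDl mul1r -exprSr lerD2l.
by rewrite -[leLHS](expr1n R n.+1) lerXn2r// nnegrE (le_trans ler01).
Qed.

Lemma rV_kernel_error n (k : 'I_n -> R -> R) (f : 'rV[R]_n -> R) (x : 'rV[R]_n)
    (A B e : R) :
  1 <= A -> 0 <= e -> (forall i, rintegrable leb (k i)) ->
  (forall i, \int[leb]_s `|k i s| <= A) ->
  measurable_fun setT f -> (forall y, `|f y| <= B) ->
  (forall i y, `|\int[leb]_s (f (s *: delta_mx 0 i + y) * k i s) -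
     f (x 0 i *: delta_mx 0 i + y)| <= e) ->
  `|\int[lebesgue_rV n]_y (f y * \prod_i k i (y 0 i)) - f x| <= e * (n%:R * A ^+ n).
Proof.
move=> A1 e0; have A0 : 0 <= A := le_trans ler01 A1.
elim: n k f x => [|n IH] k f x ki kA mf fB fe.
  rewrite Rintegral_rV0 big_ord0 mulr1 [x]thinmx0 subrr normr0.
  by rewrite mul0r mulr0.
pose x' : 'rV[R]_n := \row_i x 0 (lift ord0 i).
pose k' i := k (lift ord0 i).
have [ik' _] := prod_coord_integral (fun i => ki (lift ord0 i)).
have mF : measurable_fun setT (fun y : 'rV[R]_n.+1 => f y * \prod_i k i (y 0 i)).
  apply: measurable_funM => //; apply: measurable_prod_coord => i.
  exact: rintegrable_measurable (ki i).
have pE : (fun z : measurableTypeR R * 'rV[R]_n =>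
      f (row_cons z) * \prod_i k i (row_cons z 0 i)) =
    fun z => f (row_cons z) * (k ord0 z.1 * \prod_i k' i (z.2 0 i)).
  apply/funext => z; rewrite big_ord_recl row_cons0; congr (_ * (_ * _)).
  by apply: eq_bigr => i _; rewrite row_consS.
have [|||i1 i2] := @prod_kernel_error _ _ _ _ (@lebesgue_measure R) (lebesgue_rV n)
  (k ord0) (fun y => \prod_i k' i (y 0 i)) (f \o @row_cons R n) (x 0 ord0) x'
  A B e (e * (n%:R * A ^+ n)) (ki ord0) ik'
  (measurableT_comp mf (@measurable_row_cons R n)) (fun z => fB _) (kA ord0).
- by rewrite !mulr_ge0 ?exprn_ge0.
- move=> s; apply: (IH k' (fun y => f (row_cons (s, y)))) => //.
  + by move=> i; exact: ki.
  + by move=> i; exact: kA.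
  + exact: (measurableT_comp mf (measurable_row_cons_snd s)).
  + move=> i y; rewrite mxE row_cons_lineS.
    under eq_Rintegral do rewrite row_cons_lineS.
    exact: fe.
- have := fe ord0 (row_cons (0 : measurableTypeR R, x')).
  rewrite -row_consE0.
  by under eq_Rintegral do rewrite -row_consE0.
rewrite (Rintegral_rV mF); last by rewrite pE.
rewrite pE [in f x](row_cons_surj x); apply: (le_trans i2); exact: error_step.
Qed.

Lemma mx_cons_surj m n (x : 'M[R]_(m.+1, n)) :
  x = mx_cons (row ord0 x, \matrix_(i, j) x (lift ord0 i) j).
Proof.
apply/row_matrixP => i; case: (unliftP ord0 i) => [l ->|->].
  by rewrite row_mx_consS; apply/rowP => j; rewrite !mxE.
by rewrite row_mx_cons0.
Qed.

Lemma mx_cons_line0 m n (s : R) j (v : 'rV[R]_n) (Y : 'M[R]_(m, n)) :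
  mx_cons (s *: delta_mx 0 j + v, Y) = s *: delta_mx ord0 j + mx_cons (v, Y).
Proof.
apply/row_matrixP => i; case: (unliftP ord0 i) => [l ->|->].
  rewrite linearD linearZ /= !row_mx_consS; apply/rowP => c.
  by rewrite !mxE/= mulr0 add0r.
rewrite linearD linearZ /= !row_mx_cons0; apply/rowP => c.
by rewrite !mxE.
Qed.

Lemma mx_cons_lineS m n (s : R) i j (v : 'rV[R]_n) (Y : 'M[R]_(m, n)) :
  mx_cons (v, s *: delta_mx i j + Y) = s *: delta_mx (lift ord0 i) j + mx_cons (v, Y).
Proof.
apply/row_matrixP => k; case: (unliftP ord0 k) => [l ->|->].
  rewrite linearD linearZ /= !row_mx_consS; apply/rowP => c.
  by rewrite !mxE/= (inj_eq lift_inj).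
rewrite linearD linearZ /= !row_mx_cons0; apply/rowP => c.
by rewrite !mxE/= mulr0 add0r.
Qed.

Lemma mx_kernel_error m n (k : 'I_m -> 'I_n -> R -> R) (f : 'M[R]_(m, n) -> R)
    (x : 'M[R]_(m, n)) (A B e : R) :
  1 <= A -> 0 <= e -> (forall i j, rintegrable leb (k i j)) ->
  (forall i j, \int[leb]_s `|k i j s| <= A) ->
  measurable_fun setT f -> (forall y, `|f y| <= B) ->
  (forall i j y, `|\int[leb]_s (f (s *: delta_mx i j + y) * k i j s) -
     f (x i j *: delta_mx i j + y)| <= e) ->
  `|\int[lebesgue_mx m n]_y (f y * \prod_i \prod_j k i j (row i y 0 j)) - f x| <=
  e * (n%:R * A ^+ n) * (m%:R * (A ^+ n) ^+ m).
Proof.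
move=> A1 e0; have A0 : 0 <= A := le_trans ler01 A1.
have An1 : 1 <= A ^+ n by rewrite exprn_ege1.
have En0 : 0 <= e * (n%:R * A ^+ n) by rewrite !mulr_ge0 ?exprn_ge0.
elim: m k f x => [|m IH] k f x ki kA mf fB fe.
  rewrite Rintegral_mx0 big_ord0 mulr1 [x]flatmx0 subrr normr0.
  by rewrite mul0r mulr0.
pose x' : 'M[R]_(m, n) := \matrix_(i, j) x (lift ord0 i) j.
have iK i : rintegrable (lebesgue_rV n) (fun v => \prod_j k i j (v 0 j)).
  by have [] := prod_coord_integral (ki i).
have KA i : \int[lebesgue_rV n]_v `|\prod_j k i j (v 0 j)| <= A ^+ n.
  have [_ /= intE] := prod_coord_integral (fun j => rintegrable_norm (ki i j)).
  rewrite (_ : (fun v => `|_|) = fun v : 'rV[R]_n => \prod_j `|k i j (v 0 j)|).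
    rewrite intE -[X in A ^+ X]card_ord -prodr_const; apply: ler_prod => j _.
    by rewrite kA andbT; exact: Rintegral_ge0.
  by apply/funext => v; rewrite normr_prod.
have [iK' _] := prod_row_integral (fun i : 'I_m => iK (lift ord0 i)).
have mF : measurable_fun setT (fun y : 'M[R]_(m.+1, n) =>
    f y * \prod_i \prod_j k i j (row i y 0 j)).
  apply: measurable_funM => //.
  apply: (measurable_prod_row (u := fun i v => \prod_j k i j (v 0 j))) => i.
  exact: rintegrable_measurable (iK i).
have pE : (fun z : 'rV[R]_n * 'M[R]_(m, n) =>
      f (mx_cons z) * \prod_i \prod_j k i j (row i (mx_cons z) 0 j)) =
    fun z => f (mx_cons z) * ((\prod_j k ord0 j (z.1 0 j)) *
      \prod_i \prod_j k (lift ord0 i) j (row i z.2 0 j)).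
  apply/funext => z; rewrite big_ord_recl row_mx_cons0; congr (_ * (_ * _)).
  by apply: eq_bigr => i _; rewrite row_mx_consS.
have [|||i1 i2] := @prod_kernel_error _ _ _ _ (lebesgue_rV n) (lebesgue_mx m n)
  (fun v => \prod_j k ord0 j (v 0 j))
  (fun y => \prod_i \prod_j k (lift ord0 i) j (row i y 0 j))
  (f \o @mx_cons R m n) (row ord0 x) x'
  (A ^+ n) B (e * (n%:R * A ^+ n)) (e * (n%:R * A ^+ n) * (m%:R * (A ^+ n) ^+ m))
  (iK ord0) iK' (measurableT_comp mf (@measurable_mx_cons R m n)) (fun z => fB _)
  (KA ord0).
- by rewrite !mulr_ge0 ?exprn_ge0.
- move=> v; apply: (IH (fun i => k (lift ord0 i)) (fun y => f (mx_cons (v, y)))) => //.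
  + exact: (measurableT_comp mf
      (measurableT_comp (@measurable_mx_cons R m n) (measurable_pair1 v))).
  + move=> i j y; rewrite mxE mx_cons_lineS.
    under eq_Rintegral do rewrite mx_cons_lineS.
    exact: fe.
- apply: (rV_kernel_error (f := fun v => f (mx_cons (v, x'))) (B := B)) => //.
    exact: (measurableT_comp mf
      (measurableT_comp (@measurable_mx_cons R m n) (measurable_pair2 x'))).
  move=> j v; rewrite mxE mx_cons_line0.
  under eq_Rintegral do rewrite mx_cons_line0.
  exact: fe.
rewrite (Rintegral_mx mF); last by rewrite pE.
rewrite pE [in f x](mx_cons_surj x); apply: (le_trans i2); exact: error_step.
Qed.

End kernel_error.

(** * Dyadic projections on (R^n)^m, their residuals and coefficients *)

Section scales.
Variables (R : realType) (m n M L : nat).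
Hypothesis M0 : (0 < M)%N.
Local Notation leb := (@lebesgue_measure R).
Local Notation A := (node_poly_norm R M + 1).
Local Notation G := (M.+1%:R : R).

Lemma frame_cell (N : nat) : (0 < N)%N ->
  frame leb (@cell_poly R M L N) (@cell_dual R M L N) A G N%:R.
Proof.
move=> N0; have N0R : 0 < N%:R :> R by rewrite ltr0n.
have e0 := @node_poly_norm_ge0 R M.
split => //.
- by rewrite ltr_wpDl.
- by move=> k; apply: cell_poly_integrable.
- by move=> x; apply: (@le_trans _ _ (node_poly_norm R M)); [exact: cell_poly_sum|rewrite lerDl].
- move=> k; apply: (@le_trans _ _ (node_poly_norm R M / N%:R)).
    exact: cell_poly_norm_integral.
  by rewrite ler_wpM2r ?invr_ge0// lerDl.
- by move=> k x; exact: cell_dual_ge0.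
- by move=> k; apply: cell_dual_integrable.
- by move=> k; apply: cell_dual_integral.
- by move=> x; apply: cell_dual_sum.
Qed.

Definition rV_piece (N : nat) :=
  tensor (fun (i : 'I_n) (x : 'rV[R]_n) => x 0 i) (@cell_poly R M L N).
Definition rV_dual (N : nat) :=
  tensor (fun (i : 'I_n) (x : 'rV[R]_n) => x 0 i) (@cell_dual R M L N).
Definition mx_piece (N : nat) :=
  tensor (fun (j : 'I_m) (x : 'M[R]_(m, n)) => row j x) (@rV_piece N).
Definition mx_dual (N : nat) :=
  tensor (fun (j : 'I_m) (x : 'M[R]_(m, n)) => row j x) (@rV_dual N).

Local Notation mu := (lebesgue_mx m n).

Lemma frame_rV (N : nat) : (0 < N)%N ->
  frame (lebesgue_rV n) (@rV_piece N) (@rV_dual N) (A ^+ n) (G ^+ n) (N%:R ^+ n).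
Proof.
by move=> N0; apply: frame_tensor (frame_cell N0); exact: prod_coord_integral.
Qed.

Lemma frame_mx (N : nat) : (0 < N)%N ->
  frame mu (@mx_piece N) (@mx_dual N) ((A ^+ n) ^+ m) ((G ^+ n) ^+ m) ((N%:R ^+ n) ^+ m).
Proof.
by move=> N0; apply: frame_tensor (frame_rV N0); exact: prod_row_integral.
Qed.

Lemma mx_piece_reproduces (N : nat) k x : (0 < N)%N ->
  \int[mu]_y (mx_piece k y *
    fkernel (@mx_piece (2 * N)) (@mx_dual (2 * N)) (((2 * N)%:R ^+ n) ^+ m) x y) =
  @mx_piece N k x.
Proof.
move=> N0; have N20 : (0 < 2 * N)%N by rewrite muln_gt0.
apply: (tensor_reproduces _ (frame_rV N0) (frame_rV N20)).
  exact: prod_row_integral.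
apply: (tensor_reproduces _ (frame_cell N0) (frame_cell N20)).
  exact: prod_coord_integral.
by move=> k' x'; exact: cell_kernel_reproduces.
Qed.

Lemma mx_kernelE (N : nat) x y :
  fkernel (@mx_piece N) (@mx_dual N) ((N%:R ^+ n) ^+ m) x y =
  \prod_i \prod_j cell_kernel M L N (row i x 0 j) (row i y 0 j).
Proof.
by rewrite fkernel_tensor; apply: eq_bigr => i _; rewrite fkernel_tensor.
Qed.

Definition inbox (x : 'M[R]_(m, n)) := forall i j, - L%:R <= x i j < L%:R.

Lemma mx_dual_support (N : nat) k x : (0 < N)%N -> @mx_dual N k x != 0 -> inbox x.
Proof.
move=> N0 /prodf_neq0 /= h i j; have {h} := h i isT.
move=> /prodf_neq0 /= h; have {h} := h j isT; rewrite mxE /cell_dual.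
case: ifP => [/andP[z0 z1] _|]; last by rewrite eqxx.
apply: (cell_box N0 (c := (k i j).1)); rewrite z0 (lt_le_trans z1)//.
exact: node_le1.
Qed.

Definition cell_proj (l : nat) (r : 'M[R]_(m, n) -> R) :=
  fproj mu (@mx_piece (2 ^ l)) (@mx_dual (2 ^ l)) (((2 ^ l)%:R ^+ n) ^+ m) r.

Definition cell_coef (l : nat) (r : 'M[R]_(m, n) -> R) :=
  fcoef mu (@mx_dual (2 ^ l)) (((2 ^ l)%:R ^+ n) ^+ m) r.

Definition proj_error : R := A * (n%:R * A ^+ n) * (m%:R * (A ^+ n) ^+ m).

Lemma proj_error_ge0 : 0 <= proj_error.
Proof.
have A0 : 0 <= A by rewrite addr_ge0// node_poly_norm_ge0.
by rewrite /proj_error !mulr_ge0 ?exprn_ge0 ?ler0n.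
Qed.

Variables (sigma : 'M[R]_(m, n) -> R) (D : R).
Hypothesis sC : Ck_real M sigma.
Hypothesis sD : forall x, `|sigma x| <= D.
Hypothesis dD : forall i j x, `|iter M (partial i j) sigma x| <= D.

Let msigma : measurable_fun setT sigma.
Proof. by apply: continuous_mx_measurable; exact: Ck_real_continuous sC. Qed.

Let D0 : 0 <= D := le_trans (normr_ge0 _) (sD 0).

Let N0 l : (0 < 2 ^ l)%N. Proof. by rewrite expn_gt0. Qed.

Lemma proj_approx l x : inbox x ->
  `|cell_proj l sigma x - sigma x| <= proj_error * (D * (2 ^ l)%:R^-1 ^+ M).
Proof.
move=> xL; have e0 := @node_poly_norm_ge0 R M.
rewrite /cell_proj (fproj_kernel (frame_mx (N0 l)) msigma sD).
under eq_Rintegral do rewrite mx_kernelE.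
have c0 : 0 <= D * (2 ^ l)%:R^-1 ^+ M by rewrite mulr_ge0// exprn_ge0// invr_ge0.
have A1 : 1 <= A by rewrite lerDr.
have -> : proj_error * (D * (2 ^ l)%:R^-1 ^+ M) = A * (D * (2 ^ l)%:R^-1 ^+ M) *
    (n%:R * A ^+ n) * (m%:R * (A ^+ n) ^+ m).
  rewrite /proj_error; set a := n%:R * _; set b := m%:R * _; set c := D * _.
  by ring.
apply: (@mx_kernel_error R m n (fun i j => cell_kernel M L (2 ^ l) (row i x 0 j)) sigma x
  A D) => //.
- by rewrite mulr_ge0// (le_trans ler01).
- by move=> i j; apply: cell_kernel_integrable.
- move=> i j; apply: (@le_trans _ _ (node_poly_norm R M)); last by rewrite lerDl.
  exact: cell_kernel_norm_integral.
- move=> i j y; rewrite mxE.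
  (* The symbol along a line in a coordinate direction: its successive derivatives are pure partial
     derivatives, so Taylor's formula in one variable applies. *)
  pose F p (s : R) := iter p (partial i j) sigma (s *: delta_mx i j + y).
  have dF p s : (p < M)%N -> is_derive s (1 : R) (F p) (F p.+1 s).
    move=> pM; apply: (is_derive_line (phi := fun s : R => s *: delta_mx i j + y)
      (w := delta_mx i j)).
      by move=> h; rewrite scalerDl addrA /GRing.scale/= mulr1.
    apply: (Ck_real_is_derive (k := (M - p.+1)%N)).
    by apply: Ck_real_iter; rewrite addnS -addSn subnKC.
  apply: (@cell_kernel_taylor R M L M0 (2 ^ l) (N0 l) F D) => //.
  + by move=> s; exact: dD.
  + apply: continuous_measurable_fun.
    exact: (@is_derive_continuous _ (F 0%N) (F 1%N) (fun s => dF 0%N s M0)).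
  + by move=> s; exact: sD.
Qed.

(** At level 0 nothing has been subtracted yet, and at level l the coarser projection of level l - 1
    has. *)
Fixpoint cell_resid (l : nat) : 'M[R]_(m, n) -> R :=
  if l is p.+1 then fun x => sigma x - cell_proj p sigma x else sigma.

Let a0 : 0 < (A ^+ n) ^+ m := frame_A0 (frame_mx (N0 0)).

Definition resid_bound : R := (1 + (A ^+ n) ^+ m) * D.

Let projD l x : `|cell_proj l sigma x| <= (A ^+ n) ^+ m * D.
Proof. exact: (fproj_bound (frame_mx (N0 l)) msigma sD). Qed.

Let mproj l : measurable_fun setT (cell_proj l sigma).
Proof. exact: (measurable_fproj (frame_mx (N0 l))). Qed.

Lemma measurable_resid l : measurable_fun setT (cell_resid l).
Proof. by case: l => //= p; exact: measurable_funB. Qed.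

Lemma resid_le l x : `|cell_resid l x| <= resid_bound.
Proof.
rewrite /resid_bound mulrDl mul1r; case: l => [|l] /=.
  by apply: (le_trans (sD x)); rewrite lerDl mulr_ge0// ltW.
by apply: (le_trans (ler_normB _ _)); exact: lerD.
Qed.

(** A telescoping sum: since the projection of level l + 1 fixes that of level l, the difference of
    the two projections of [sigma] is the finer projection of the residual. *)
Lemma proj_resid l x : cell_proj l sigma x = \sum_(p < l.+1) cell_proj p (cell_resid p) x.
Proof.
elim: l => [|l IH]; first by rewrite big_ord_recl big_ord0 addr0.
rewrite big_ord_recr/= -IH.
have frl := frame_mx (N0 l); have frl' := frame_mx (N0 l.+1).
have pE : cell_proj l.+1 (cell_proj l sigma) x = cell_proj l sigma x.
  rewrite /cell_proj (fproj_idem sigma frl frl')// => k y.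
  rewrite expnS; exact: mx_piece_reproduces.
rewrite -[X in X + _]pE -[LHS]addr0 -[X in _ + X](subrr (cell_proj l.+1 (cell_proj l sigma) x)).
rewrite addrCA; congr (_ + _); rewrite /cell_proj /fproj -sumrB.
apply: eq_bigr => k _; rewrite -mulrBl; congr (_ * _).
pose B := (1 + (A ^+ n) ^+ m) * D.
symmetry; apply: (fcoefB frl' (B := B)) => //.
- by move=> y; exact: (resid_le 0).
- exact: mproj.
- move=> y; apply: (le_trans (projD l y)); rewrite /B mulrDl mul1r.
  by rewrite lerDr.
Qed.

(** The 1 serves level 0, where the residual is the symbol itself; the factor 2^M compensates for
    the residual of level l being small at scale 2^-(l-1) instead of 2^-l. *)
Definition coef_const : R := 1 + 2 ^+ M * proj_error.

Lemma coef_const_gt0 : 0 < coef_const.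
Proof. by rewrite /coef_const ltr_pwDl// mulr_ge0// proj_error_ge0. Qed.

Lemma coef_le l k : `|@cell_coef l (cell_resid l) k| <= coef_const * (D * (2 ^ l)%:R^-1 ^+ M).
Proof.
have e0 := proj_error_ge0.
have fr := frame_mx (N0 l).
have c0 p : 0 <= D * (2 ^ p)%:R^-1 ^+ M by rewrite mulr_ge0// exprn_ge0// invr_ge0.
apply: (fcoef_le fr (measurable_resid l) (resid_le l)); last first.
  by rewrite mulr_ge0 ?c0// ltW// coef_const_gt0.
(* The approximation estimate holds inside the box only, and the dual functions vanish outside
   it. *)
move=> x; have [->|/mx_dual_support xL] := eqVneq (@mx_dual (2 ^ l) k x) 0; first by rewrite !mulr0.
apply: ler_wpM2r; first exact: (frame_g0 fr).
rewrite /coef_const mulrDl mul1r; case: l {fr k} xL => [_|l xL] /=.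
  rewrite expn0 invr1 expr1n mulr1 (le_trans (sD x))// lerDl.
  by rewrite mulr_ge0// mulr_ge0// exprn_ge0.
rewrite distrC; apply: (le_trans (proj_approx _ (xL (N0 l.+1)))).
rewrite ler_wpDl//.
rewrite le_eqVlt; apply/orP; left; apply/eqP.
rewrite expnS natrM invfM exprMn !exprVn.
have t0 : 2 ^+ M != 0 :> R by rewrite expf_neq0// pnatr_eq0.
move: t0; move: (2 ^+ M : R) ((2 ^ l)%:R ^+ M)^-1 => a b a0'.
by rewrite -[RHS]mulrA [RHS]mulrCA; congr (_ * _); rewrite [RHS]mulrCA mulVKf.
Qed.

Variable q : R.
Hypothesis q1 : 1 < q.
Hypothesis sq : rintegrable mu (fun x => `|sigma x| `^ q).

(** |a - b|^q <= 2^q (|a|^q + |b|^q), combined with the bound on the projection in L^q. *)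
Definition lq_growth : R :=
  2 `^ q * (1 + ((A ^+ n) ^+ m) `^ (q - 1) * (A ^+ n) ^+ m * (G ^+ n) ^+ m).

Definition lq_const : R := (G ^+ n) ^+ m * lq_growth.

Let growth_ge0 : 0 <= ((A ^+ n) ^+ m) `^ (q - 1) * (A ^+ n) ^+ m * (G ^+ n) ^+ m.
Proof. by rewrite mulr_ge0 ?exprn_ge0// mulr_ge0 ?powR_ge0// ltW. Qed.

Lemma lq_const_gt0 : 0 < lq_const.
Proof.
by rewrite mulr_gt0 ?exprn_gt0// mulr_gt0 ?powR_gt0// ltr_pwDl.
Qed.

Lemma resid_powR l :
  rintegrable mu (fun x => `|cell_resid l x| `^ q) /\
  \int[mu]_x `|cell_resid l x| `^ q <=
  lq_growth * \int[mu]_x `|sigma x| `^ q.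
Proof.
have q0 : 0 <= q by rewrite (le_trans ler01)// ltW.
rewrite /lq_growth; move: growth_ge0; set K := _ * _ * (G ^+ n) ^+ m => K0.
have S0 : 0 <= \int[mu]_x `|sigma x| `^ q.
  by apply: Rintegral_ge0 => x _; exact: powR_ge0.
have two1 : 1 <= 2 `^ q.
  have {1}<- : 1 `^ q = 1 :> R by rewrite powR1.
  by rewrite ge0_ler_powR ?nnegrE// ler1n.
case: l => [|l] /=.
  split=> //; rewrite ler_peMl// -[X in X <= _]mulr1 ler_pM//.
  by rewrite lerDl.
have [iP intP] := fproj_powR (frame_mx (N0 l)) msigma sD q1 sq.
have ih : rintegrable mu (fun x => 2 `^ q * (`|sigma x| `^ q + `|cell_proj l sigma x| `^ q)).
  by apply/rintegrableZl/rintegrableD.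
have rh x : `|sigma x - cell_proj l sigma x| `^ q <=
    2 `^ q * (`|sigma x| `^ q + `|cell_proj l sigma x| `^ q).
  apply: (@le_trans _ _ ((2 * Num.max `|sigma x| `|cell_proj l sigma x|) `^ q)).
    apply: ge0_ler_powR; rewrite ?nnegrE ?mulr_ge0 ?le_max ?normr_ge0//.
    apply: (le_trans (ler_normB _ _)); rewrite mulr2n mulrDl mul1r lerD//.
      by rewrite le_max lexx.
    by rewrite le_max lexx orbT.
  rewrite powRM ?le_max ?normr_ge0// ler_wpM2l ?powR_ge0//.
  by case: (leP `|sigma x| `|cell_proj l sigma x|) => _;
    [rewrite lerDr powR_ge0|rewrite lerDl powR_ge0].
have mr : measurable_fun setT (fun x => `|sigma x - cell_proj l sigma x| `^ q).
  apply: (measurableT_comp (measurable_powR q)).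
  exact: (measurableT_comp (@normr_measurable R setT) (measurable_resid l.+1)).
have ir : rintegrable mu (fun x => `|sigma x - cell_proj l sigma x| `^ q).
  by apply: (rintegrable_le mr ih) => x; rewrite ger0_norm ?powR_ge0.
split=> //; apply: (le_trans (le_Rintegral measurableT ir ih (fun x _ => rh x))).
rewrite (RintegralZl _ measurableT (rintegrableD sq iP)).
rewrite (RintegralD measurableT sq iP) -mulrA ler_wpM2l ?powR_ge0//.
by rewrite mulrDl mul1r lerD2l.
Qed.

Lemma coef_powR_sum l :
  \sum_k `|@cell_coef l (cell_resid l) k| `^ q <=
  lq_const * ((2 ^ l)%:R ^+ n) ^+ m * \int[mu]_x `|sigma x| `^ q.
Proof.
have [ir intr] := resid_powR l.
have := fcoef_powR_sum (frame_mx (N0 l)) (measurable_resid l) (resid_le l) q1 ir.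
move=> /le_trans; apply; rewrite /lq_const [leRHS]mulrAC.
apply: (@le_trans _ _ ((G ^+ n) ^+ m * ((2 ^ l)%:R ^+ n) ^+ m *
    (lq_growth * \int[mu]_x `|sigma x| `^ q))).
  by rewrite ler_wpM2l// mulr_ge0// !exprn_ge0.
by rewrite le_eqVlt; apply/orP; left; apply/eqP; ring.
Qed.

End scales.

Lemma cintegrable_bounded_mul d (T : measurableType d) (R : realType)
    (mu : {measure set T -> \bar R}) (h : T -> R[i]) (s : T -> R) (B : R) :
  cintegrable mu h -> measurable_fun setT s -> (forall x, `|s x| <= B) ->
  cintegrable mu (fun x => (s x)%:C * h x).
Proof.
move=> [h1 h2] ms sB.
split.
  rewrite (_ : (fun _ => _) = fun x => complex.Re (h x) * s x).
    exact: (rintegrable_bounded h1 ms sB).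
  by apply/funext => x; rewrite cReM/= mul0r subr0 mulrC.
rewrite (_ : (fun _ => _) = fun x => complex.Im (h x) * s x).
  exact: (rintegrable_bounded h2 ms sB).
by apply/funext => x; rewrite cImM/= mul0r addr0 mulrC.
Qed.

(** * Multiplier operators of real symbols *)

Section multiplier_tensor.
Variables (R : realType) (p n : nat).
Hypothesis p0 : (0 < p)%N.
Local Notation m := p.+1.
Variables (f : 'I_m -> 'rV[R]_n -> R[i]).
Hypothesis fS : forall j, schwartz (f j).
Local Notation mu := (lebesgue_rV n).
Local Notation nu := (lebesgue_mx m n).

Definition fourier_prod (xi : 'M[R]_(m, n)) : R[i] :=
  \prod_(j < m) fourier (f j) (row j xi).

Definition phase (x : 'rV[R]_n) (xi : 'M[R]_(m, n)) : R[i] :=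
  e2pi (dot x (\sum_(j < m) row j xi)).

Lemma phaseE x xi : phase x xi = \prod_(j < m) e2pi ((-1) ^+ false * dot (row j xi) x).
Proof.
rewrite /phase -e2pi_sum; congr e2pi; rewrite /dot.
under [RHS]eq_bigr do rewrite expr0 mul1r.
rewrite [RHS]exchange_big/=; apply: eq_bigr => i _.
by rewrite summxE mulr_sumr; apply: eq_bigr => j _; rewrite mulrC.
Qed.

Definition mopR (s : 'M[R]_(m, n) -> R) (x : 'rV[R]_n) : R[i] :=
  multiplier_op (fun xi => (s xi)%:C) f x.

Lemma fourier_sqr j : rintegrable mu (fun xi => cmod (fourier (f j) xi) ^+ 2) /\
  \int[mu]_xi cmod (fourier (f j) xi) ^+ 2 <=
  2 * 16 ^+ n * \int[mu]_x cmod (f j x) ^+ 2.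
Proof.
have := plancherel true (schwartz_cintegrable (fS j)) (schwartz_cmod_sqr (fS j)).
rewrite (_ : fint true (f j) = fourier (f j))//.
by apply/funext => xi; rewrite fourierE.
Qed.

Lemma fourier_prod_phase_integrable x :
  cintegrable nu (fun xi => fourier_prod xi * phase x xi).
Proof.
have h j : cintegrable mu (fun v => fourier (f j) v * e2pi ((-1) ^+ false * dot v x)).
  exact/cintegrable_fint/fourier_cintegrable.
have [+ _] := cintegral_prod_row h.
congr cintegrable; apply/funext => xi; rewrite phaseE -big_split.
by [].
Qed.

Lemma mopRE (s : 'M[R]_(m, n) -> R) x :
  mopR s x = cintegral nu (fun xi => (s xi)%:C * (fourier_prod xi * phase x xi)).
Proof.
rewrite /mopR /multiplier_op; congr cintegral; apply/funext => xi.
by rewrite -mulrA.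
Qed.

Lemma mopR_sum (J : finType) (s : J -> 'M[R]_(m, n) -> R) (B : R) x :
  (forall j, measurable_fun setT (s j)) -> (forall j xi, `|s j xi| <= B) ->
  mopR (fun xi => \sum_j s j xi) x = \sum_j mopR (s j) x.
Proof.
move=> ms sB.
have is_ j := cintegrable_bounded_mul (fourier_prod_phase_integrable x) (ms j) (sB j).
under [RHS]eq_bigr do rewrite mopRE.
rewrite mopRE -(cintegral_sum _ is_); congr cintegral; apply/funext => xi.
by rewrite rmorph_sum mulr_suml.
Qed.

Section tensor.
Variables (I : finType) (w g : I -> 'rV[R]_n -> R) (A G N : R).
Hypothesis fr : frame mu w g A G N.

Let wb k y : `|w k y| <= A.
Proof.
apply: le_trans (frame_wsum fr y); rewrite (bigD1 k)//= lerDl; exact: sumr_ge0.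
Qed.

Let mw k : measurable_fun setT (w k).
Proof. exact: rintegrable_measurable (frame_wI fr k). Qed.

Let wf j a v : R[i] := (w a v)%:C * fourier (f j) v.

Let iwf j a : cintegrable mu (wf j a).
Proof. exact: (cintegrable_bounded_mul (fourier_cintegrable (fS j)) (mw a) (wb a)). Qed.

(** The phase is a product over the rows, so for a tensor symbol the integral factorises; each
    factor is the inverse transform of [w a] times the transform of [f j]. *)
Lemma mopR_tensor (B : {ffun 'I_m -> I} -> R) x :
  mopR (fun xi => \sum_k B k * tensor (fun (j : 'I_m) xi => row j xi) w k xi) x =
  tensor_sum (fun j a => fint false (wf j a)) B x.
Proof.
have h (k : {ffun 'I_m -> I}) j :
    cintegrable mu (fun v => wf j (k j) v * e2pi ((-1) ^+ false * dot v x)).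
  exact/cintegrable_fint/iwf.
pose P (k : {ffun 'I_m -> I}) xi :=
  \prod_j (wf j (k j) (row j xi) * e2pi ((-1) ^+ false * dot (row j xi) x)).
have iP k : cintegrable nu (P k) := (cintegral_prod_row (h k)).1.
rewrite /mopR /multiplier_op /tensor_sum.
transitivity (cintegral nu (fun xi => \sum_k (B k)%:C * P k xi)).
  congr cintegral; apply/funext => xi; rewrite -/(fourier_prod xi) -/(phase x xi).
  rewrite phaseE rmorph_sum/= !mulr_suml; apply: eq_bigr => k _.
  rewrite rmorphM/= -!mulrA; congr (_ * _); rewrite /tensor rmorph_prod/= -!big_split/=.
  by apply: eq_bigr => j _; rewrite /wf mulrA.
rewrite (cintegral_sum _ (fun k => cintegrableZl (B k)%:C (iP k))).
apply: eq_bigr => k _; rewrite (cintegralZl _ (iP k)); congr (_ * _).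
by rewrite (cintegral_prod_row (h k)).2.
Qed.

Lemma cmeasurable_mopR_tensor (B : {ffun 'I_m -> I} -> R) :
  cmeasurable (mopR (fun xi => \sum_k B k * tensor (fun (j : 'I_m) xi => row j xi) w k xi)).
Proof.
rewrite (_ : mopR _ = tensor_sum (fun j a => fint false (wf j a)) B).
  apply: cmeasurable_tensor_sum => j a; apply: cmeasurable_fint.
  exact: cintegrable_measurable (iwf j a).
by apply/funext => x; rewrite mopR_tensor.
Qed.

Variable v : 'I_m -> R.
Hypothesis v0 : forall j, 0 < v j.
Hypothesis fv : forall j, \int[mu]_x cmod (f j x) ^+ 2 <= v j ^+ 2.

(** Bounded overlap stands in for orthogonality: by Cauchy-Schwarz with weights |w_a|, the square of
    \sum_a c_a w_a is at most A \sum_a c_a^2 |w_a|. Plancherel is used for the inverse transform of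
    such a combination and again for the transform of [f j], and the overlap bound also enters
    twice, whence the square of [2 * 16 ^+ n * A * v j]. *)
Lemma mopR_tensor_bound (B : {ffun 'I_m -> I} -> R) (X : R) (a0 : I) : 0 < X ->
  \sum_k `|B k| `^ (2 * m%:R / p%:R) <= X `^ (2 * m%:R / p%:R) ->
  (\int[mu]_x (cmod (mopR (fun xi =>
     \sum_k B k * tensor (fun (j : 'I_m) xi => row j xi) w k xi) x) `^ (2 / m%:R))%:E <=
   (m%:R * (2 * X ^+ 2 * \prod_j ((2 * 16 ^+ n * A * v j) ^+ 2)) `^ m%:R^-1)%:E)%E.
Proof.
move=> X0 BX; have A0 := frame_A0 fr.
under eq_integral do rewrite mopR_tensor.
have K0 : 0 < 2 * 16 ^+ n :> R by rewrite mulr_gt0// exprn_gt0.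
pose W j a := 2 * 16 ^+ n * (A * \int[mu]_y (`|w a y| * cmod (fourier (f j) y) ^+ 2)).
have iW j a : rintegrable mu (fun y => `|w a y| * cmod (fourier (f j) y) ^+ 2).
  rewrite (_ : (fun _ => _) = fun y => cmod (fourier (f j) y) ^+ 2 * `|w a y|).
    apply: (rintegrable_bounded (c := A) (fourier_sqr j).1).
      exact: (measurableT_comp (@normr_measurable R setT) (mw a)).
    by move=> y; rewrite normr_id.
  by apply/funext => y; rewrite mulrC.
apply: (@tensor_sum_bound _ _ _ mu p I a0 p0 _ W) => //.
- by move=> j a; apply: cmeasurable_fint; exact: cintegrable_measurable (iwf j a).
- move=> j c.
  pose h y : R[i] := \sum_a (c a)%:C * wf j a y.
  have ih : cintegrable mu h by apply: cintegrable_sum => a; exact: cintegrableZl.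
  have hE x : \sum_a (c a)%:C * fint false (wf j a) x = fint false h x.
    rewrite /fint -(eq_bigr _ (fun a _ => cintegralZl (c a)%:C
      (cintegrable_fint false x (iwf j a)))).
    rewrite -(cintegral_sum _ (fun a => cintegrableZl (c a)%:C
      (cintegrable_fint false x (iwf j a)))).
    congr cintegral; apply/funext => y; rewrite /h mulr_suml.
    by apply: eq_bigr => a _; rewrite mulrA.
  have hb y : cmod (h y) ^+ 2 <=
      \sum_a (A * c a ^+ 2) * (`|w a y| * cmod (fourier (f j) y) ^+ 2).
    have -> : h y = (\sum_a c a * w a y)%:C * fourier (f j) y.
      rewrite /h rmorph_sum mulr_suml; apply: eq_bigr => a _.
      by rewrite /wf rmorphM mulrA.
    rewrite cmodM cmod_real exprMn real_normK ?num_real//.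
    under [leRHS]eq_bigr do rewrite mulrA.
    rewrite -mulr_suml ler_wpM2r ?sqr_ge0//.
    apply: (@le_trans _ _ ((\sum_a `|w a y|) * (\sum_a c a ^+ 2 * `|w a y|))).
      pose u a := Num.sqrt `|w a y|.
      have uu a : u a ^+ 2 = `|w a y| by rewrite /u sqr_sqrtr.
      apply: (@le_trans _ _ ((\sum_a u a * (`|c a| * u a)) ^+ 2)).
        rewrite -[leLHS]real_normK ?num_real// lerXn2r ?nnegrE//.
          by apply: sumr_ge0 => a _; rewrite !mulr_ge0 ?sqrtr_ge0.
        apply: le_trans (ler_norm_sum _ _ _) _; apply: ler_sum => a _.
        by rewrite normrM mulrCA -expr2 uu.
      apply: (le_trans (sqr_sum_le _ _ _)).
      rewrite le_eqVlt; apply/orP; left; apply/eqP; congr (_ * _).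
        by apply: eq_bigr => a _; rewrite uu.
      by apply: eq_bigr => a _; rewrite exprMn uu real_normK ?num_real.
    rewrite -[leRHS](_ : A * \sum_a c a ^+ 2 * `|w a y| = _).
      apply: ler_wpM2r; last exact: (frame_wsum fr).
      by apply: sumr_ge0 => a _; rewrite mulr_ge0 ?sqr_ge0.
    by rewrite mulr_sumr; apply: eq_bigr => a _; rewrite mulrA.
  have isum : rintegrable mu (fun y => \sum_a (A * c a ^+ 2) *
      (`|w a y| * cmod (fourier (f j) y) ^+ 2)).
    by apply: rintegrable_sum => a; exact: rintegrableZl.
  have ih2 : rintegrable mu (fun y => cmod (h y) ^+ 2).
    apply: (rintegrable_le _ isum) => [|y]; last by rewrite ger0_norm ?sqr_ge0.
    by apply/measurable_funX/measurable_cmod; exact: cintegrable_measurable ih.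
  have [i1 i2] := plancherel false ih ih2.
  under eq_fun do rewrite hE.
  split=> //.
  apply: (le_trans i2).
  have -> : \sum_a c a ^+ 2 * W j a = 2 * 16 ^+ n *
      \sum_a (A * c a ^+ 2) * \int[mu]_y (`|w a y| * cmod (fourier (f j) y) ^+ 2).
    by rewrite mulr_sumr; apply: eq_bigr => a _; rewrite /W; ring.
  rewrite ler_wpM2l ?(ltW K0)//.
  apply: (le_trans (le_Rintegral measurableT ih2 isum (fun y _ => hb y))).
  rewrite (Rintegral_sum _ (fun a => rintegrableZl (A * c a ^+ 2) (iW j a))).
  by apply: ler_sum => a _; rewrite (RintegralZl _ measurableT (iW j a)).
- move=> j a; rewrite /W !mulr_ge0 ?(ltW K0) ?(ltW A0)//.
  by apply: Rintegral_ge0 => y _; rewrite mulr_ge0 ?sqr_ge0.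
- move=> j; rewrite /W -!mulr_sumr -(Rintegral_sum _ (iW j)).
  rewrite -[leRHS](_ : 2 * 16 ^+ n * (A * (A * (2 * 16 ^+ n * v j ^+ 2))) = _); last by ring.
  rewrite ler_wpM2l ?(ltW K0)// ler_wpM2l ?(ltW A0)//.
  apply: (@le_trans _ _ (\int[mu]_y (A * cmod (fourier (f j) y) ^+ 2))).
    apply: (le_Rintegral measurableT); first exact: rintegrable_sum.
      exact: rintegrableZl (fourier_sqr j).1.
    by move=> y _; rewrite -mulr_suml ler_wpM2r ?sqr_ge0// (frame_wsum fr).
  rewrite (RintegralZl _ measurableT (fourier_sqr j).1) ler_wpM2l ?(ltW A0)//.
  apply: (le_trans (fourier_sqr j).2).
  by rewrite ler_wpM2l ?(ltW K0).
- by move=> j; rewrite exprn_gt0// !mulr_gt0.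
Qed.

End tensor.
End multiplier_tensor.

Section powers.
Variable R : realType.

(** Away from 0 the power is differentiable, hence continuous; the limit 0 is treated by hand. *)
Lemma powR_cvg (u : nat -> R) (x r : R) : 0 < r -> (forall k, 0 <= u k) ->
  u k @[k --> \oo] --> x -> u k `^ r @[k --> \oo] --> x `^ r.
Proof.
move=> r0 u0 ux.
have x0 : 0 <= x.
  rewrite -(cvg_lim (@Rhausdorff R) ux); apply: limr_ge; first exact: cvgP ux.
  exact: nearW.
move: x0; rewrite le_eqVlt => /predU1P[xE|x0].
  rewrite -xE powR0 ?gt_eqF//; rewrite -xE in ux.
  apply/cvgr0Pnorm_lt => e e0.
  have e1 : 0 < e `^ r^-1 by exact: powR_gt0.
  near=> k; rewrite ger0_norm ?powR_ge0//.
  have -> : e = (e `^ r^-1) `^ r.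
    by rewrite -powRrM mulVf ?powRr1 ?(ltW e0)// gt_eqF.
  apply: gt0_ltr_powR => //; rewrite ?nnegrE ?powR_ge0//.
  rewrite -[ltLHS](ger0_norm (u0 k)); near: k.
  by move/cvgr0Pnorm_lt : ux; exact.
apply: (@continuous_cvg _ _ _ _ _ _ (fun y => y `^ r)) ux.
apply: differentiable_continuous; apply/derivable1_diffP/derivable_powR.
by rewrite in_itv/= andbT.
Unshelve. all: by end_near. Qed.

Lemma powR_lt1 (b e : R) : 0 < e -> 0 <= b < 1 -> b `^ e < 1.
Proof.
move=> e0 /andP[b0 b1]; have <- : 1 `^ e = 1 :> R by rewrite powR1.
by apply: gt0_ltr_powR; rewrite ?nnegrE.
Qed.

End powers.

Section level_algebra.
Variables (R : realType) (m : nat).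

Lemma piece_algebra (X P V c d t : R) : 0 <= X -> 0 <= P -> 0 <= V -> 0 <= c ->
  0 <= d -> X `^ (2 / m%:R) = (c * d) `^ (2 / m%:R) * t ->
  m%:R * (2 * X ^+ 2 * (P * V) ^+ 2) `^ m%:R^-1 =
  m%:R * 2 `^ m%:R^-1 * (c * P) `^ (2 / m%:R) * (d * V) `^ (2 / m%:R) * t.
Proof.
move=> X0 P0 V0 c0 d0 XE.
have sqE (y : R) : 0 <= y -> (y ^+ 2) `^ m%:R^-1 = y `^ (2 / m%:R).
  by move=> y0; rewrite powRrM powR_mulrn.
have PV0 : 0 <= P * V by exact: mulr_ge0.
have X2 : 0 <= 2 * X ^+ 2 by rewrite mulr_ge0 ?sqr_ge0.
rewrite (powRM _ X2 (sqr_ge0 _)) (powRM _ (ler0n _ 2) (sqr_ge0 X)).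
rewrite (sqE _ X0) (sqE _ PV0) XE (powRM _ P0 V0) (powRM _ c0 d0).
rewrite (powRM _ c0 P0) (powRM _ d0 V0).
move: (2 `^ _) (c `^ _) (d `^ _) (P `^ _) (V `^ _) => *; ring.
Qed.

End level_algebra.

(** * Geometric summation over the dyadic levels *)

Section level.
Variables (R : realType) (p n M : nat) (q : R).
Hypotheses (p0 : (0 < p)%N) (M0 : (0 < M)%N).
Local Notation m := p.+1.
Local Notation mR := (p.+1%:R : R).
Local Notation mu := (lebesgue_rV n).
Local Notation nu := (lebesgue_mx m n).

Definition qcrit : R := 2 * mR / p%:R.
Local Notation tau := (q / qcrit).

Hypotheses (q1 : 1 < q) (qq0 : q < qcrit).
Hypothesis qM : mR * n%:R < M%:R * (qcrit - q).

Let qcrit_gt0 : 0 < qcrit. Proof. by rewrite (lt_trans _ qq0)// (lt_trans _ q1). Qed.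

(** The ratio of consecutive level masses: 2^(n m) from the number of cells in a unit of volume,
    against the gain 2^(-M) in each coefficient raised to the power qcrit - q. The hypothesis [qM]
    makes the exponent negative. *)
Definition level_decay : R := 2 `^ (n%:R * mR - M%:R * (qcrit - q)).

Lemma level_decay_lt1 : 0 < level_decay < 1.
Proof.
rewrite /level_decay powR_gt0//= -opprB powRN -powR_inv1 ?powR_ge0//.
rewrite -powRrM mulrC powRrM powR_inv1//.
by apply: powR_lt1; [rewrite subr_gt0 mulrC|rewrite invr_ge0 ler0n invf_lt1 ?ltr1n].
Qed.

Definition level_ratio : R := level_decay `^ (2 / mR / qcrit).

Lemma level_ratio_lt1 : 0 < level_ratio < 1.
Proof.
have /andP[t0 t1] := level_decay_lt1; rewrite /level_ratio powR_gt0//=.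
apply: powR_lt1; last by rewrite (ltW t0).
by apply: divr_gt0 => //; apply: divr_gt0; rewrite ltr0n.
Qed.

Local Notation c1 := (coef_const R m n M).
Local Notation c2 := (lq_const m n M q).

Definition level_const : R := (c1 `^ (qcrit - q) * c2) `^ (qcrit^-1).

Section bound.
Variables (D s : R).
Hypotheses (D0 : 0 < D) (s0 : 0 < s).

(** The bound on the coefficients to the power qcrit obtained from |b|^qcrit <= (sup |b|)^(qcrit -
    q) |b|^q: the first factor comes from [coef_le], the second from [coef_powR_sum]. *)
Definition level_mass (l : nat) : R :=
  (c1 * (D * (2 ^ l)%:R^-1 ^+ M)) `^ (qcrit - q) *
  (c2 * ((2 ^ l)%:R ^+ n) ^+ m * s `^ q).

Lemma level_massE l : level_mass l =
  c1 `^ (qcrit - q) * c2 * (D `^ (qcrit - q) * s `^ q) * level_decay ^+ l.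
Proof.
have c10 : 0 <= c1 by rewrite ltW// coef_const_gt0.
have b0 : 0 <= (2 ^ l)%:R^-1 ^+ M :> R by rewrite exprn_ge0// invr_ge0.
rewrite /level_mass powRM ?mulr_ge0 ?(ltW D0)// powRM ?(ltW D0)//.
have -> : level_decay ^+ l = ((2 ^ l)%:R^-1 ^+ M) `^ (qcrit - q) * ((2 ^ l)%:R ^+ n) ^+ m :> R.
  set a : R := (2 ^ l)%:R; have a0 : 0 < a by rewrite ltr0n expn_gt0.
  have aE : a = 2 `^ l%:R by rewrite powR_mulrn// /a natrX.
  have -> : level_decay ^+ l = a `^ (n%:R * mR - M%:R * (qcrit - q)).
    by rewrite -[LHS]powR_mulrn ?powR_ge0// /level_decay powRAC -aE.
  rewrite [LHS]powRB; last by rewrite (gt_eqF a0) implybT.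
  rewrite mulrC -powRN; congr (_ * _).
    by rewrite exprVn -powR_invn ?(ltW a0)// -powRrM mulNr.
  by rewrite powRrM !powR_mulrn ?exprn_ge0 ?(ltW a0).
by move: (_ `^ _) (_ `^ _) (_ `^ _) (_ `^ _) => *; ring.
Qed.

Lemma level_mass_powR l :
  (level_mass l `^ qcrit^-1) `^ (2 / mR) =
  (level_const * (D `^ (1 - tau) * s `^ tau)) `^ (2 / mR) * level_ratio ^+ l.
Proof.
have c10 : 0 < c1 by exact: coef_const_gt0.
have c20 : 0 < c2 by exact: lq_const_gt0.
have t0 : 0 <= level_decay by have /andP[/ltW] := level_decay_lt1.
have E1 : (D `^ (qcrit - q)) `^ qcrit^-1 = D `^ (1 - tau).
  by rewrite -powRrM; congr powR; field; rewrite gt_eqF.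
have E2 : (s `^ q) `^ qcrit^-1 = s `^ tau by rewrite -powRrM.
rewrite level_massE /level_const.
have k0 : 0 <= c1 `^ (qcrit - q) * c2 by rewrite mulr_ge0 ?powR_ge0 ?(ltW c20).
move: k0; move: (c1 `^ (qcrit - q) * c2) => k k0.
have ds : 0 <= D `^ (qcrit - q) * s `^ q by rewrite mulr_ge0 ?powR_ge0.
rewrite powRM ?exprn_ge0 ?(mulr_ge0 k0)//.
rewrite (powRM _ k0 ds) (powRM _ (powR_ge0 D _) (powR_ge0 s _)) E1 E2.
rewrite powRM ?powR_ge0 ?mulr_ge0 ?powR_ge0//; congr (_ * _).
rewrite -[level_decay ^+ l](powR_mulrn _ t0) -[RHS](powR_mulrn _ (powR_ge0 _ _))
  /level_ratio -!powRrM.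
by congr (_ `^ (_ * _)); ring.
Qed.

End bound.
Section family.
Variables (f : 'I_m -> 'rV[R]_n -> R[i]) (v : 'I_m -> R).
Hypothesis fS : forall j, schwartz (f j).
Hypothesis v0 : forall j, 0 < v j.
Hypothesis fv : forall j, \int[mu]_x cmod (f j x) ^+ 2 <= v j ^+ 2.
Variables (sigma : 'M[R]_(m, n) -> R) (D s : R).
Hypotheses (D0 : 0 < D) (s0 : 0 < s).
Hypothesis sC : Ck_real M sigma.
Hypothesis sD : forall x, `|sigma x| <= D.
Hypothesis dD : forall i j x, `|iter M (partial i j) sigma x| <= D.
Hypothesis sq : rintegrable nu (fun x => `|sigma x| `^ q).
Hypothesis sqs : \int[nu]_x `|sigma x| `^ q <= s `^ q.

Definition plancherel_const : R := 2 * 16 ^+ n * (node_poly_norm R M + 1) ^+ n.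

Definition piece_const : R :=
  mR * 2 `^ mR^-1 * (level_const * plancherel_const ^+ m) `^ (2 / mR).

Definition size_factor : R := D `^ (1 - tau) * s `^ tau * \prod_j v j.

Variable L : nat.
Hypothesis L0 : (0 < L)%N.

Local Notation cell_coef l := (@cell_coef R m n M L l).
Local Notation cell_proj := (@cell_proj R m n M L).
Local Notation cell_resid := (@cell_resid R m n M L sigma).

Lemma level_coef_sum l : \sum_k `|cell_coef l (cell_resid l) k| `^ qcrit <= level_mass D s l.
Proof.
apply: (@le_trans _ _ (\sum_k (c1 * (D * (2 ^ l)%:R^-1 ^+ M)) `^ (qcrit - q) *
    `|cell_coef l (cell_resid l) k| `^ q)).
  apply: ler_sum => k _.
  have -> : `|cell_coef l (cell_resid l) k| `^ qcrit =
      `|cell_coef l (cell_resid l) k| `^ (qcrit - q) * `|cell_coef l (cell_resid l) k| `^ q.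
    by rewrite -powRD ?subrK// (gt_eqF qcrit_gt0).
  rewrite ler_wpM2r ?powR_ge0//; apply: ge0_ler_powR; rewrite ?nnegrE ?subr_ge0 ?(ltW qq0)//.
    by rewrite !mulr_ge0 ?(ltW D0) ?exprn_ge0 ?invr_ge0// ltW// coef_const_gt0.
  exact: (coef_le M0 sC sD dD).
rewrite -mulr_sumr /level_mass ler_wpM2l ?powR_ge0//.
apply: (le_trans (coef_powR_sum L M0 sC sD q1 sq l)).
apply: ler_wpM2l => //; rewrite mulr_ge0 ?exprn_ge0// ltW//; exact: lq_const_gt0.
Qed.

Lemma piece_bound l :
  (\int[mu]_x (cmod (mopR f (cell_proj l (cell_resid l)) x) `^ (2 / mR))%:E <=
   (piece_const * size_factor `^ (2 / mR) * level_ratio ^+ l)%:E)%E.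
Proof.
have z : (0 < 2 * L * 2 ^ l)%N by rewrite !muln_gt0 L0 expn_gt0.
(* Any index would do; one exists because the box has positive size. *)
pose a0 : {ffun 'I_n -> 'I_(2 * L * 2 ^ l) * 'I_M.+1} := [ffun=> (Ordinal z, ord0)].
have N0 : (0 < 2 ^ l)%N by rewrite expn_gt0.
have lm0 : 0 < level_mass D s l.
  apply: mulr_gt0.
    rewrite powR_gt0// mulr_gt0 ?coef_const_gt0// mulr_gt0// exprn_gt0// invr_gt0 ltr0n.
  apply: mulr_gt0; last exact: powR_gt0.
  apply: mulr_gt0; first exact: lq_const_gt0.
  by rewrite !exprn_gt0// ltr0n.
have := @mopR_tensor_bound R p n p0 f fS _ _ _ _ _ _ (@frame_rV R n M L M0 (2 ^ l) N0)
  v v0 fv (cell_coef l (cell_resid l)) (level_mass D s l `^ qcrit^-1) a0 (powR_gt0 _ lm0).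
rewrite -/qcrit -[in X in _ <= X -> _]powRrM mulVf ?(gt_eqF qcrit_gt0)// powRr1 ?(ltW lm0)//.
move=> /(_ (level_coef_sum l)) /le_trans; apply.
rewrite lee_fin -/plancherel_const.
have pc0 : 0 <= plancherel_const.
  by rewrite !mulr_ge0 ?exprn_ge0// addr_ge0// node_poly_norm_ge0.
have lc0 : 0 <= level_const by exact: powR_ge0.
have pv0 : 0 <= \prod_j v j by apply: prodr_ge0 => j _; exact/ltW.
have ds0 : 0 <= D `^ (1 - tau) * s `^ tau by rewrite mulr_ge0 ?powR_ge0.
have -> : \prod_j (plancherel_const * v j) ^+ 2 =
    (plancherel_const ^+ m * \prod_j v j) ^+ 2.
  by rewrite prodrXl big_split/= prodr_const card_ord.
have X0 : 0 <= level_mass D s l `^ qcrit^-1 by exact: powR_ge0.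
rewrite /piece_const /size_factor.
have XE : (level_mass D s l `^ qcrit^-1) `^ (2 / mR) =
    (level_const * (D `^ (1 - tau) * s `^ tau)) `^ (2 / mR) * level_ratio ^+ l.
  exact: level_mass_powR.
rewrite (piece_algebra X0 (exprn_ge0 _ pc0) pv0 lc0 ds0 XE).
exact: lexx.
Qed.

Lemma cmeasurable_piece l : cmeasurable (mopR f (cell_proj l (cell_resid l))).
Proof.
have N0 : (0 < 2 ^ l)%N by rewrite expn_gt0.
exact: (cmeasurable_mopR_tensor fS (@frame_rV R n M L M0 (2 ^ l) N0)).
Qed.

Let mproj l : measurable_fun setT (cell_proj l (cell_resid l)).
Proof.
have N0 : (0 < 2 ^ l)%N by rewrite expn_gt0.
exact: (measurable_fproj (@frame_mx R m n M L M0 (2 ^ l) N0)).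
Qed.

Lemma mopR_pieces l x :
  mopR f (cell_proj l sigma) x = \sum_(i < l.+1) mopR f (cell_proj i (cell_resid i)) x.
Proof.
rewrite -(mopR_sum fS (B := ((node_poly_norm R M + 1) ^+ n) ^+ m * resid_bound m n M D)).
- by congr mopR; apply/funext => xi; exact: (proj_resid L M0 sC sD).
- by move=> i; exact: mproj.
- move=> i xi; have N0 : (0 < 2 ^ i)%N by rewrite expn_gt0.
  apply: (fproj_bound (@frame_mx R m n M L M0 (2 ^ i) N0)).
    exact: (measurable_resid L M0 sC).
  exact: (resid_le L M0 sC sD).
Qed.

Lemma cmeasurable_mopR_proj l : cmeasurable (mopR f (cell_proj l sigma)).
Proof.
rewrite (_ : mopR f _ = fun x => \sum_(i < l.+1) mopR f (cell_proj i (cell_resid i)) x).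
  by apply: cmeasurable_sum => i; exact: cmeasurable_piece.
by apply/funext => x; rewrite mopR_pieces.
Qed.

Definition sum_const : R := piece_const / (1 - level_ratio).

(** Subadditivity of the power 2/m reduces the claim to the pieces, whose bounds form a geometric
    series. The result depends neither on the level [l] nor on the box size [L], so both may tend to
    infinity. *)
Lemma mopR_proj_bound l :
  (\int[mu]_x (cmod (mopR f (cell_proj l sigma) x) `^ (2 / mR))%:E <=
   (sum_const * size_factor `^ (2 / mR))%:E)%E.
Proof.
have /andP[r0 r1] := level_ratio_lt1.
have mi i : measurable_fun setT (fun x => cmod (mopR f (cell_proj i (cell_resid i)) x) `^ (2 / mR)).
  apply: (measurableT_comp (measurable_powR _)).
  exact/measurable_cmod/cmeasurable_piece.
apply: (@le_trans _ _ (\int[mu]_x (\sum_(i < l.+1)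
    (cmod (mopR f (cell_proj i (cell_resid i)) x) `^ (2 / mR))%:E))%E).
  apply: ge0_le_integral => //.
  - by move=> x _; rewrite lee_fin powR_ge0.
  - apply/measurable_EFinP; apply: (measurableT_comp (measurable_powR _)).
    exact/measurable_cmod/cmeasurable_mopR_proj.
  - by apply: emeasurable_sum => i; exact/measurable_EFinP.
  - move=> x _; rewrite sumEFin lee_fin mopR_pieces.
    apply: (@le_trans _ _ ((\sum_(i < l.+1)
        cmod (mopR f (cell_proj i (cell_resid i)) x)) `^ (2 / mR))).
      apply: ge0_ler_powR; rewrite ?nnegrE ?divr_ge0 ?cmod_ge0//; last exact: cmod_sum.
      by apply: sumr_ge0 => i _; exact: cmod_ge0.
    apply: powR_sum_le => [|i]; last exact: cmod_ge0.
    by rewrite divr_gt0//= ler_pdivrMr// mul1r ler_nat ltnS.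
rewrite ge0_integral_sum//; last by move=> i x _; rewrite lee_fin powR_ge0.
  2: by move=> i; exact/measurable_EFinP.
apply: (@le_trans _ _ (\sum_(i < l.+1)
  (piece_const * size_factor `^ (2 / mR) * level_ratio ^+ i)%:E)%E).
  by apply: lee_sum => i _; exact: piece_bound.
rewrite sumEFin lee_fin -mulr_sumr /sum_const [leRHS]mulrAC; apply: ler_wpM2l.
  by rewrite !mulr_ge0 ?powR_ge0.
rewrite -[leRHS]mul1r ler_pdivlMr ?subr_gt0// mulrC -opprB mulNr -subrX1 opprB.
by rewrite gerBl exprn_ge0// ltW.
Qed.

End family.
End level.

Section complex_limits.
Variable R : realType.

Lemma cmodE (z : R[i]) : cmod z = Num.sqrt (complex.Re z ^+ 2 + complex.Im z ^+ 2).
Proof. by rewrite -cmod_sqr sqrtr_sqr ger0_norm ?cmod_ge0. Qed.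

Lemma cmod_cvg (u : nat -> R[i]) (z : R[i]) :
  complex.Re (u k) @[k --> \oo] --> complex.Re z ->
  complex.Im (u k) @[k --> \oo] --> complex.Im z ->
  cmod (u k) @[k --> \oo] --> cmod z.
Proof.
move=> h1 h2; rewrite cmodE; under eq_fun do rewrite cmodE.
apply: (@continuous_cvg _ _ _ _ _ _ Num.sqrt); first exact: sqrt_continuous.
by apply: cvgD; apply: cvgM.
Qed.

Lemma cmod_i (z : R[i]) : cmod ((0 +i* 1) * z) = cmod z.
Proof. by rewrite cmodM [cmod (_ +i* _)]cmodE/= expr0n/= add0r expr1n sqrtr1 mul1r. Qed.

Lemma cReI (z : R[i]) : complex.Re ((0 +i* 1) * z) = - complex.Im z.
Proof. by rewrite cReM/= mul0r sub0r mul1r. Qed.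

Lemma cImI (z : R[i]) : complex.Im ((0 +i* 1) * z) = complex.Re z.
Proof. by rewrite cImM/= mul0r add0r mul1r. Qed.

End complex_limits.

(** * Passage to the full symbol, real and complex *)

Section limit.
Variables (R : realType) (p n M : nat) (q : R).
Hypotheses (p0 : (0 < p)%N) (M0 : (0 < M)%N).
Local Notation m := p.+1.
Local Notation mR := (p.+1%:R : R).
Local Notation mu := (lebesgue_rV n).
Local Notation nu := (lebesgue_mx m n).
Local Notation qcrit := (qcrit R p).
Hypotheses (q1 : 1 < q) (qq0 : q < qcrit).
Hypothesis qM : mR * n%:R < M%:R * (qcrit - q).
Variables (f : 'I_m -> 'rV[R]_n -> R[i]) (v : 'I_m -> R).
Hypothesis fS : forall j, schwartz (f j).
Hypothesis v0 : forall j, 0 < v j.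
Hypothesis fv : forall j, \int[mu]_x cmod (f j x) ^+ 2 <= v j ^+ 2.
Variables (D s : R).
Hypotheses (D0 : 0 < D) (s0 : 0 < s).

(** Stated for a real symbol with bounds [D] and [s], so that it can be applied to the real and
    imaginary parts alike, each of them dominated by the complex symbol. *)
Definition admissible (sigma : 'M[R]_(m, n) -> R) :=
  [/\ Ck_real M sigma, forall x, `|sigma x| <= D,
      forall i j x, `|iter M (partial i j) sigma x| <= D,
      rintegrable nu (fun x => `|sigma x| `^ q) &
      \int[nu]_x `|sigma x| `^ q <= s `^ q].

Section real_symbol.
Variable sigma : 'M[R]_(m, n) -> R.
Hypothesis sA : admissible sigma.

(** Box and level grow together along a single parameter; the half-width is [k.+1] because the box
    has to be nonempty. *)
Let approx (k : nat) := @cell_proj R m n M k.+1 k sigma.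

Let Abound : R := ((node_poly_norm R M + 1) ^+ n) ^+ m * D.

Let approx_bound k x : `|approx k x| <= Abound.
Proof.
have [sC sD dD _ _] := sA; have N0 : (0 < 2 ^ k)%N by rewrite expn_gt0.
apply: (fproj_bound (@frame_mx R m n M k.+1 M0 (2 ^ k) N0)) => //.
by apply: continuous_mx_measurable; exact: Ck_real_continuous sC.
Qed.

Let measurable_approx k : measurable_fun setT (approx k).
Proof.
have N0 : (0 < 2 ^ k)%N by rewrite expn_gt0.
exact: (measurable_fproj (@frame_mx R m n M k.+1 M0 (2 ^ k) N0)).
Qed.

(** Every point ends up in the box, where the error is at most a constant times (2^k)^-M; as M is at
    least 1, this is bounded by a multiple of 1/(k+1). *)
Lemma cell_proj_cvg x : approx k x @[k --> \oo] --> sigma x.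
Proof.
have [sC sD dD _ _] := sA.
apply/cvgrPdist_le => e e0.
pose c := proj_error R m n M * D.
have c0 : 0 <= c by rewrite mulr_ge0 ?proj_error_ge0 ?(ltW D0).
pose b := \sum_i \sum_j `|x i j|.
near=> k.
have xk : inbox k.+1 x.
  move=> i j; have : `|x i j| < k.+1%:R.
    apply: (@le_lt_trans _ _ b).
      rewrite /b (bigD1 i)//= (bigD1 j)//= -addrA lerDl addr_ge0 ?sumr_ge0//.
      by move=> *; exact: sumr_ge0.
    apply: (lt_le_trans (archi_boundP (_ : 0 <= b))).
      by apply: sumr_ge0 => *; exact: sumr_ge0.
    by rewrite ler_nat ltnW// ltnS; near: k; exact: nbhs_infty_ge.
  by rewrite ltr_norml => /andP[/ltW -> ->].
rewrite distrC; apply: (le_trans (proj_approx M0 sC sD dD k xk)).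
rewrite mulrA -/c.
apply: (@le_trans _ _ (c * k.+1%:R^-1)).
  rewrite ler_wpM2l//; apply: (@le_trans _ _ (2 ^ k)%:R^-1).
    rewrite -[leRHS]expr1 ler_wiXn2l ?invr_ge0//.
    by rewrite invf_le1 ?ler1n ?ltr0n ?expn_gt0.
  by rewrite lef_pV2 ?posrE ?ltr0n ?expn_gt0// ler_nat ltn_expl.
rewrite ler_pdivrMr ?ltr0n// mulrC -ler_pdivrMr//.
apply/ltW/(lt_le_trans (archi_boundP (divr_ge0 c0 (ltW e0)))).
by rewrite ler_nat ltnW// ltnS; near: k; exact: nbhs_infty_ge.
Unshelve. all: by end_near. Qed.

(** Dominated convergence: the approximants are bounded uniformly in [k], and the remaining factor,
    a product of Fourier transforms of Schwartz functions with a phase, is integrable. *)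
Lemma mopR_cvg x :
  complex.Re (mopR f (approx k) x) @[k --> \oo] --> complex.Re (mopR f sigma x) /\
  complex.Im (mopR f (approx k) x) @[k --> \oo] --> complex.Im (mopR f sigma x).
Proof.
have [iR iI] := fourier_prod_phase_integrable fS x.
pose H xi := fourier_prod f xi * phase x xi.
have cv (h : 'M[R]_(m, n) -> R) : rintegrable nu h ->
    \int[nu]_xi (approx k xi * h xi) @[k --> \oo] --> \int[nu]_xi (sigma xi * h xi).
  move=> ih.
  apply: (Rintegral_cvg_dominated (g := fun xi => Abound * `|h xi|) _ _ _ _).2.
  - move=> k; apply: measurable_funM; first exact: measurable_approx.
    exact: rintegrable_measurable ih.
  - exact/rintegrableZl/rintegrable_norm.
  - by move=> k xi; rewrite normrM ler_wpM2r.
  - by move=> xi; apply: cvgM; [exact: cell_proj_cvg|exact: cvg_cst].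
have rE s' : complex.Re (mopR f s' x) = \int[nu]_xi (s' xi * complex.Re (H xi)).
  rewrite mopRE /=; apply: eq_Rintegral => xi _.
  by rewrite cReM/= mul0r subr0.
have iE s' : complex.Im (mopR f s' x) = \int[nu]_xi (s' xi * complex.Im (H xi)).
  rewrite mopRE /=; apply: eq_Rintegral => xi _.
  by rewrite cImM/= mul0r addr0.
rewrite rE iE; split.
  by under eq_fun do rewrite rE; exact: cv.
by under eq_fun do rewrite iE; exact: cv.
Qed.

End real_symbol.

Variable sigma : 'M[R]_(m, n) -> R[i].
Hypothesis sRe : admissible (fun x => complex.Re (sigma x)).
Hypothesis sIm : admissible (fun x => complex.Im (sigma x)).

Lemma multiplier_op_split x : multiplier_op sigma f x =
  mopR f (fun xi => complex.Re (sigma xi)) x +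
  (0 +i* 1) * mopR f (fun xi => complex.Im (sigma xi)) x.
Proof.
have [C1 D1 _ _ _] := sRe; have [C2 D2 _ _ _] := sIm.
have ih := fourier_prod_phase_integrable fS x.
have m1 : measurable_fun setT (fun xi => complex.Re (sigma xi)).
  by apply: continuous_mx_measurable; exact: Ck_real_continuous C1.
have m2 : measurable_fun setT (fun xi => complex.Im (sigma xi)).
  by apply: continuous_mx_measurable; exact: Ck_real_continuous C2.
have i1 := cintegrable_bounded_mul ih m1 D1.
have i2 := cintegrable_bounded_mul ih m2 D2.
rewrite !mopRE -(cintegralZl _ i2) -(cintegralD i1 (cintegrableZl _ i2)).
rewrite /multiplier_op; congr cintegral; apply/funext => xi.
rewrite -/(fourier_prod f xi) -/(phase x xi) -mulrA [X in _ = _ + X]mulrA -mulrDl.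
congr (_ * _).
by rewrite [LHS]complexE.
Qed.

(** The factor 2 accounts for the real and imaginary parts of the symbol, combined by subadditivity
    of the power 2/m before the limit is taken. *)
Theorem multiplier_op_bound :
  (\int[mu]_x (cmod (multiplier_op sigma f x) `^ (2 / mR))%:E <=
   (2 * (sum_const p n M q * size_factor q v D s `^ (2 / mR)))%:E)%E.
Proof.
have r0 : 0 < 2 / mR by rewrite divr_gt0.
pose P (s' : 'M[R]_(m, n) -> R) (k : nat) := @cell_proj R m n M k.+1 k s'.
pose s1 xi := complex.Re (sigma xi); pose s2 xi := complex.Im (sigma xi).
pose u k x := mopR f (P s1 k) x + (0 +i* 1) * mopR f (P s2 k) x.
have cm s' k : admissible s' -> cmeasurable (mopR f (P s' k)).
  by move=> [sC sD dD sq sqs]; exact: (cmeasurable_mopR_proj M0 fS sC sD).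
have cm1 k := cm s1 k sRe; have cm2 k := cm s2 k sIm.
have mi s' k : cmeasurable (mopR f (P s' k)) ->
    measurable_fun setT (fun x => cmod (mopR f (P s' k) x) `^ (2 / mR)).
  move=> cs; apply: (measurableT_comp (measurable_powR _)); exact: measurable_cmod.
have mi1 k := mi s1 k (cm1 k); have mi2 k := mi s2 k (cm2 k).
have cmu k : cmeasurable (u k).
  by apply: cmeasurableD => //; apply: cmeasurableM => //; exact: cmeasurable_cst.
have mu_ k : measurable_fun setT (fun x => cmod (u k x) `^ (2 / mR)).
  apply: (measurableT_comp (measurable_powR _)); exact: measurable_cmod.
apply: (fatou_le (f_ := fun k x => cmod (u k x) `^ (2 / mR))) => //.
- by move=> k x; exact: powR_ge0.
- move=> x; apply: powR_cvg => // [k|]; first exact: cmod_ge0.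
  have [c1 c2] := mopR_cvg sRe x; have [c3 c4] := mopR_cvg sIm x.
  rewrite multiplier_op_split /u; apply: cmod_cvg.
    rewrite cReD cReI; under eq_fun do rewrite cReD cReI.
    by apply: cvgB.
  rewrite cImD cImI; under eq_fun do rewrite cImD cImI.
  by apply: cvgD.
move=> k.
apply: (@le_trans _ _ (\int[mu]_x ((cmod (mopR f (P s1 k) x) `^ (2 / mR))%:E +
    (cmod (mopR f (P s2 k) x) `^ (2 / mR))%:E))%E).
  apply: ge0_le_integral => //.
  - by move=> x _; rewrite lee_fin powR_ge0.
  - exact/measurable_EFinP.
  - by apply: emeasurable_funD; exact/measurable_EFinP.
  - move=> x _; rewrite -EFinD lee_fin.
    apply: (@le_trans _ _ ((cmod (mopR f (P s1 k) x) + cmod (mopR f (P s2 k) x)) `^ (2 / mR))).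
      apply: ge0_ler_powR; rewrite ?nnegrE ?addr_ge0 ?cmod_ge0 ?(ltW r0)//.
      by rewrite -[X in _ <= _ + X]cmod_i; exact: cmodD.
    apply: powR_subadditive; rewrite ?cmod_ge0//.
    by rewrite r0/= ler_pdivrMr ?ltr0n// mul1r ler_nat ltnS.
rewrite ge0_integralD//; last 4 first.
- by move=> x _; rewrite lee_fin powR_ge0.
- exact/measurable_EFinP.
- by move=> x _; rewrite lee_fin powR_ge0.
- exact/measurable_EFinP.
set Y := sum_const _ _ _ _ * _; have -> : 2 * Y = Y + Y by ring.
rewrite EFinD; apply: leeD.
  by have [sC sD dD sq sqs] := sRe; exact: mopR_proj_bound.
by have [sC sD dD sq sqs] := sIm; exact: mopR_proj_bound.
Qed.

End limit.

(** * Norms and the main estimate *)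

Section essential_bound.
Variables (R : realType) (m n : nat).
Local Notation nu := (lebesgue_mx m n).
Local Notation leb := (@lebesgue_measure R).

(** The closed cube of half side e/2 lies in the ball; the integral of its indicator, a product of
    one-dimensional indicators, is a product of factors [e], and it would be 0 if the ball were
    null. *)
Lemma ball_not_null (x : 'M[R]_(m, n)) (e : R) : 0 < e ->
  ~ (\forall y \ae nu, ~ ball x e y).
Proof.
move=> e0 xe.
pose ind (i : 'I_m) (j : 'I_n) : R -> R :=
  (fun _ : R => 1 : R) \_ `[x i j - e / 2, x i j + e / 2].
have e20 : 0 < e / 2 by rewrite divr_gt0.
have c1 : continuous (fun _ : R => 1 : R) by move=> s; exact: cst_continuous.
have iind i j : rintegrable leb (ind i j) by exact: rintegrable_itv.
have indE i j : \int[leb]_s ind i j s = e.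
  rewrite (Rintegral_FTC_patch (F := id))//; first by field.
  by lra.
pose b (y : 'M[R]_(m, n)) := \prod_i \prod_j ind i j (row i y 0 j).
have iv i := prod_coord_integral (iind i).
have [ib intb] := prod_row_integral (fun i => (iv i).1).
have b_gt0 : 0 < \int[nu]_y b y.
  rewrite intb; apply: prodr_gt0 => i _; rewrite (iv i).2.
  by apply: prodr_gt0 => j _; rewrite indE.
have b_ball y : ~ ball x e y -> b y = 0.
  move=> nby; apply/eqP; apply: contra_notT nby => by0; split=> // i j.
  move: by0 => /prodf_neq0/(_ i isT)/prodf_neq0/(_ j isT).
  rewrite mxE /ind patchE; case: ifPn => [|_]; last by rewrite eqxx.
  rewrite inE/= in_itv/= => /andP[y0 y1] _.
  by rewrite /ball/= distrC ltr_norml; apply/andP; split; lra.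
have : \int[nu]_y b y = 0.
  rewrite /Rintegral (ae_eq_integral (cst 0%E))//; first by rewrite integral0.
  - by apply/measurable_EFinP; exact: rintegrable_measurable ib.
  - by apply: filterS xe => y /b_ball by0 _ /=; rewrite by0.
by move/eqP; rewrite (gt_eqF b_gt0).
Qed.

(** The norm of exponent +oo is the essential supremum provided that the whole space has positive
    measure; otherwise it is 0 by convention. *)
Lemma lebesgue_mx_gt0 : (0 < nu [set: 'M[R]_(m, n)])%E.
Proof.
rewrite lt0e measure_ge0 andbT; apply/eqP => nu0.
apply: (@ball_not_null 0 1 ltr01); exists setT; split => //.
Qed.

(** If the modulus exceeded [c] at a point, by continuity it would do so on a ball, and a ball is
    not null. This turns the essential bounds on the derivatives into pointwise ones. *)
Lemma Linfty_bound (g : 'M[R]_(m, n) -> R[i]) (c : R) :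
  continuous (fun x => complex.Re (g x)) -> continuous (fun x => complex.Im (g x)) ->
  (cLnorm nu +oo g <= c%:E)%E -> forall x, cmod (g x) <= c.
Proof.
move=> cR cI; rewrite /cLnorm unlock /= lebesgue_mx_gt0 => /ess_supP gc x.
rewrite leNgt; apply/negP => cx.
have cg : continuous (fun x => cmod (g x)).
  have -> : (fun x => cmod (g x)) =
      fun x => Num.sqrt (complex.Re (g x) * complex.Re (g x) +
        complex.Im (g x) * complex.Im (g x)).
    by apply/funext => y; rewrite cmodE.
  move=> y; apply: (@continuous_comp _ _ _
    (fun x => complex.Re (g x) * complex.Re (g x) + complex.Im (g x) * complex.Im (g x))
    (@Num.sqrt R)).
    exact: (cvgD (cvgM (cR y) (cR y)) (cvgM (cI y) (cI y))).
  exact: sqrt_continuous.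
have : \forall y \near x, c < cmod (g y) by exact: cvgr_gt (cg x) _ cx.
move=> /nbhs_ballP[e /= e0 xe]; apply: (ball_not_null (x := x) e0).
apply: filterS gc => y /= gy /xe /=.
by move: gy; rewrite lee_fin ger0_norm ?cmod_ge0// ltNge => ->.
Qed.

End essential_bound.

Section norms.
Context d (T : measurableType d) (R : realType).
Variable mu : {measure set T -> \bar R}.

Lemma cLnormE (r : R) (g : T -> R[i]) : 0 < r ->
  cLnorm mu r%:E g = poweR (\int[mu]_x (cmod (g x) `^ r)%:E) r^-1.
Proof.
move=> r0; rewrite /cLnorm unlock; congr poweR; apply: eq_integral => x _ /=.
by rewrite ger0_norm ?cmod_ge0.
Qed.

Lemma cLnorm_EFin (r : R) (g : T -> R[i]) : 0 < r ->
  rintegrable mu (fun x => cmod (g x) `^ r) ->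
  cLnorm mu r%:E g = ((\int[mu]_x cmod (g x) `^ r) `^ r^-1)%:E.
Proof. by move=> r0 ig; rewrite cLnormE// Rintegral_EFin. Qed.

Lemma cLnorm_fin (r : R) (g : T -> R[i]) : 0 < r -> cmeasurable g ->
  (cLnorm mu r%:E g < +oo)%E -> rintegrable mu (fun x => cmod (g x) `^ r).
Proof.
move=> r0 mg; rewrite cLnormE// => goo.
apply: (ge0_rintegrable _ _ _ (lexx _)).
- by apply: (measurableT_comp (measurable_powR r)); exact: measurable_cmod.
- by move=> x; exact: powR_ge0.
- by apply: lty_poweRy goo; rewrite invr_eq0 gt_eqF.
Qed.

Lemma cLnorm_le (r c : R) (g : T -> R[i]) : 0 < r -> 0 <= c ->
  (\int[mu]_x (cmod (g x) `^ r)%:E <= (c `^ r)%:E)%E -> (cLnorm mu r%:E g <= c%:E)%E.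
Proof.
move=> r0 c0 gc; rewrite cLnormE//.
have : (0 <= \int[mu]_x (cmod (g x) `^ r)%:E)%E.
  by apply: integral_ge0 => x _; rewrite lee_fin powR_ge0.
move: gc; case: (\int[mu]_x _)%E => [y| |]//; rewrite !lee_fin => yc y0.
have -> : c = (c `^ r) `^ r^-1 by rewrite -powRrM divff ?gt_eqF// powRr1.
apply: ge0_ler_powR => //; rewrite ?nnegrE ?powR_ge0 ?invr_ge0 ?(ltW r0)//.
Qed.

End norms.

Lemma ereal_le_cvg (R : realType) (x : \bar R) (a : nat -> R) (l : R) :
  (0 <= x)%E -> (forall k, (x <= (a k)%:E)%E) -> a k @[k --> \oo] --> l ->
  (x <= l%:E)%E.
Proof.
move=> x0 xa al; case: x x0 xa => [y|/= _ /(_ 0%N)|]//= _ ya.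
rewrite lee_fin -(cvg_lim (@Rhausdorff R) al); apply: limr_ge; first exact: cvgP al.
by apply: nearW => k; have := ya k; rewrite lee_fin.
Qed.

Lemma cvg_add_inv (R : realType) (x : R) : x + k.+1%:R^-1 @[k --> \oo] --> x.
Proof.
by rewrite -[X in _ --> X]addr0; apply: cvgD; [exact: cvg_cst|exact: cvg_harmonic].
Qed.

Lemma sum_const_ge0 (R : realType) (p n M : nat) (q : R) : (0 < p)%N ->
  1 < q -> q < qcrit R p -> p.+1%:R * n%:R < M%:R * (qcrit R p - q) ->
  0 <= sum_const p n M q.
Proof.
move=> p0 q1 qq0 qM; have /andP[r0 r1] := level_ratio_lt1 q1 qq0 qM.
by rewrite divr_ge0 ?subr_ge0 ?(ltW r1)// !mulr_ge0 ?powR_ge0.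
Qed.

Theorem theorem1p1 (R : realType) (n m : nat) (q : R) (M : nat) :
  (1 <= n)%N -> (2 <= m)%N ->
  1 < q -> q < 2 * m%:R / (m%:R - 1) ->
  (0 < M)%N ->
  m%:R * (m%:R - 1) * n%:R / (2 * m%:R - (m%:R - 1) * q) < M%:R ->
  exists C : R, 0 < C /\
  forall (sigma : 'M[R]_(m, n) -> R[i]) (D0 : R),
    in_Lp (lebesgue_mx m n) q%:E sigma ->
    Ck M sigma ->
    (forall a : 'M[nat]_(m, n), (mdeg a <= M)%N ->
      (cLnorm (lebesgue_mx m n) +oo (mpartial a sigma) <= D0%:E)%E) ->
  forall f : 'I_m -> 'rV[R]_n -> R[i],
    (forall j, schwartz (f j)) ->
    let t := (m%:R - 1) * q / (2 * m%:R) in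
    (cLnorm (lebesgue_rV n) (2 / m%:R)%:E (multiplier_op sigma f) <=
     C%:E * (D0 `^ (1 - t))%:E *
     poweR (cLnorm (lebesgue_mx m n) q%:E sigma) t *
     \prod_(j < m) cLnorm (lebesgue_rV n) 2%:E (f j))%E.
Proof.
case: n m => [//|n'] [|p]// _; set n := n'.+1; rewrite ltnS => p0 q1 + M0.
have pR0 : 0 < p%:R :> R by rewrite ltr0n.
have -> : p.+1%:R - 1 = p%:R :> R by rewrite mulrSr addrK.
rewrite -/(qcrit R p) => qq0 nM.
have m0 : 0 < p.+1%:R :> R by rewrite ltr0n.
have q_gt0 : 0 < q := lt_trans ltr01 q1.
have q00 : 0 < qcrit R p := lt_trans q_gt0 qq0.
have den0 : 0 < 2 * p.+1%:R - p%:R * q.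
  by move: qq0; rewrite /qcrit ltr_pdivlMr// subr_gt0 mulrC.
(* The assumed lower bound on [M], with its denominator cleared and the common factor m - 1
   removed. *)
have qM : p.+1%:R * n%:R < M%:R * (qcrit R p - q).
  move: nM; rewrite ltr_pdivrMr// => nM.
  rewrite -(ltr_pM2l pR0) mulrCA mulrA (lt_le_trans nM)// mulrCA ler_wpM2l//.
  by rewrite /qcrit mulrBr mulrCA divff ?gt_eqF// mulr1.
have tE : p%:R * q / (2 * p.+1%:R) = q / qcrit R p.
  by rewrite /qcrit; field; rewrite !gt_eqF.
(* The integral of the power 2/m is bounded by 2 * [sum_const] times the size factor to the power
   2/m; taking the norm raises this to the power m/2. The added 1 makes the constant positive. *)
pose C := (2 * sum_const p n M q) `^ (p.+1%:R / 2) + 1.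
have sc0 := sum_const_ge0 p0 q1 qq0 qM.
have C0 : 0 < C by rewrite ltr_wpDl ?powR_ge0.
exists C; split=> // sigma D0 [mR mI sfin] [CR CI] sD f fS; rewrite tE; cbv zeta.
set t := q / qcrit R p.
have t0 : 0 < t by rewrite divr_gt0.
have t1 : 0 < 1 - t by rewrite subr_gt0 ltr_pdivrMr// mul1r.
have sq : rintegrable (lebesgue_mx p.+1 n) (fun x => cmod (sigma x) `^ q).
  exact: cLnorm_fin.
rewrite (cLnorm_EFin q_gt0 sq) poweR_EFin; set S := (_ `^ q^-1).
have S0 : 0 <= S by exact: powR_ge0.
have Sq : S `^ q = \int[lebesgue_mx p.+1 n]_x cmod (sigma x) `^ q.
  rewrite -powRrM mulVf ?gt_eqF// powRr1//.
  by apply: Rintegral_ge0 => x _; exact: powR_ge0.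
pose V j := (\int[lebesgue_rV n]_x cmod (f j x) `^ 2) `^ 2^-1.
have fsq j : rintegrable (lebesgue_rV n) (fun x => cmod (f j x) `^ 2).
  rewrite (_ : (fun _ => _) = fun x => cmod (f j x) ^+ 2); last first.
    by apply/funext => x; rewrite powR_mulrn ?cmod_ge0.
  exact: schwartz_cmod_sqr.
have V0 j : 0 <= V j by exact: powR_ge0.
have V2 j : V j ^+ 2 = \int[lebesgue_rV n]_x cmod (f j x) ^+ 2.
  rewrite -powR_mulrn// -powRrM mulVf// powRr1.
    by apply: eq_Rintegral => x _; rewrite powR_mulrn ?cmod_ge0.
  by apply: Rintegral_ge0 => x _; exact: powR_ge0.
have -> : (\prod_(j < p.+1) cLnorm (lebesgue_rV n) 2%:E (f j))%E = (\prod_j V j)%:E.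
  rewrite (big_morph EFin (@EFinM R) (erefl _)); apply: eq_bigr => j _.
  exact: cLnorm_EFin.
rewrite -!EFinM.
have bnd l i j x : (l <= M)%N ->
    `|iter l (partial i j) (fun y => complex.Re (sigma y)) x| <= D0 /\
    `|iter l (partial i j) (fun y => complex.Im (sigma y)) x| <= D0.
  move=> lM; have := sD (mdelta l i j); rewrite mdeg_mdelta => /(_ lM) h.
  have cont (g : 'M[R]_(p.+1, n) -> R) : Ck_real M g -> continuous (iter l (partial i j) g).
    move=> Cg; apply: (@Ck_real_continuous _ _ _ (M - l)%N).
    by apply: Ck_real_iter; rewrite subnKC.
  have {}h : cmod (mpartial (mdelta l i j) sigma x) <= D0.
    apply: Linfty_bound h x.
      by rewrite /mpartial/= mpartial_mdelta; exact: cont.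
    by rewrite /mpartial/= mpartial_mdelta; exact: cont.
  have := le_trans (Re_le_cmod _) h; have := le_trans (Im_le_cmod _) h.
  by rewrite /mpartial/= !mpartial_mdelta.
(* The bound on the symbol at a single point shows that [D0] is nonnegative; the index [ord0] exists
   since both dimensions are positive. *)
have D00 : 0 <= D0.
  by have [+ _] := bnd 0%N ord0 ord0 0 isT; apply: le_trans.
have adm (g : 'M[R]_(p.+1, n) -> R) (e : R) : 0 < e -> Ck_real M g ->
    (forall l i j x, (l <= M)%N -> `|iter l (partial i j) g x| <= D0) ->
    (forall x, `|g x| <= cmod (sigma x)) -> admissible M q (D0 + e) (S + e) g.
  move=> e0 Cg gD gs.
  have D0e : D0 <= D0 + e by rewrite lerDl ltW.
  have mg : measurable_fun setT (fun x => `|g x| `^ q).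
    apply: (measurableT_comp (measurable_powR q)).
    apply: (measurableT_comp (@normr_measurable R setT)).
    by apply: continuous_mx_measurable; exact: Ck_real_continuous Cg.
  have gsq x : `|g x| `^ q <= cmod (sigma x) `^ q.
    by apply: ge0_ler_powR; rewrite ?nnegrE ?cmod_ge0// ltW.
  have ig : rintegrable (lebesgue_mx p.+1 n) (fun x => `|g x| `^ q).
    by apply: (rintegrable_le mg sq) => x; rewrite ger0_norm ?powR_ge0.
  split => //.
  - by move=> x; apply: le_trans D0e; exact: (gD 0%N ord0 ord0).
  - by move=> i j x; apply: le_trans D0e; exact: gD.
  - apply: (le_trans (le_Rintegral measurableT ig sq (fun x _ => gsq x))).
    rewrite -Sq; apply: ge0_ler_powR; rewrite ?nnegrE ?addr_ge0 ?(ltW e0) ?(ltW q_gt0)//.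
    by rewrite lerDl ltW.
(* [multiplier_op_bound] needs strictly positive bounds: enlarge all of them by
   [1 / (k + 1)] and let [k] tend to infinity. *)
apply: (@ereal_le_cvg _ _ (fun k => C * (D0 + k.+1%:R^-1) `^ (1 - t) *
    (S + k.+1%:R^-1) `^ t * \prod_j (V j + k.+1%:R^-1))).
- exact: Lnorm_ge0.
- move=> k; set e : R := k.+1%:R^-1; have e0 : 0 < e by rewrite invr_gt0 ltr0n.
  have r0 : 0 < 2 / p.+1%:R :> R by rewrite divr_gt0.
  have v0 j : 0 < V j + e by rewrite ltr_wpDl.
  have fv j : \int[lebesgue_rV n]_x cmod (f j x) ^+ 2 <= (V j + e) ^+ 2.
    by rewrite -V2 lerXn2r ?nnegrE ?(ltW (v0 j))// lerDl ltW.
  have De0 : 0 < D0 + e by rewrite ltr_wpDl.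
  have Se0 : 0 < S + e by rewrite ltr_wpDl.
  have aRe := adm _ e e0 CR (fun l i j x lM => (bnd l i j x lM).1)
    (fun x => Re_le_cmod (sigma x)).
  have aIm := adm _ e e0 CI (fun l i j x lM => (bnd l i j x lM).2)
    (fun x => Im_le_cmod (sigma x)).
  have := multiplier_op_bound p0 M0 q1 qq0 qM fS v0 fv De0 Se0 aRe aIm.
  set z := size_factor _ _ _ _.
  have z0 : 0 <= z.
    rewrite !mulr_ge0 ?powR_ge0//; apply: prodr_ge0 => j _; exact/ltW.
  have -> : C * (D0 + e) `^ (1 - t) * (S + e) `^ t * \prod_j (V j + e) = C * z.
    by rewrite /z /size_factor -!mulrA.
  move=> h; apply: (@le_trans _ _ ((2 * sum_const p n M q) `^ (p.+1%:R / 2) * z)%:E).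
    apply: cLnorm_le => //; first by rewrite mulr_ge0 ?powR_ge0.
    rewrite powRM ?powR_ge0// -powRrM [_ / 2 * _](_ : _ = 1); last first.
      by field; rewrite gt_eqF.
    rewrite powRr1; last by rewrite mulr_ge0.
    by rewrite mulrA in h.
  by rewrite lee_fin ler_wpM2r// lerDl.
have ck (x : R) := @cvg_add_inv R x.
apply: cvgM; last by apply: cvg_bigprod => j; exact: ck.
apply: cvgM; last first.
  by apply: powR_cvg => // k; rewrite addr_ge0// invr_ge0.
apply: cvgM; first exact: cvg_cst.
by apply: powR_cvg => // k; rewrite addr_ge0// invr_ge0.
Qed.
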